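(* Let $B\subset\mathbb{R}^2$ be the open unit ball, and for $\varepsilon\ge1$ let $$\mathbb{D}_\varepsilon(v)=\int_B\frac1\varepsilon\big|\nabla v(x)^T\hat x\big|^2+\varepsilon\big|(\mathrm{adj}\,\nabla v(x))\,\hat x\big|^2\,dx ,\qquad \hat x=\frac{x}{|x|}.$$ In the regime $1<\varepsilon<\sqrt2$ the identity map is the unique global minimizer of $\mathbb{D}_\varepsilon$ in the class $$\mathcal{A}^c=\{v\in W^{1,2}(B,\mathbb{R}^2): v|_{\partial B}=\mathrm{Id},\ \det\nabla v=1\text{ a.e. in }B\}.$$ Moreover, in the limiting case $\varepsilon=\sqrt2$ the identity is a (not necessarily unique) global minimizer of $\mathbb{D}_\varepsilon$ in $\mathcal{A}^c$.
   Context: $\mathrm{adj}\,A$ denotes the adjugate matrix of $A$ (the transpose of the cofactor matrix). Boundary values are understood in the trace sense. *)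

(* Defs.v *)
From mathcomp Require Import all_boot all_order all_algebra.
From mathcomp Require Import all_classical all_reals all_analysis.

Set Implicit Arguments.
Unset Strict Implicit.
Unset Printing Implicit Defensive.
Import Order.TTheory GRing.Theory Num.Theory numFieldNormedType.Exports.
Local Open Scope classical_set_scope.
Local Open Scope ring_scope.

(* The plane is R * R with the product of the library's measurable lines
   [measurableTypeR R]. Its library norm is the max norm, so Euclidean lengths
   are spelled out. *)
Definition plane (R : realType) := (measurableTypeR R * measurableTypeR R)%type.

Definition coord (R : realType) (i : 'I_2) (p : R * R) : R :=
  if i == ord0 then p.1 else p.2.

Definition basis (R : realType) (j : 'I_2) : R * R :=
  if j == ord0 then (1, 0) else (0, 1).

Definition vec (R : realType) (p : R * R) : 'cV[R]_2 := \col_i coord i p.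

Definition sqnorm (R : realType) (w : 'cV[R]_2) : R := \sum_i w i 0 ^+ 2.

(* Equals 0 at the origin (a null set), since 0^-1 = 0. *)
Definition hat (R : realType) (p : R * R) : 'cV[R]_2 :=
  (Num.sqrt (sqnorm (vec p)))^-1 *: vec p.

Definition unit_ball (R : realType) : set (plane R) :=
  [set p | sqnorm (vec p) < 1].
Arguments unit_ball R : clear implicits.

Definition leb2 (R : realType) : {measure set (plane R) -> \bar R} :=
  (@lebesgue_measure R \x @lebesgue_measure R)%E.

Definition partial (R : realType) (j : 'I_2) (f : R * R -> R) (x : R * R) : R :=
  'D_(basis R j) f x.

Fixpoint Cn (R : realType) (n : nat) (f : R * R -> R) : Prop :=
  continuous f /\
  if n is m.+1 then
    forall j, (forall x, derivable f x (basis R j)) /\ Cn m (partial j f)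
  else True.

Definition smooth (R : realType) (f : R * R -> R) : Prop := forall n, Cn n f.

Definition test_function (R : realType) (phi : R * R -> R) : Prop :=
  smooth phi /\
  exists K : set (R * R),
    [/\ compact K, K `<=` unit_ball R & forall x, ~ K x -> phi x = 0].

Definition L2 (R : realType) (u : R * R -> R) : Prop :=
  measurable_fun (unit_ball R) u /\
  (leb2 R).-integrable (unit_ball R) (fun x => (u x ^+ 2)%:E).

Definition weak_gradient (R : realType) (u : R * R -> R)
    (g : R * R -> 'rV[R]_2) : Prop :=
  forall j : 'I_2,
    L2 (fun x => g x 0 j) /\
    forall phi, test_function phi ->
      \int[leb2 R]_(x in unit_ball R) (u x * partial j phi x) =
      - \int[leb2 R]_(x in unit_ball R) (g x 0 j * phi x).

Definition W12 (R : realType) (u : R * R -> R) : Prop :=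
  L2 u /\ exists g, weak_gradient u g.

(* Weak gradients are unique up to null sets; this picks one of them. *)
Definition wgrad (R : realType) (u : R * R -> R) : R * R -> 'rV[R]_2 :=
  xget (fun _ => 0) [set g | weak_gradient u g].

(* [g] is the trace on the unit circle of [u] in W^{1,2} of the unit disc. The
   trace operator is the continuous extension, from W^{1,2} to L^2 of the
   circle, of the restriction map on functions smooth up to the boundary. *)
Definition has_trace (R : realType) (u g : R * R -> R) : Prop :=
  exists U : nat -> R * R -> R,
    [/\ forall k, smooth (U k),
        (fun k => \int[leb2 R]_(x in unit_ball R)
                    ((U k x - u x) ^+ 2)%:E)%E @ \oo --> 0%E,
        forall j : 'I_2,
          (fun k => \int[leb2 R]_(x in unit_ball R)
                      ((partial j (U k) x - wgrad u x 0 j) ^+ 2)%:E)%E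
            @ \oo --> 0%E
      & (fun k => \int[@lebesgue_measure R]_(t in `[0%R, (2 * pi)%R])
                    ((U k (cos t, sin t) - g (cos t, sin t)) ^+ 2)%:E)%E
            @ \oo --> 0%E].

(* Rows are indexed by the components of [v]: entry (i, j) is d_j v_i. *)
Definition nabla (R : realType) (v : R * R -> R * R) (x : R * R) : 'M[R]_2 :=
  \matrix_(i, j) wgrad (fun y => coord i (v y)) x 0 j.

Definition Denergy (R : realType) (eps : R) (v : R * R -> R * R) : \bar R :=
  (\int[leb2 R]_(x in unit_ball R)
     (eps^-1 * sqnorm ((nabla v x)^T *m hat x)
      + eps * sqnorm (\adj (nabla v x) *m hat x))%:E)%E.

Definition Ac (R : realType) : set (R * R -> R * R) :=
  [set v | [/\ forall i : 'I_2, W12 (fun x => coord i (v x)),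
               forall i : 'I_2, has_trace (fun x => coord i (v x)) (coord i)
             & {ae leb2 R, forall x, unit_ball R x -> \det (nabla v x) = 1}]].

Arguments Ac R : clear implicits.

Definition global_minimizer (R : realType) (T : Type) (E : T -> \bar R)
    (A : set T) (u : T) : Prop :=
  A u /\ forall w, A w -> (E u <= E w)%E.

(* Main.v *)
Require Import Defs.
From HB Require Import structures.
From mathcomp Require Import all_boot all_order all_algebra.
From mathcomp Require Import all_classical all_reals all_analysis.
From mathcomp Require Import measurable_realfun.
From mathcomp Require Import ring lra.
Import Order.TTheory GRing.Theory Num.Theory numFieldNormedType.Exports.
Local Open Scope classical_set_scope.
Local Open Scope ring_scope.

Set Implicit Arguments.
Unset Strict Implicit.
Unset Printing Implicit Defensive.

(** Write [F] for the gradient of the displacement [v - id], with rows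
    [(a, b)] and [(c, d)], let [h] be the radial unit vector, [t] its quarter
    turn, [r = |x|], and put [c0 = eps - 1 / eps >= 0]. Expanding the density
    around the identity gives, pointwise,
      W(I + F) - W(I)
        = (2 / eps) tr F + 2 c0 (F t . t) + (1 / eps) |F|^2 + c0 |adj F h|^2.
    The last term is nonnegative and [tr F] integrates to zero, because the
    displacement vanishes on the circle. The linear term in [F t . t], which
    has no sign, is treated with the logarithm of [r] as a pressure:

    - the divergence theorem gives [int (ln r) tr F + F t . t = 0];
    - the constraint [det (I + F) = 1] reads [tr F = - det F], hence
      [2 int F t . t = int 2 (ln r) det F];
    - [det F] is a divergence, so an integration by parts turns the right-hand
      side into minus the integral of [r^-2] times twice the area swept by
      the displacement along circles. Wirtinger's inequality on each circle, in
      isoperimetric form and with its sharp constant, bounds it from below by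
      [- int |F t|^2 >= - int |F|^2].

    Altogether the energy of [v] exceeds that of the identity by at least
    [(1 / eps - c0) int |F|^2 = (2 / eps - eps) int |F|^2]. The factor is
    nonnegative exactly when [eps <= sqrt 2], and when it is positive a
    minimizer has [F = 0], hence equals the identity by its boundary values.

    Three points turn this into a proof. The singular weights [ln r] and
    [r^-2] are replaced by [log_weight e] and [inv_weight e], which still
    satisfy that the first vanishes on the circle and has gradient the second
    times [x]; the error they cause disappears as [e] tends to 0
    ([energy_excess]). The identities are proved for smooth maps
    ([integral_log_weight_divergence], [integral_log_weight_det],
    [weighted_wirtinger]) and pass to the limit along the smooth maps by which
    the trace is defined, since they are at most quadratic in the gradient.
    Polar coordinates are avoided: the divergence theorem is proved by slicing,
    and the inequality on circles is integrated over the disc by averaging over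
    rotations, which preserve area ([rotation_average_ge0]).

    The chosen weak gradient of the identity is known only through its
    defining property, so that the fundamental lemma of the calculus of
    variations ([test_function_ae0]) enters to show that it is the identity
    matrix almost everywhere. *)

(** * Continuous functions on the plane and on the disc *)

Section continuity.
Context {R : realType} {T : topologicalType}.
Implicit Types f g : T -> R.

Lemma contD f g : continuous f -> continuous g -> continuous (fun x => f x + g x).
Proof. by move=> cf cg x; apply: cvgD; [exact: cf|exact: cg]. Qed.

Lemma contN f : continuous f -> continuous (fun x => - f x).
Proof. by move=> cf x; apply: cvgN; exact: cf. Qed.

Lemma contB f g : continuous f -> continuous g -> continuous (fun x => f x - g x).
Proof. by move=> cf cg; apply: contD => //; exact: contN. Qed.

Lemma contM f g : continuous f -> continuous g -> continuous (fun x => f x * g x).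
Proof. by move=> cf cg x; apply: cvgM; [exact: cf|exact: cg]. Qed.

Lemma contX f n : continuous f -> continuous (fun x => f x ^+ n).
Proof.
move=> cf; elim: n => [|n IH]; first by move=> x; exact: cvg_cst.
by under eq_fun do rewrite exprS; exact: contM.
Qed.

Lemma contC (c : R) : continuous (fun _ : T => c).
Proof. by move=> x; exact: cvg_cst. Qed.

Lemma cont_comp (h : R -> R) f : continuous h -> continuous f -> continuous (fun x => h (f x)).
Proof. by move=> ch cf x; apply: continuous_comp; [exact: cf|exact: ch]. Qed.

Lemma cont_pair (U : topologicalType) (h : R * R -> U) f g :
  continuous h -> continuous f -> continuous g -> continuous (fun x => h (f x, g x)).
Proof.
by move=> ch cf cg x; apply: (cvg_comp _ _ (cvg_pair (cf x) (cg x))); exact: (ch (f x, g x)).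
Qed.

End continuity.

Section plane_measure.
Context {R : realType}.
Implicit Types f g : R * R -> R.
Local Notation B := (unit_ball R).

Lemma rational_bracket (z e : R) : 0 < e -> exists2 r : rat * rat,
  z - e < ratr r.1 & (ratr r.1 < z) && (z < ratr r.2 < z + e).
Proof.
move=> e0.
have [r1 r1P] : exists r : rat, ratr r \in `]z - e, z[.
  by have [] := @rat_in_itvoo R (z - e) z; [lra | move=> r ?; exists r].
have [r2 r2P] : exists r : rat, ratr r \in `]z, z + e[.
  by have [] := @rat_in_itvoo R z (z + e); [lra | move=> r ?; exists r].
move: r1P r2P; rewrite !in_itv/= => /andP[h1 h2] h3.
by exists (r1, r2) => //=; rewrite h2.
Qed.

(** The product sigma-algebra of the plane contains the topology, because an
    open set is the countable union of the rational boxes that it contains. *)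
Lemma open_measurable_plane (U : set (R * R)) :
  open U -> measurable (U : set (plane R)).
Proof.
move=> oU.
pose box (i : (rat * rat) * (rat * rat)) : set (plane R) :=
  `]ratr i.1.1, ratr i.1.2[%classic `*` `]ratr i.2.1, ratr i.2.2[%classic.
have -> : (U : set (plane R)) =
    \bigcup_i (if i \in [set i | box i `<=` U] then box i else set0).
  rewrite -bigcup_mkcond.
  apply/seteqP; split => [[x y] Uxy|z [i bi]]; last exact: bi.
  have /nbhs_ballP[e /= e0 eU] := open_nbhs_nbhs (conj oU Uxy).
  have [r rx1 /andP[rx2 /andP[rx3 rx4]]] := rational_bracket x e0.
  have [s sy1 /andP[sy2 /andP[sy3 sy4]]] := rational_bracket y e0.
  exists (r, s) => /=; last by rewrite /box/= !in_itv/= rx2 rx3 sy2 sy3.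
  move=> [a b] [] /=; rewrite !in_itv/= => /andP[ra ar] /andP[sb bs].
  by apply: eU; split => /=; rewrite /ball/= ltr_norml; lra.
apply: countable_bigcupT_measurable => // i.
by case: ifPn => _ //; exact: measurableX.
Qed.

Lemma continuous_measurable_plane f :
  continuous f -> measurable_fun [set: plane R] f.
Proof.
move=> cf; apply: (measurability _ (RGenOpens.measurableE R)).
move=> _ [_ [a [b ->] <-]]; rewrite setTI; apply: open_measurable_plane.
by apply: open_comp => // z _; exact: cf.
Qed.

Lemma unit_ballP (p : R * R) : B p <-> p.1 ^+ 2 + p.2 ^+ 2 < 1.
Proof. by rewrite /unit_ball/= /sqnorm big_ord_recl big_ord1 /vec !mxE. Qed.

Lemma continuous_fst2 : continuous (fst : R * R -> R).
Proof. by move=> x; exact: cvg_fst. Qed.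

Lemma continuous_snd2 : continuous (snd : R * R -> R).
Proof. by move=> x; exact: cvg_snd. Qed.

Lemma open_unit_ball : open (B : set (R * R)).
Proof.
have -> : B = (fun p : R * R => p.1 ^+ 2 + p.2 ^+ 2) @^-1` `]-oo, 1[.
  by apply/seteqP; split => p; rewrite /= in_itv/= => /unit_ballP.
apply: open_comp; last exact: interval_open.
by move=> p _; apply: contD; apply: contX; [exact: continuous_fst2|exact: continuous_snd2].
Qed.

Lemma measurable_unit_ball : measurable B.
Proof. exact: open_measurable_plane open_unit_ball. Qed.

Lemma unit_ball_sub_square :
  B `<=` `[(-1)%R, 1%R]%classic `*` `[(-1)%R, 1%R]%classic.
Proof.
by move=> [x y] /unit_ballP /= xy; split; rewrite /= in_itv/=; apply/andP; split; nra.
Qed.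

Lemma leb2X (A D : set (measurableTypeR R)) : measurable A -> measurable D ->
  leb2 R (A `*` D) = (@lebesgue_measure R A * @lebesgue_measure R D)%E.
Proof. by move=> mA mD; exact: product_measure1E. Qed.

Lemma leb2_unit_ball_lty : (leb2 R B < +oo)%E.
Proof.
have KB : (leb2 R (`[(-1)%R, 1%R]%classic `*` `[(-1)%R, 1%R]%classic) < +oo)%E.
  by rewrite leb2X// !lebesgue_measure_itv/= lte_fin ifT ?ltry//; lra.
apply: le_lt_trans KB; apply: le_measure; last exact: unit_ball_sub_square.
- by rewrite inE; exact: measurable_unit_ball.
- by rewrite inE; exact: measurableX.
Qed.

Lemma continuous_bounded_ball f : continuous f -> [bounded f x | x in B].
Proof.
move=> cf.
have cK : compact (`[(-1)%R, 1%R]%classic `*` `[(-1)%R, 1%R]%classic : set (R * R)).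
  by apply: compact_setX; exact: segment_compact.
have /compact_bounded[M [_ MB]] :=
  continuous_compact (continuous_subspaceT cf) cK.
exists M; split; rewrite ?num_real // => k Mk p Bp; apply: MB => //.
by exists p => //; exact: unit_ball_sub_square.
Qed.

Lemma integrable_continuous_ball f :
  continuous f -> (leb2 R).-integrable B (EFin \o f).
Proof.
move=> cf; apply: measurable_bounded_integrable.
- exact: measurable_unit_ball.
- exact: leb2_unit_ball_lty.
- by apply: measurable_funTS; exact: continuous_measurable_plane.
- exact: continuous_bounded_ball.
Qed.

End plane_measure.

(** * Primitives on the line *)

Section primitives.
Context {R : realType}.
Local Notation leb := (@lebesgue_measure R).
Implicit Types f F : R -> R.

Lemma Rintegral_derive F f (a b : R) : a <= b -> continuous f ->
  (forall x, is_derive x (1 : R) F (f x)) ->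
  \int[leb]_(x in `[a, b]) f x = F b - F a.
Proof.
rewrite le_eqVlt => /predU1P[<- _ _|ab cf dF].
  by rewrite set_itv1 Rintegral_set1 subrr.
have cF : continuous F by move=> x; apply/differentiable_continuous/derivable1_diffP.
rewrite /Rintegral (continuous_FTC2 ab _ _ (F := F)) //.
- exact: continuous_subspaceT.
- split => //.
  + by apply: cvg_at_right_filter; exact: cF.
  + by apply: cvg_at_left_filter; exact: cF.
- by move=> x _; rewrite derive1E derive_val.
Qed.

Lemma integrable_continuous_itv f (a b : R) : continuous f ->
  leb.-integrable `[a, b] (EFin \o f).
Proof.
move=> cf; apply: continuous_compact_integrable; first exact: segment_compact.
exact: continuous_subspaceT.
Qed.

(** The primitive has to exist on the whole line. Integrating from 0 with the
    sign convention of oriented integrals, the fundamental theorem is applied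
    near [x] on an interval whose left end [M] lies below both 0 and [x]. *)
Lemma continuous_primitive f : continuous f ->
  exists F, forall x, is_derive x (1 : R) F (f x).
Proof.
move=> cf.
pose I (a b : R) := \int[leb]_(x in `[a, b]) f x.
have Ichasles a b c : a <= b -> b <= c -> I a b + I b c = I a c.
  move=> ab bc; suff : I a c - I a b = I b c by move=> <-; rewrite addrC subrK.
  have ibc : leb.-integrable `]b, c] (EFin \o f).
    apply: integrableS (integrable_continuous_itv b c cf) => //.
    by apply: subset_itvr; rewrite bnd_simp.
  rewrite {1 2}/I Rintegral_itvB ?bnd_simp//; last exact: integrable_continuous_itv.
  by rewrite Rintegral_itv_obnd_cbnd.
exists (fun x => if 0 <= x then I 0 x else - I x 0) => x.
pose M := - `|x| - 1.
have Mx : M < x by rewrite /M; have := ler_norm (- x); rewrite normrN; lra.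
have M0 : M < 0 by rewrite /M; have := normr_ge0 x; lra.
have x1 : x < x + 1 by lra.
have iM : leb.-integrable `[M, x + 1] (EFin \o f) by exact: integrable_continuous_itv.
have [dI DI] := continuous_FTC1_closed x1 iM Mx (cf x).
have dM : is_derive x (1 : R) (fun y => I M y - I M 0) (f x).
  rewrite -[f x]subr0; apply: is_deriveB.
  by rewrite -DI derive1E; exact/derivableP.
apply: near_eq_is_derive dM; near=> y.
have My : M < y by near: y; exact: lt_nbhsr.
case: (leP 0 y) => y0.
  by have := Ichasles M 0 y (ltW M0) y0; lra.
by have := Ichasles M y 0 (ltW My) (ltW y0); lra.
Unshelve. all: by end_near. Qed.
End primitives.

Lemma ord2P (P : 'I_2 -> Prop) : P ord0 -> P (lift ord0 ord0) -> forall i, P i.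
Proof.
move=> P0 P1 [[|[|//]] lti].
  by rewrite (_ : Ordinal lti = ord0)//; exact: val_inj.
by rewrite (_ : Ordinal lti = lift ord0 ord0)//; exact: val_inj.
Qed.

(** * Partial derivatives as derivatives along lines *)

Section lines.
Context {R : realType}.

(** Directional derivatives only see the restriction to a line, so that
    one-variable calculus applies to the partial derivatives. *)
Lemma is_derive_lineP (V W : normedModType R) (f : V -> W) (x v : V) (d : W) :
  is_derive x v f d <-> is_derive (0 : R) (1 : R) (fun h : R => f (h *: v + x)) d.
Proof.
have E : (fun h : R => h^-1 *: ((f \o shift x) (h *: v) - f x)) =
   (fun h : R => h^-1 *: (((fun h : R => f (h *: v + x)) \o shift 0) (h *: (1:R)) - f ((0 : R) *: v + x))).
  by apply/funext => h /=; rewrite addr0 scale0r add0r /GRing.scale/= mulr1.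
by split => -[h1 h2]; split; [move: h1|rewrite -h2|move: h1|rewrite -h2]; rewrite /derivable /derive E.
Qed.

Lemma is_derive_fst_lineP (f : R * R -> R) (x y d : R) :
  is_derive (x, y) (Defs.basis R ord0) f d <-> is_derive x (1 : R) (fun t => f (t, y)) d.
Proof.
rewrite is_derive_lineP [X in _ <-> X]is_derive_lineP.
suff -> : (fun h : R => f (h *: Defs.basis R ord0 + (x, y))) = (fun h : R => f (h *: (1 : R) + x, y)) by [].
by apply/funext => h; congr (f _); apply: injective_projections ; rewrite /= ?mulr0 ?scaler0 ?add0r.
Qed.

Lemma is_derive_snd_lineP (f : R * R -> R) (x y d : R) :
  is_derive (x, y) (Defs.basis R (lift ord0 ord0)) f d <-> is_derive y (1 : R) (fun t => f (x, t)) d.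
Proof.
rewrite is_derive_lineP [X in _ <-> X]is_derive_lineP.
suff -> : (fun h : R => f (h *: Defs.basis R (lift ord0 ord0) + (x, y))) = (fun h : R => f (x, h *: (1 : R) + y)) by [].
by apply/funext => h; congr (f _); apply: injective_projections ; rewrite /= ?mulr0 ?scaler0 ?add0r.
Qed.

End lines.

Section C1_along.
Context {R : realType}.
Implicit Types f g df dg : R * R -> R.

(** The regularity that a single term of a divergence needs: the derivative in
    one direction, carried along explicitly so that the calculus below computes
    it. *)
Definition C1_along (j : 'I_2) f df :=
  [/\ continuous f, continuous df & forall p, is_derive p (Defs.basis R j) f (df p)].

Lemma C1D j f df g dg : C1_along j f df -> C1_along j g dg ->
  C1_along j (fun p => f p + g p) (fun p => df p + dg p).
Proof.
by case=> cf cdf Df [cg cdg Dg]; split; [exact: contD..|move=> p; exact: is_deriveD].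
Qed.

Lemma C1N j f df : C1_along j f df -> C1_along j (fun p => - f p) (fun p => - df p).
Proof. by case=> cf cdf Df; split; [exact: contN..|move=> p; exact: is_deriveN]. Qed.

Lemma C1B j f df g dg : C1_along j f df -> C1_along j g dg ->
  C1_along j (fun p => f p - g p) (fun p => df p - dg p).
Proof. by move=> Df Dg; apply: C1D => //; exact: C1N. Qed.

Lemma C1M j f df g dg : C1_along j f df -> C1_along j g dg ->
  C1_along j (fun p => f p * g p) (fun p => f p * dg p + g p * df p).
Proof.
case=> cf cdf Df [cg cdg Dg]; split; first exact: contM.
  by apply: contD; exact: contM.
by move=> p; exact: is_deriveM.
Qed.

Lemma C1C j (c : R) : C1_along j (fun _ => c) (fun _ => 0).
Proof. by split; [exact: contC..|move=> p; exact: is_derive_cst]. Qed.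

Lemma C1_comp j (h dh : R -> R) f df :
  (forall p, {for f p, continuous dh}) ->
  (forall p, is_derive (f p) (1 : R) h (dh (f p))) -> C1_along j f df ->
  C1_along j (fun p => h (f p)) (fun p => dh (f p) * df p).
Proof.
move=> cdh Dh [cf cdf Df]; split.
- move=> p; apply: continuous_comp; first exact: cf.
  by apply/differentiable_continuous/derivable1_diffP; case: (Dh p).
- apply: contM => // p; apply: (@continuous_comp _ _ _ f dh); [exact: cf|exact: cdh].
move=> p; apply/is_derive_lineP.
have /is_derive_lineP Dfp := Df p.
have E : f p = f ((0 : R) *: Defs.basis R j + p) by rewrite scale0r add0r.
have Dhp : is_derive (f ((0 : R) *: Defs.basis R j + p)) (1 : R) h (dh (f p)) by rewrite -E.
exact: is_derive1_comp Dhp Dfp.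
Qed.

Lemma C1_eq j f df f' df' : f =1 f' -> df =1 df' -> C1_along j f df -> C1_along j f' df'.
Proof. by move=> /funext -> /funext ->. Qed.

Lemma C1_fst j : C1_along j fst (fun _ => (j == ord0)%:R).
Proof.
split; [exact: continuous_fst2|exact: contC|move=> [x y]].
elim/ord2P: j.
  by apply/is_derive_fst_lineP => /=; exact: is_derive_id.
by apply/is_derive_snd_lineP => /=; exact: is_derive_cst.
Qed.

Lemma C1_snd j : C1_along j snd (fun _ => (j != ord0)%:R).
Proof.
split; [exact: continuous_snd2|exact: contC|move=> [x y]].
elim/ord2P: j.
  by apply/is_derive_fst_lineP => /=; exact: is_derive_cst.
by apply/is_derive_snd_lineP => /=; exact: is_derive_id.
Qed.

Lemma C1_coord (i j : 'I_2) : C1_along j (@Defs.coord R i) (fun _ => (i == j)%:R).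
Proof.
elim/ord2P: i; first by apply: C1_eq (C1_fst j) => // p; rewrite eq_sym.
by apply: C1_eq (C1_snd j) => // p; elim/ord2P: j.
Qed.

End C1_along.

(** * Integration of partial derivatives over slices of the disc *)

Section slices.
Context {R : realType}.
Local Notation leb := (@lebesgue_measure R).
Local Notation B := (unit_ball R).
Implicit Types f g : R * R -> R.

(** Half of the length of the chord of the unit circle at height [y]. It is 0
    when the line misses the disc, so that slices need no case distinction. *)
Definition half_chord (y : R) : R := Num.sqrt (1 - y ^+ 2).

Lemma continuous_half_chord : continuous half_chord.
Proof.
apply: (@cont_comp R _ (@Num.sqrt R)); first exact: sqrt_continuous.
apply: contB; first exact: contC.
by apply: (@contX _ _ id) => x; exact: cvg_id.
Qed.

Let unit_ball_half (x y : R) : (x ^+ 2 + y ^+ 2 < 1) = (- half_chord y < x < half_chord y).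
Proof.
transitivity (`|x| ^+ 2 < half_chord y ^+ 2); last first.
  by rewrite -ltr_norml ltr_pXn2r// ?nnegrE ?sqrtr_ge0.
rewrite real_normK ?num_real//.
have [y1|y1] := leP 0 (1 - y ^+ 2).
  by rewrite sqr_sqrtr// ltrBrDr.
rewrite /half_chord ler0_sqrtr ?ltW// expr0n/=.
by apply/idP/idP => H; exfalso; have := sqr_ge0 x; lra.
Qed.

Let unit_ball_asbool (x y : R) : ((x, y) \in B) = `[< x ^+ 2 + y ^+ 2 < 1 >].
Proof.
apply/idP/asboolP => [|H]; first by rewrite inE => /unit_ballP.
by rewrite inE; apply/unit_ballP.
Qed.

Let half_chord_out (y : R) : ~~ (-1 <= y <= 1) -> half_chord y = 0.
Proof.
move=> y1; apply: ler0_sqrtr; rewrite leNgt; apply: contra y1 => y1.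
by apply/andP; split; nra.
Qed.

Let integral_section (h H : R -> R) (y : R) :
  continuous h -> (forall x, is_derive x (1 : R) H (h x)) ->
  (\int[leb]_x (if `[< (x ^+ 2 + y ^+ 2 < 1)%R >] then (h x)%:E else 0) =
   (H (half_chord y) - H (- half_chord y))%:E)%E.
Proof.
move=> ch DH.
pose D : set R := `]- half_chord y, half_chord y[%classic.
transitivity (\int[leb]_(x in D) (h x)%:E)%E.
  rewrite [RHS]integral_mkcond; apply: eq_integral => x _.
  rewrite /patch; congr (if _ then _ else _).
  by rewrite unit_ball_half asboolb /D mem_setE in_itv.
rewrite /D {D}; have [s0|s0] := ltP 0 (half_chord y); last first.
  have -> : half_chord y = 0 by apply/eqP; rewrite eq_le s0 sqrtr_ge0.
  by rewrite oppr0 set_itvoo0 integral_set0 subrr.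
have s1 : - half_chord y <= half_chord y by lra.
have := Rintegral_derive s1 ch DH; rewrite /Rintegral => <-.
rewrite fineK; last first.
  by apply: integrable_fin_num => //; exact: integrable_continuous_itv.
have mh : measurable_fun [set: R] h by exact: continuous_measurable_fun.
rewrite -integral_itv_obnd_cbnd -?integral_itv_bndo_bndc//;
  by apply/measurable_EFinP; exact: measurable_funTS.
Qed.

(** By Fubini's theorem, and the fundamental theorem of calculus on each
    chord. *)
Lemma integral_partial_fst f g : C1_along ord0 f g ->
  \int[leb2 R]_(p in B) g p =
  \int[leb]_(y in `[(-1)%R, 1%R]) (f (half_chord y, y) - f (- half_chord y, y)).
Proof.
case=> cf cg Dg; rewrite /Rintegral; congr fine.
rewrite integral_mkcond [RHS]integral_mkcond.
rewrite -integral21_prod_meas1; last first.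
  by rewrite -integrable_mkcond; [exact: integrable_continuous_ball|exact: measurable_unit_ball].
apply: eq_integral => y _; rewrite /fubini_G.
transitivity ((f (half_chord y, y) - f (- half_chord y, y))%:E).
  have cgy : continuous (fun x => g (x, y)).
    by apply: cont_pair => // x; [exact: cvg_id|exact: cvg_cst].
  have Dfy x : is_derive x (1 : R) (fun x => f (x, y)) (g (x, y)).
    exact/is_derive_fst_lineP.
  rewrite -(integral_section y cgy Dfy).
  by apply: eq_integral => x _; rewrite /patch unit_ball_asbool.
rewrite /patch mem_setE in_itv/=; case: ifPn => // /half_chord_out ->.
by rewrite oppr0 subrr.
Qed.

Lemma integral_partial_snd f g : C1_along (lift ord0 ord0) f g ->
  \int[leb2 R]_(p in B) g p =
  \int[leb]_(x in `[(-1)%R, 1%R]) (f (x, half_chord x) - f (x, - half_chord x)).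
Proof.
case=> cf cg Dg; rewrite /Rintegral; congr fine.
rewrite integral_mkcond [RHS]integral_mkcond.
rewrite -integral12_prod_meas1; last first.
  by rewrite -integrable_mkcond; [exact: integrable_continuous_ball|exact: measurable_unit_ball].
apply: eq_integral => x _; rewrite /fubini_F.
transitivity ((f (x, half_chord x) - f (x, - half_chord x))%:E).
  have cgx : continuous (fun y => g (x, y)).
    by apply: cont_pair => // y; [exact: cvg_cst|exact: cvg_id].
  have Dfx y : is_derive y (1 : R) (fun y => f (x, y)) (g (x, y)).
    exact/is_derive_snd_lineP.
  rewrite -(integral_section x cgx Dfx).
  by apply: eq_integral => y _; rewrite /patch unit_ball_asbool addrC.
rewrite /patch mem_setE in_itv/=; case: ifPn => // /half_chord_out ->.
by rewrite oppr0 subrr.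
Qed.

End slices.

(** * The divergence theorem on the disc *)

Section constancy.
Context {R : realType}.
Implicit Types K D : R -> R.

(** The derivative has to vanish only inside the interval: the parametrisations
    of half circles used below degenerate at their end points. *)
Lemma derive0_endpoints K D (a b : R) : a <= b ->
  (forall x, is_derive x (1 : R) K (D x)) -> (forall x, a < x < b -> D x = 0) ->
  K b = K a.
Proof.
rewrite le_eqVlt => /predU1P[-> //|ab DK D0].
have [|c cab] := MVT ab (fun x _ => DK x).
  apply: continuous_subspaceT => x.
  by apply/differentiable_continuous/derivable1_diffP; case: (DK x).
by move: cab; rewrite in_itv => /= /D0 ->; lra.
Qed.

Lemma derive_comp1 (h g : R -> R) (x a b : R) :
  is_derive (g x) (1 : R) h a -> is_derive x (1 : R) g b ->
  is_derive x (1 : R) (fun y => h (g y)) (a * b).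
Proof. exact: is_derive1_comp. Qed.

(** For functions of one real variable the derivative rules of normed modules
    are restated with products in place of scalings, and with eta-expanded
    functions, so that [ring] normalises the computed derivatives. *)
Lemma deriveD1 (f g : R -> R) (x a b : R) :
  is_derive x (1 : R) f a -> is_derive x (1 : R) g b ->
  is_derive x (1 : R) (fun y => f y + g y) (a + b).
Proof. by move=> Df Dg; exact: is_deriveD. Qed.

Lemma deriveB1 (f g : R -> R) (x a b : R) :
  is_derive x (1 : R) f a -> is_derive x (1 : R) g b ->
  is_derive x (1 : R) (fun y => f y - g y) (a - b).
Proof. by move=> Df Dg; exact: is_deriveB. Qed.

Lemma deriveM1 (f g : R -> R) (x a b : R) :
  is_derive x (1 : R) f a -> is_derive x (1 : R) g b ->
  is_derive x (1 : R) (fun y => f y * g y) (f x * b + g x * a).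
Proof. by move=> Df Dg; exact: is_deriveM. Qed.

Lemma deriveC1 (c x : R) : is_derive x (1 : R) (fun _ : R => c) 0.
Proof. exact: is_derive_cst. Qed.

Lemma derive_id1 (x : R) : is_derive x (1 : R) (fun y : R => y) 1.
Proof. exact: is_derive_id. Qed.

End constancy.

Section green.
Context {R : realType}.
Local Notation leb := (@lebesgue_measure R).
Local Notation B := (unit_ball R).
Implicit Types f g : R * R -> R.

Definition circle_integral (f : R * R -> R) : R :=
  \int[leb]_(t in `[0%R, (2 * pi)%R]) f (cos t, sin t).

Lemma contid : continuous (fun x : R => x).
Proof. by move=> x; exact: cvg_id. Qed.

Lemma continuous_circle f : continuous f -> continuous (fun t : R => f (cos t, sin t)).
Proof. by move=> cf; apply: cont_pair => //; [exact: continuous_cos|exact: continuous_sin]. Qed.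

Let half_chord_pyth (a b : R) : 0 <= b -> a ^+ 2 + b ^+ 2 = 1 -> half_chord a = b.
Proof.
move=> b0; rewrite /half_chord => <-; have -> : a ^+ 2 + b ^+ 2 - a ^+ 2 = b ^+ 2 by ring.
by rewrite sqrtr_sqr ger0_norm.
Qed.

(** On the right half circle the parametrisation [y = sin t] changes the
    integral over slices into a circle integral, and the reflection [pi - t]
    accounts for the left half. Instead of substituting in integrals one checks
    that the difference of the primitives has zero derivative. *)
Lemma green_fst f g : C1_along ord0 f g ->
  \int[leb2 R]_(p in B) g p = circle_integral (fun p => f p * p.1).
Proof.
move=> fg; have [cf cg Dg] := fg; rewrite (integral_partial_fst fg).
pose h (y : R) := f (half_chord y, y) - f (- half_chord y, y).
have ch : continuous h.
  by apply: contB; apply: cont_pair; [|exact: continuous_half_chord|exact: contid| |exact: (contN continuous_half_chord)|exact: contid].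
pose P (t : R) := f (cos t, sin t) * cos t.
have cP : continuous P by apply: contM; [exact: continuous_circle|exact: continuous_cos].
have [H DH] := continuous_primitive ch.
have [F DF] := continuous_primitive cP.
have pi2 := pi_gt0 R.
have N11 : -1 <= 1 :> R by lra.
have le2pi : 0 <= 2 * pi :> R by lra.
rewrite (Rintegral_derive N11 ch DH) /circle_integral (Rintegral_derive le2pi cP DF).
(* By periodicity the circle may be traversed from the south pole, so that
   the right and the left half circles are intervals of the angle. *)
have -> : F (2 * pi) - F 0 = F (3 / 2 * pi) - F (- (pi / 2)).
  pose K t := F (t + 2 * pi) - F t.
  suff : K 0 = K (- (pi / 2)) by rewrite /K add0r (_ : - (pi / 2) + 2 * pi = 3 / 2 * pi); lra.
  apply: (@is_derive_0_is_cst _ K) => t.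
  have <- : P (t + 2 * pi) * (1 + 0) - P t = 0.
    by rewrite /P mulr_natl cosD2pi sinD2pi addr0 mulr1 subrr.
  apply: is_deriveB; apply: derive_comp1.
pose K t := H (sin t) - F t + F (pi - t).
have HK : K (pi / 2) = K (- (pi / 2)).
  apply: (@derive0_endpoints _ K (fun t => h (sin t) * cos t - P t + P (pi - t) * (0 - 1))).
  - lra.
  - move=> t tpi; have ct : 0 < cos t by exact: cos_gt0_pihalf.
    have E : half_chord (sin t) = cos t.
      by apply: half_chord_pyth; [exact: ltW|rewrite addrC cos2Dsin2].
    have Ec : cos (pi - t) = - cos t by rewrite cosB cospi sinpi; ring.
    have Es : sin (pi - t) = sin t by rewrite sinB cospi sinpi; ring.
    by rewrite /h E /P Ec Es; ring.
move: HK; rewrite /K sin_pihalf sinN sin_pihalf.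
rewrite (_ : pi - pi / 2 = pi / 2); last by field.
rewrite (_ : pi - - (pi / 2) = 3 / 2 * pi); last by field.
lra.
Qed.

(** As for the first variable, with [x = cos t] on the upper half circle and the
    reflection [2 * pi - t] for the lower half. *)
Lemma green_snd f g : C1_along (lift ord0 ord0) f g ->
  \int[leb2 R]_(p in B) g p = circle_integral (fun p => f p * p.2).
Proof.
move=> fg; have [cf cg Dg] := fg; rewrite (integral_partial_snd fg).
pose h (x : R) := f (x, half_chord x) - f (x, - half_chord x).
have ch : continuous h.
  by apply: contB; apply: cont_pair; [|exact: contid|exact: continuous_half_chord| |exact: contid|exact: (contN continuous_half_chord)].
pose P (t : R) := f (cos t, sin t) * sin t.
have cP : continuous P by apply: contM; [exact: continuous_circle|exact: continuous_sin].
have [H DH] := continuous_primitive ch.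
have [F DF] := continuous_primitive cP.
have pi2 := pi_gt0 R.
have N11 : -1 <= 1 :> R by lra.
have le2pi : 0 <= 2 * pi :> R by lra.
rewrite (Rintegral_derive N11 ch DH) /circle_integral (Rintegral_derive le2pi cP DF).
pose K t := F t - F (2 * pi - t) + H (cos t).
have HK : K pi = K 0.
  apply: (@derive0_endpoints _ K (fun t => P t - P (2 * pi - t) * (0 - 1) + h (cos t) * - sin t)).
  - lra.
  - move=> t tpi; have st : 0 < sin t by exact: sin_gt0_pi.
    have E : half_chord (cos t) = sin t.
      by apply: half_chord_pyth; [exact: ltW|rewrite cos2Dsin2].
    have Ec : cos (2 * pi - t) = cos t by rewrite mulr_natl cosB cos2pi sin2pi; ring.
    have Es : sin (2 * pi - t) = - sin t by rewrite mulr_natl sinB cos2pi sin2pi; ring.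
    by rewrite /h E /P Ec Es; ring.
move: HK; rewrite /K cospi cos0 subr0.
by rewrite (_ : 2 * pi - pi = pi); [lra|ring].
Qed.

Lemma continuous_circle_integrable f : continuous f ->
  leb.-integrable `[0%R, (2 * pi)%R] (EFin \o (fun t => f (cos t, sin t))).
Proof. by move=> cf; apply: integrable_continuous_itv; exact: continuous_circle. Qed.

Lemma green f1 f2 g1 g2 : C1_along ord0 f1 g1 -> C1_along (lift ord0 ord0) f2 g2 ->
  \int[leb2 R]_(p in B) (g1 p + g2 p) =
  circle_integral (fun p => f1 p * p.1 + f2 p * p.2).
Proof.
move=> fg1 fg2; have [cf1 cg1 _] := fg1; have [cf2 cg2 _] := fg2.
rewrite RintegralD//; [|exact: measurable_unit_ball|exact: integrable_continuous_ball..].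
rewrite (green_fst fg1) (green_snd fg2) /circle_integral RintegralD//.
- by apply: (@continuous_circle_integrable (fun p => f1 p * p.1)); apply: contM => //; exact: continuous_fst2.
- by apply: (@continuous_circle_integrable (fun p => f2 p * p.2)); apply: contM => //; exact: continuous_snd2.
Qed.

End green.

(** * Equality of mixed partial derivatives *)

Section schwarz.
Context {R : realType}.
Local Notation j0 := (ord0 : 'I_2).
Local Notation j1 := (lift ord0 ord0 : 'I_2).

Lemma mean_value (F f : R -> R) (a h : R) : 0 < h ->
  (forall x, is_derive x (1 : R) F (f x)) ->
  exists2 c, a < c < a + h & F (a + h) - F a = f c * h.
Proof.
move=> h0 DF; have ah : a < a + h by lra.
have [|c cab E] := MVT ah (fun x _ => DF x).
  apply: continuous_subspaceT => x.
  by apply/differentiable_continuous/derivable1_diffP; case: (DF x).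
by exists c; [move: cab; rewrite in_itv|rewrite E; ring].
Qed.

(** The second difference of [f] over a small square of side [h] equals
    [h ^+ 2] times a value of either mixed derivative nearby. *)
Lemma mixed_partials (f f0 f1 f01 f10 : R * R -> R) :
  C1_along j0 f f0 -> C1_along j1 f f1 ->
  C1_along j1 f0 f01 -> C1_along j0 f1 f10 -> f01 =1 f10.
Proof.
move=> [_ _ Df0] [_ _ Df1] [_ c01 Df01] [_ c10 Df10] [a b].
apply/eqP/negPn/negP => ne.
pose e := `|f01 (a, b) - f10 (a, b)| / 2.
have e0 : 0 < e by rewrite divr_gt0// normr_gt0 subr_eq0.
have near01 (g : R * R -> R) : continuous g ->
    exists2 d : R, 0 < d & forall x y, a < x < a + d -> b < y < b + d -> `|g (a, b) - g (x, y)| < e.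
  move=> cg; have /cvgrPdist_lt/(_ e e0)/nbhs_ballP[d /= d0 H] := cg (a, b).
  exists d => // x y xd yd; apply: H; split => /=; rewrite /ball/= ltr_norml; lra.
have [d d0 H01] := near01 _ c01; have [d' d0' H10] := near01 _ c10.
pose h := Num.min d d'.
have h0 : 0 < h by rewrite lt_min d0.
have hd : h <= d by rewrite ge_min lexx.
have hd' : h <= d' by rewrite ge_min lexx orbT.
have [x xP E1] : exists2 x, a < x < a + h &
    (f (a + h, b + h) - f (a + h, b)) - (f (a, b + h) - f (a, b)) = (f0 (x, b + h) - f0 (x, b)) * h.
  apply: (mean_value (F := fun x => f (x, b + h) - f (x, b)) (f := fun x => f0 (x, b + h) - f0 (x, b))) => // x.
  by apply: deriveB1; apply/is_derive_fst_lineP.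
have [y yP E2] : exists2 y, b < y < b + h & f0 (x, b + h) - f0 (x, b) = f01 (x, y) * h.
  by apply: (mean_value (F := fun y => f0 (x, y)) (f := fun y => f01 (x, y))) => // y; apply/is_derive_snd_lineP.
have [y' yP' E3] : exists2 y, b < y < b + h &
    (f (a + h, b + h) - f (a, b + h)) - (f (a + h, b) - f (a, b)) = (f1 (a + h, y) - f1 (a, y)) * h.
  apply: (mean_value (F := fun y => f (a + h, y) - f (a, y)) (f := fun y => f1 (a + h, y) - f1 (a, y))) => // y0.
  by apply: deriveB1; apply/is_derive_snd_lineP.
have [x' xP' E4] : exists2 x', a < x' < a + h & f1 (a + h, y') - f1 (a, y') = f10 (x', y') * h.
  by apply: (mean_value (F := fun x => f1 (x, y')) (f := fun x => f10 (x, y'))) => // x0; apply/is_derive_fst_lineP.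
have E : f01 (x, y) = f10 (x', y').
  apply: (@mulIf _ h); first exact: lt0r_neq0.
  apply: (@mulIf _ h); first exact: lt0r_neq0.
  by rewrite -E2 -E1 -E4 -E3; ring.
have l1 : `|f01 (a, b) - f01 (x, y)| < e by apply: H01; lra.
have l2 : `|f10 (a, b) - f10 (x', y')| < e by apply: H10; lra.
have : `|f01 (a, b) - f10 (a, b)| <= `|f01 (a, b) - f01 (x, y)| + `|f10 (a, b) - f10 (x', y')|.
  by rewrite [X in _ <= _ + X]distrC E; apply: (le_trans _ (ler_normD _ _)); rewrite subrKA.
by rewrite /e in l1 l2; lra.
Qed.

End schwarz.

(** * Regularised logarithm and inverse square of the distance *)

Section weights.
Context {R : realType}.
Variable d : R.
Hypothesis d0 : 0 < d.
Implicit Types (p : R * R) (j : 'I_2).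

(** The regularised [r ^- 2] and, below it, the regularised [ln r], normalised to
    vanish on the unit circle; the gradient of the latter is the former times
    [x], as for the singular functions. *)
Definition inv_weight p : R := (p.1 ^+ 2 + p.2 ^+ 2 + d)^-1.

Definition log_weight p : R := 2^-1 * (ln (p.1 ^+ 2 + p.2 ^+ 2 + d) - ln (1 + d)).

Let N p := p.1 * p.1 + p.2 * p.2 + d.

Let N_gt0 p : 0 < N p.
Proof. by rewrite /N ltr_wpDl// addr_ge0// -expr2 sqr_ge0. Qed.

Let inv_weightE p : inv_weight p = (N p)^-1.
Proof. by rewrite /inv_weight !expr2. Qed.

Let log_weightE p : log_weight p = 2^-1 * (ln (N p) - ln (1 + d)).
Proof. by rewrite /log_weight !expr2. Qed.

Let N_C1 j : C1_along j N (fun p => 2 * (if j == ord0 then p.1 else p.2)).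
Proof.
apply: C1_eq; last first.
- apply: C1D; last exact: (C1C j d).
  by apply: C1D; apply: C1M; [exact: C1_fst|exact: C1_fst|exact: C1_snd|exact: C1_snd].
- by move=> p /=; case: (j == ord0) => /=; ring.
- by [].
Qed.

Lemma inv_weight_C1 j :
  C1_along j inv_weight (fun p => - (inv_weight p ^+ 2) * (2 * (if j == ord0 then p.1 else p.2))).
Proof.
have cinv p : {for N p, continuous (fun x : R => - (x^-1 ^+ 2))}.
  apply: cvgN; apply: (@continuous_comp _ _ _ (fun x : R => x^-1) (fun x => x ^+ 2)).
    by apply: inv_continuous; rewrite gt_eqF.
  exact: exprn_continuous.
have dinv p : is_derive (N p) (1 : R) (fun x : R => x^-1) (- ((N p)^-1 ^+ 2)).
  rewrite -[X in is_derive _ _ _ X]mulr1 exprVn; apply: is_deriveV.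
  by rewrite gt_eqF.
apply: C1_eq (C1_comp cinv dinv (N_C1 j)); first by move=> p; rewrite inv_weightE.
by move=> p /=; rewrite inv_weightE.
Qed.

Lemma log_weight_C1 j :
  C1_along j log_weight (fun p => inv_weight p * (if j == ord0 then p.1 else p.2)).
Proof.
apply: C1_eq; last first.
- apply: C1M; first exact: (C1C j 2^-1).
  apply: C1B; last exact: (C1C j (ln (1 + d))).
  have cinv p : {for N p, continuous (fun x : R => x^-1)}.
    by apply: inv_continuous; rewrite gt_eqF.
  have dln p : is_derive (N p) (1 : R) (@ln R) (N p)^-1 by exact: is_derive1_ln.
  exact: (C1_comp cinv dln (N_C1 j)).
- by move=> p /=; rewrite inv_weightE; field; rewrite gt_eqF.
- by move=> p; rewrite log_weightE.
Qed.

Lemma log_weight_circle p : p.1 ^+ 2 + p.2 ^+ 2 = 1 -> log_weight p = 0.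
Proof. by rewrite /log_weight => ->; rewrite subrr mulr0. Qed.

Lemma inv_weight_gt0 p : 0 < inv_weight p.
Proof. by rewrite inv_weightE invr_gt0. Qed.

End weights.

(** * Integral identities for smooth displacements *)

Section disc_identities.
Context {R : realType}.
Local Notation B := (unit_ball R).
Local Notation mu := (leb2 R).
Local Notation j0 := (ord0 : 'I_2).
Local Notation j1 := (lift ord0 ord0 : 'I_2).
Variables (u v a b c d : R * R -> R).
Hypotheses (ua : C1_along j0 u a) (ub : C1_along j1 u b).
Hypotheses (vc : C1_along j0 v c) (vd : C1_along j1 v d).

Lemma eq_Rintegral_ball (f g : R * R -> R) : f =1 g ->
  \int[mu]_(p in B) f p = \int[mu]_(p in B) g p.
Proof. by move=> /funext ->. Qed.

Lemma circle_integral0 (f : R * R -> R) :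
  (forall p, p.1 ^+ 2 + p.2 ^+ 2 = 1 -> f p = 0) -> circle_integral f = 0.
Proof.
move=> f0; rewrite /circle_integral /Rintegral.
by under eq_integral do rewrite f0 ?cos2Dsin2//; rewrite integral0.
Qed.

Lemma integral_divergence :
  \int[mu]_(p in B) (a p + d p) = circle_integral (fun p => u p * p.1 + v p * p.2).
Proof. exact: green. Qed.

(** With [m = inv_weight * (x v - y u)], apply the divergence theorem to
    [log_weight * (u, v) + m * (-y, x)]: on the circle the first field vanishes
    and the second is tangential. *)
Lemma integral_log_weight_divergence (e : R) : 0 < e ->
  \int[mu]_(p in B) (log_weight e p * (a p + d p) + inv_weight e p *
    (p.2 ^+ 2 * a p - p.1 * p.2 * b p - p.1 * p.2 * c p + p.1 ^+ 2 * d p)) = 0.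
Proof.
move=> e0.
have X (j : 'I_2) := C1_fst (R := R) j; have Y (j : 'I_2) := C1_snd (R := R) j.
have L := log_weight_C1 e0; have Q := inv_weight_C1 e0.
have m0 := C1M (Q j0) (C1B (C1M (X j0) vc) (C1M (Y j0) ua)).
have m1 := C1M (Q j1) (C1B (C1M (X j1) vd) (C1M (Y j1) ub)).
have X1 := C1B (C1M (L j0) ua) (C1M (Y j0) m0).
have X2 := C1D (C1M (L j1) vd) (C1M (X j1) m1).
transitivity (circle_integral (fun p =>
   (log_weight e p * u p - p.2 * (inv_weight e p * (p.1 * v p - p.2 * u p))) * p.1 +
   (log_weight e p * v p + p.1 * (inv_weight e p * (p.1 * v p - p.2 * u p))) * p.2)).
  rewrite -(green X1 X2); apply: eq_Rintegral_ball => p /=; ring.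
by apply: circle_integral0 => p p1; rewrite log_weight_circle//; ring.
Qed.

(** The determinant is the divergence of [(u d, - u c)] and of [(- v b, v a)],
    as mixed derivatives commute. The divergence theorem is applied to the sum
    of these two fields multiplied by the logarithm, which vanishes on the
    circle. *)
Lemma integral_log_weight_det (a1 b0 c1 d0 : R * R -> R) (e : R) : 0 < e ->
  C1_along j1 a a1 -> C1_along j0 b b0 -> C1_along j1 c c1 -> C1_along j0 d d0 ->
  \int[mu]_(p in B) (2 * log_weight e p * (a p * d p - b p * c p) + inv_weight e p *
    ((p.1 * d p - p.2 * c p) * u p - (p.1 * b p - p.2 * a p) * v p)) = 0.
Proof.
move=> e0 aa bb cc dd.
have L := log_weight_C1 e0.
have ab : a1 =1 b0 := mixed_partials ua ub aa bb.
have cd : c1 =1 d0 := mixed_partials vc vd cc dd.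
have X1 := C1M (L j0) (C1B (C1M ua dd) (C1M vc bb)).
have X2 := C1M (L j1) (C1B (C1M vd aa) (C1M ub cc)).
transitivity (circle_integral (fun p =>
   (log_weight e p * (u p * d p - v p * b p)) * p.1 +
   (log_weight e p * (v p * a p - u p * c p)) * p.2)).
  rewrite -(green X1 X2); apply: eq_Rintegral_ball => p /=; rewrite ab cd; ring.
by apply: circle_integral0 => p p1; rewrite log_weight_circle//; ring.
Qed.

(** The divergence theorem for [u ^+ 2 * x]. It replaces Poincare's inequality:
    a function with zero gradient and zero trace has zero square integral. *)
Lemma integral_square_divergence :
  \int[mu]_(p in B) (2 * u p ^+ 2 + 2 * u p * (p.1 * a p + p.2 * b p)) =
  circle_integral (fun p => u p ^+ 2).
Proof.
have X (j : 'I_2) := C1_fst (R := R) j; have Y (j : 'I_2) := C1_snd (R := R) j.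
have X1 := C1M (X j0) (C1M ua ua); have X2 := C1M (Y j1) (C1M ub ub).
transitivity (circle_integral (fun p =>
    (p.1 * (u p * u p)) * p.1 + (p.2 * (u p * u p)) * p.2)).
  rewrite -(green X1 X2); apply: eq_Rintegral_ball => p /=; ring.
rewrite /circle_integral; apply: eq_Rintegral => t _ /=.
by rewrite -[RHS]mulr1 -(cos2Dsin2 t); ring.
Qed.

End disc_identities.

(** * Rotations preserve area *)

Section translation.
Context {R : realType}.
Local Notation leb := (@lebesgue_measure R).

Lemma measurable_translation (c : R) :
  measurable_fun [set: measurableTypeR R]
    ((fun x => x + c) : measurableTypeR R -> measurableTypeR R).
Proof.
by apply: (@continuous_measurable_fun R) => x; apply: cvgD; [exact: cvg_id|exact: cvg_cst].
Qed.

Lemma lebesgue_measure_translation (c : R) (A : set (measurableTypeR R)) :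
  measurable A -> leb ((fun x => x + c) @^-1` A) = leb A.
Proof.
move=> mA; apply/esym.
pose m' := measure_function_pushforward__canonical__measure_function_Measure leb (measurable_translation c).
suff : leb A = m' A by [].
apply: lebesgue_measure_unique => // _ [[a b] _ <-] /=.
rewrite /pushforward.
have -> : (fun x : R => x + c) @^-1` `]a, b]%classic = `]a - c, b - c]%classic.
  by apply/seteqP; split => x /=; rewrite !in_itv/= ltrBlDr lerBrDr.
by rewrite !lebesgue_measure_itv/= !lte_fin ltrD2r; case: ifP => // _; rewrite -!EFinB; congr EFin; ring.
Qed.

End translation.

Section rotation.
Context {R : realType}.
Local Notation leb := (@lebesgue_measure R).
Implicit Types (f g : plane R -> plane R).

Definition area_preserving f := measurable_fun [set: plane R] f /\
  forall X : set (plane R), measurable X -> leb2 R (f @^-1` X) = leb2 R X.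

Lemma area_preserving_comp f g :
  area_preserving f -> area_preserving g -> area_preserving (f \o g).
Proof.
move=> [mf Hf] [mg Hg]; split; first exact: measurableT_comp.
move=> X mX; rewrite comp_preimage Hg ?Hf//.
by rewrite -[X in measurable X]setTI; exact: mf.
Qed.

(** A measure on the plane is determined by its values on rectangles. *)
Lemma area_preserving_rect f : measurable_fun [set: plane R] f ->
  (forall A D : set (measurableTypeR R), measurable A -> measurable D ->
     leb2 R (f @^-1` (A `*` D)) = (leb A * leb D)%E) -> area_preserving f.
Proof.
move=> mf H; split => // X mX.
pose m' := measure_function_pushforward__canonical__measure_function_Measure (leb2 R) mf.
exact/esym/(@product_measure_unique _ _ _ _ R leb leb m').
Qed.

Lemma area_preserving_swap : area_preserving (fun p => (p.2, p.1)).
Proof.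
apply: area_preserving_rect.
  by apply: measurable_fun_pair; [exact: measurable_snd|exact: measurable_fst].
move=> A D mA mD; have -> : (fun p : plane R => (p.2, p.1)) @^-1` (A `*` D) = D `*` A.
  by apply/seteqP; split => -[x y] [].
by rewrite leb2X// muleC.
Qed.

(** On each vertical line a shear is a translation. *)
Lemma area_preserving_shear_snd (b : R) : area_preserving (fun p => (p.1, p.2 + b * p.1)).
Proof.
have mf : measurable_fun [set: plane R] (fun p => (p.1, p.2 + b * p.1)).
  apply: measurable_fun_pair; first exact: measurable_fst.
  by apply: measurable_funD; [exact: measurable_snd|apply: measurable_funM => //; exact: measurable_fst].
apply: area_preserving_rect => // A D mA mD.
rewrite -(leb2X mA mD) /leb2 /= /product_measure1 /=.
apply: eq_integral => x _ /=.
have [xA|xA] := boolP (x \in A).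
  rewrite in_xsectionX//= -(lebesgue_measure_translation (b * x) mD); congr leb.
  rewrite /xsection; apply/seteqP; split => y /=; rewrite inE/=; first by case.
  by move=> ?; split => //=; rewrite inE in xA.
rewrite notin_xsectionX//= ; congr leb.
apply/seteqP; split => y //=; rewrite /xsection/= inE => -[/= Ax _].
by move: xA; rewrite notin_setE.
Qed.

Lemma area_preserving_shear_fst (b : R) : area_preserving (fun p => (p.1 + b * p.2, p.2)).
Proof.
have := area_preserving_comp area_preserving_swap
  (area_preserving_comp (area_preserving_shear_snd b) area_preserving_swap).
by [].
Qed.

Definition rotation (c s : R) (p : plane R) : plane R :=
  (c * p.1 - s * p.2, s * p.1 + c * p.2).

Let rotation_shears (c s : R) : c ^+ 2 + s ^+ 2 = 1 -> c != -1 ->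
  area_preserving (rotation c s).
Proof.
move=> cs c1; have c10 : 1 + c != 0 by rewrite addrC addr_eq0.
pose k := - s / (1 + c).
have k1 : k * (1 + c) = - s by rewrite /k divfK.
have k2 : k * s = c - 1.
  (* From [k1] and [s ^+ 2 = (1 - c) * (1 + c)]. *)
  apply: (mulIf c10); rewrite mulrAC k1.
  have -> : (c - 1) * (1 + c) = c ^+ 2 - 1 by ring.
  by rewrite -cs; ring.
have := area_preserving_comp (area_preserving_shear_fst k)
  (area_preserving_comp (area_preserving_shear_snd s) (area_preserving_shear_fst k)).
congr area_preserving; apply/funext => -[x y] /=; rewrite /rotation/=; congr pair.
  have -> : x + k * y + k * (y + s * (x + k * y)) =
    (1 + k * s) * x + (k * (1 + k * s) + k) * y by ring.
  rewrite k2; have -> : (k * (1 + (c - 1)) + k) = k * (1 + c) by ring.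
  by rewrite k1; ring.
by have -> : y + s * (x + k * y) = s * x + (1 + k * s) * y; [ring|rewrite k2; ring].
Qed.

(** A rotation is a product of three shears, with coefficients
    [- tan (theta / 2)], [sin theta] and [- tan (theta / 2)]. The half turn,
    where the tangent is infinite, is the square of a quarter turn. *)
Lemma area_preserving_rotation (c s : R) : c ^+ 2 + s ^+ 2 = 1 ->
  area_preserving (rotation c s).
Proof.
move=> cs; have [c1|] := eqVneq c (-1); last exact: rotation_shears.
have s0 : s = 0 by apply/eqP; rewrite -sqrf_eq0; move: cs; rewrite c1 => cs; apply/eqP; lra.
have r : area_preserving (rotation 0 1) by apply: rotation_shears; [ring|rewrite eq_sym oppr_eq0 oner_eq0].
have := area_preserving_comp r r; congr area_preserving; apply/funext => -[x y].
by rewrite /rotation/= c1 s0; congr pair; ring.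
Qed.

End rotation.

Section rotation_average.
Context {R : realType}.
Local Notation B := (unit_ball R).
Local Notation rot t := (rotation (cos t) (sin t)).

Lemma continuous_rotated_point (G : R * R -> R) (t : R) : continuous G ->
  continuous (fun p : R * R => G (rot t p)).
Proof.
move=> cG; apply: cont_pair => //; [apply: contB|apply: contD]; apply: contM;
  by [exact: contC|exact: continuous_fst2|exact: continuous_snd2].
Qed.

Lemma continuous_rotation_angle (G : R * R -> R) (p : R * R) : continuous G ->
  continuous (fun t : R => G (rot t p)).
Proof.
move=> cG; apply: cont_pair => //; [apply: contB|apply: contD]; apply: contM;
  by [exact: contC|exact: continuous_cos|exact: continuous_sin].
Qed.

Lemma rotation_unit_ball (t : R) : (rot t) @^-1` B = B.
Proof.
have E (p : plane R) : (rot t p).1 ^+ 2 + (rot t p).2 ^+ 2 = p.1 ^+ 2 + p.2 ^+ 2.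
  move: (cos2Dsin2 t); move: (cos t) (sin t) => c s cs; rewrite /rotation/=.
  transitivity ((c ^+ 2 + s ^+ 2) * (p.1 ^+ 2 + p.2 ^+ 2)); first by ring.
  by rewrite cs mul1r.
apply/seteqP; split => p /unit_ballP.
  by rewrite E => H; apply/unit_ballP.
by rewrite -E => H; apply/unit_ballP.
Qed.

Lemma Rintegral_rotation (t : R) (G : R * R -> R) : continuous G ->
  \int[leb2 R]_(p in B) G (rot t p) = \int[leb2 R]_(p in B) G p.
Proof.
move=> cG; have [mr Hr] := area_preserving_rotation (cos2Dsin2 t).
have mB := @measurable_unit_ball R.
rewrite /Rintegral; congr fine.
transitivity (\int[pushforward (leb2 R) (rot t)]_(p in B) (G p)%:E)%E; last first.
  by apply: eq_measure_integral => A mA _; exact: Hr.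
rewrite integral_pushforward//; first by rewrite rotation_unit_ball.
  by apply/measurable_EFinP; exact: continuous_measurable_plane.
rewrite rotation_unit_ball.
apply: (@integrable_continuous_ball R (fun p => G (rot t p))).
exact: continuous_rotated_point.
Qed.

End rotation_average.

(** * Wirtinger's inequality *)

Section wirtinger.
Context {R : realType}.
Local Notation leb := (@lebesgue_measure R).
Implicit Types u v : R -> R.

Lemma derive_ge0_endpoints (F f : R -> R) (a b : R) : a <= b ->
  (forall x, a <= x <= b -> is_derive x (1 : R) F (f x)) ->
  (forall x, a < x < b -> 0 <= f x) -> F a <= F b.
Proof.
rewrite le_eqVlt => /predU1P[-> //|ab DF f0].
have [x xab||c cab E] := @MVT R F f a b ab.
- by apply: DF; move: xab; rewrite in_itv/= => /andP[? ?]; apply/andP; split; exact: ltW.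
- apply: derivable_within_continuous => z zab.
  by have [] := DF z; first by move: zab; rewrite in_itv.
- by rewrite -subr_ge0 E mulr_ge0 ?f0// ?subr_ge0 ?(ltW ab)//; move: cab; rewrite in_itv.
Qed.

(** The function [w] solves the Riccati equation [w' = - k^2 - w^2], so that
    [dg^2 - k^2 g^2] is the derivative of [g^2 w] plus the square
    [(dg - g w)^2]. As [k < 1], the tangent in [w] stays finite up to the end
    points of the interval, where [g] vanishes. *)
Lemma wirtinger_slow (g dg E : R -> R) (s k : R) : 0 < k < 1 ->
  (forall x, is_derive x (1 : R) g (dg x)) ->
  g s = 0 -> g (s + pi) = 0 ->
  (forall x, is_derive x (1 : R) E (dg x ^+ 2 - k ^+ 2 * g x ^+ 2)) ->
  E s <= E (s + pi).
Proof.
move=> /andP[k0 k1] Dg gs gp DE.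
have pi0 := pi_gt0 R.
pose m := s + pi / 2.
pose w x := - k * tan (k * (x - m)).
pose K x := E x - g x * g x * w x.
suff : K s <= K (s + pi) by rewrite /K gs gp !mul0r !subr0.
have cosm x : s <= x <= s + pi -> cos (k * (x - m)) != 0.
  move=> xs; rewrite gt_eqF// cos_gt0_pihalf// /m; apply/andP; split; nra.
apply: (@derive_ge0_endpoints K (fun x => (dg x - g x * w x) ^+ 2)) => [|x|x _].
- by rewrite lerDl ltW.
- move=> /cosm cx.
  have Dl := deriveM1 (deriveC1 k x) (deriveB1 (derive_id1 x) (deriveC1 m x)).
  have Dw := deriveM1 (deriveC1 (- k) x) (derive_comp1 (g := fun y => k * (y - m)) (is_derive_tan cx) Dl).
  have DK := deriveB1 (DE x) (deriveM1 (deriveM1 (Dg x) (Dg x)) Dw).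
  apply: is_derive_eq DK _; rewrite /= cos2_tan2// /w; ring.
- exact: sqr_ge0.
Qed.

(** Wirtinger's inequality for functions that vanish at the ends of an interval
    of length [pi], stated on a primitive [E] of [dg^2 - g^2]. The sharp
    constant is the limit [k --> 1] of the previous inequality. *)
Lemma wirtinger_dirichlet (g dg E : R -> R) (s : R) :
  continuous dg -> (forall x, is_derive x (1 : R) g (dg x)) ->
  g s = 0 -> g (s + pi) = 0 ->
  (forall x, is_derive x (1 : R) E (dg x ^+ 2 - g x ^+ 2)) ->
  E s <= E (s + pi).
Proof.
move=> cdg Dg gs gp DE.
have cg : continuous g by move=> x; apply/differentiable_continuous/derivable1_diffP; case: (Dg x).
have [P DP] := continuous_primitive (contX (n := 2) cg).
have P0 : P s <= P (s + pi).
  apply: (@derive_ge0_endpoints P (fun x => g x ^+ 2)) => // [|x _]; last exact: sqr_ge0.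
  by rewrite lerDl ltW// pi_gt0.
rewrite leNgt; apply/negP => EE.
pose A := P (s + pi) - P s; pose e := E s - E (s + pi).
have e0 : 0 < e by rewrite subr_gt0.
have A0 : 0 <= A by rewrite subr_ge0.
have slow k : 0 < k < 1 -> e <= (1 - k ^+ 2) * A.
  move=> k01; have := @wirtinger_slow g dg (fun x => E x + (1 - k ^+ 2) * P x) s k k01 Dg gs gp.
  suff DE' : forall x, is_derive x (1 : R) (fun x => E x + (1 - k ^+ 2) * P x) (dg x ^+ 2 - k ^+ 2 * g x ^+ 2).
    by move=> /(_ DE'); rewrite /e /A; lra.
  move=> x; apply: is_derive_eq (deriveD1 (DE x) (deriveM1 (deriveC1 (1 - k ^+ 2) x) (DP x))) _.
  ring.
(* With [k = 1 - t] the bound [(1 - k ^+ 2) * A <= 2 * t * A] drops below [e]. *)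
pose t := Num.min (1 / 2) (e / (4 * (A + 1))).
have A1 : 0 < 4 * (A + 1) by lra.
have t0 : 0 < t by rewrite lt_min divr_gt0// ?divr_gt0.
have t12 : t <= 1 / 2 by rewrite ge_min lexx.
have tA : t * (4 * (A + 1)) <= e by rewrite -ler_pdivlMr// ge_min lexx orbT.
have := slow (1 - t); have -> : 0 < 1 - t < 1 by apply/andP; split; lra.
by move=> /(_ isT); nra.
Qed.

Lemma periodic_primitive_shift (f F : R -> R) :
  (forall x, is_derive x (1 : R) F (f x)) -> (forall x, f (x + 2 * pi) = f x) ->
  forall s, F (s + 2 * pi) - F s = F (2 * pi) - F 0.
Proof.
move=> DF fp s.
pose K t := F (t + 2 * pi) - F t.
suff : K s = K 0 by rewrite /K add0r.
apply: (@is_derive_0_is_cst _ K) => t.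
have Dl := deriveD1 (derive_id1 t) (deriveC1 (2 * pi) t).
apply: is_derive_eq (deriveB1 (derive_comp1 (g := fun y => y + 2 * pi) (DF (t + 2 * pi)) Dl) (DF t)) _.
by rewrite fp; ring.
Qed.

(** The sharp inequality between twice the area swept by a closed curve and its
    Dirichlet energy. Subtracting the value that [u] takes at two opposite
    points, found by the intermediate value theorem, both half periods satisfy
    Dirichlet conditions; what remains of the integrand is, up to the
    derivative of a periodic function, the square [(u - al - dv)^2]. *)
Lemma wirtinger_periodic (u v du dv : R -> R) :
  continuous du -> continuous dv ->
  (forall x, is_derive x (1 : R) u (du x)) -> (forall x, is_derive x (1 : R) v (dv x)) ->
  (forall x, u (x + 2 * pi) = u x) -> (forall x, v (x + 2 * pi) = v x) ->
  (forall x, du (x + 2 * pi) = du x) -> (forall x, dv (x + 2 * pi) = dv x) ->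
  0 <= \int[leb]_(t in `[0%R, (2 * pi)%R])
     (du t ^+ 2 + dv t ^+ 2 - (u t * dv t - v t * du t)).
Proof.
move=> cdu cdv Du Dv pu pv pdu pdv.
have cu : continuous u by move=> x; apply/differentiable_continuous/derivable1_diffP; case: (Du x).
have cv : continuous v by move=> x; apply/differentiable_continuous/derivable1_diffP; case: (Dv x).
have pi0 := pi_gt0 R.
have [s us] : exists s, u s = u (s + pi).
  pose r x := u (x + pi) - u x.
  have cr : continuous r.
    by apply: contB => //; apply: cont_comp => //; apply: contD; [exact: contid|exact: contC].
  have rpi : r pi = - r 0.
    by rewrite /r add0r opprB (_ : pi + pi = 0 + 2 * pi) ?pu//; ring.
  have [||c _ cr0] := @IVT _ r 0 pi 0 (ltW pi0); first exact: continuous_subspaceT.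
    rewrite rpi; have [r0|r0] := leP 0 (r 0).
      by rewrite ge_min oppr_le0 r0 orbT/= le_max r0.
    by rewrite ge_min (ltW r0)/= le_max oppr_ge0 (ltW r0) orbT.
  by exists c; apply/eqP; rewrite eq_sym -subr_eq0; apply/eqP.
pose al := u s.
pose f t := du t ^+ 2 + dv t ^+ 2 - (u t * dv t - v t * du t).
have cf : continuous f.
  apply: contB; first by apply: contD; exact: contX.
  by apply: contB; exact: contM.
have [F DF] := continuous_primitive cf.
have le2pi : 0 <= 2 * pi :> R by lra.
rewrite (Rintegral_derive le2pi cf DF).
rewrite -(@periodic_primitive_shift f F DF _ s); last by move=> x; rewrite /f pu pv pdu pdv.
have ch : continuous (fun t => du t ^+ 2 - (u t - al) ^+ 2).
  by apply: contB; apply: contX => //; apply: contB => //; exact: contC.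
have [E DE] := continuous_primitive ch.
have Dg x : is_derive x (1 : R) (fun t => u t - al) (du x).
  by apply: is_derive_eq (deriveB1 (Du x) (deriveC1 al x)) _; rewrite subr0.
have E1 : E s <= E (s + pi).
  by apply: (wirtinger_dirichlet cdu Dg) => //; rewrite ?subrr// -us subrr.
have E2 : E (s + pi) <= E (s + pi + pi).
  apply: (wirtinger_dirichlet cdu Dg) => //; first by rewrite -us subrr.
  by rewrite (_ : s + pi + pi = s + 2 * pi) ?pu ?subrr//; ring.
(* The quantity subtracted is periodic, so its end values cancel. *)
have E3 : F s - E s - (u s * v s - 2 * al * v s) <=
   F (s + 2 * pi) - E (s + 2 * pi) - (u (s + 2 * pi) * v (s + 2 * pi) - 2 * al * v (s + 2 * pi)).
  apply: (@derive_ge0_endpoints (fun t => F t - E t - (u t * v t - 2 * al * v t))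
    (fun t => (u t - al - dv t) ^+ 2)) => [|x _|x _]; [by lra| |exact: sqr_ge0].
  apply: is_derive_eq (deriveB1 (deriveB1 (DF x) (DE x)) (deriveB1 (deriveM1 (Du x) (Dv x))
    (deriveM1 (deriveC1 (2 * al) x) (Dv x)))) _.
  by rewrite /f; ring.
move: E3; rewrite pu pv.
by move: E2; rewrite (_ : s + pi + pi = s + 2 * pi); [lra|ring].
Qed.

End wirtinger.

(** * Wirtinger's inequality averaged over the circles of the disc *)

Section chain_rule.
Context {R : realType}.
Local Notation j0 := (ord0 : 'I_2).
Local Notation j1 := (lift ord0 ord0 : 'I_2).

Lemma is_derive_cvgP (g : R -> R) (t d : R) :
  is_derive t (1 : R) g d <-> h^-1 * (g (h + t) - g t) @[h --> 0^'] --> d.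
Proof.
have E : (fun h : R => h^-1 *: ((g \o shift t) (h *: (1 : R)) - g t)) =
   (fun h : R => h^-1 * (g (h + t) - g t)).
  by apply/funext => h; rewrite /= /GRing.scale/= mulr1.
split=> [[]|cv].
  by rewrite /derivable /derive E => cv <-.
split; first by rewrite /derivable E; apply/cvg_ex; exists d.
by rewrite /derive E; exact: cvg_lim.
Qed.

Lemma mean_value_between (F f : R -> R) (a b : R) :
  (forall x, is_derive x (1 : R) F (f x)) ->
  exists c, `|c - a| <= `|b - a| /\ F b - F a = f c * (b - a).
Proof.
move=> DF.
have key x y : x <= y -> exists2 c, x <= c <= y & F y - F x = f c * (y - x).
  move=> xy; have [c cxy E] : exists2 c, c \in `[x, y] & F y - F x = f c * (y - x).
    apply: (@MVT_segment R F f x y xy) => //.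
    apply: continuous_subspaceT => z.
    by apply/differentiable_continuous/derivable1_diffP; case: (DF z).
  by exists c => //; move: cxy; rewrite in_itv.
have [ab|/ltW ba] := leP a b.
  have [c cab E] := key _ _ ab; exists c; split => //.
  by rewrite !ger0_norm; lra.
have [c cab E] := key _ _ ba; exists c; split.
  by rewrite !ler0_norm; lra.
by rewrite -opprB E; ring.
Qed.

(** The increment of [f] is split into a vertical and a horizontal one. The
    vertical one is a composition in one variable; the horizontal one is
    computed by the mean value theorem at an intermediate point, where the
    partial derivative is continuous. *)
Lemma chain_rule (f f0 f1 : R * R -> R) (al be : R -> R) (t dal dbe : R) :
  C1_along j0 f f0 -> C1_along j1 f f1 ->
  is_derive t (1 : R) al dal -> is_derive t (1 : R) be dbe ->
  is_derive t (1 : R) (fun s => f (al s, be s))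
    (f0 (al t, be t) * dal + f1 (al t, be t) * dbe).
Proof.
move=> [_ c0 D0] [_ _ D1] Dal Dbe.
have cal : {for t, continuous al} by apply/differentiable_continuous/derivable1_diffP; case: Dal.
have cbe : {for t, continuous be} by apply/differentiable_continuous/derivable1_diffP; case: Dbe.
have shift0 (g : R -> R) : {for t, continuous g} -> g (h + t) @[h --> 0^'] --> g t.
  move=> cg; apply: (@cvg_comp _ _ _ (fun h => h + t) g); last exact: cg.
  have H : h + t @[h --> (0 : R)] --> 0 + t by apply: cvgD; [exact: cvg_id|exact: cvg_cst].
  by rewrite add0r in H; exact: cvg_within_filter.
have H2 : is_derive t (1 : R) (fun s => f (al t, be s)) (f1 (al t, be t) * dbe).
  apply: (derive_comp1 (h := fun y => f (al t, y))) => //.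
  exact/is_derive_snd_lineP.
have H1 : is_derive t (1 : R) (fun s => f (al s, be s) - f (al t, be s)) (f0 (al t, be t) * dal).
  apply/is_derive_cvgP.
  have /choice[xi xiP] : forall h : R, exists c, `|c - al t| <= `|al (h + t) - al t| /\
      f (al (h + t), be (h + t)) - f (al t, be (h + t)) = f0 (c, be (h + t)) * (al (h + t) - al t).
    move=> h; apply: (@mean_value_between (fun x => f (x, be (h + t))) (fun x => f0 (x, be (h + t)))) => x.
    exact/is_derive_fst_lineP.
  have -> : (fun h : R => h^-1 * (f (al (h + t), be (h + t)) - f (al t, be (h + t)) -
       (f (al t, be t) - f (al t, be t)))) =
     (fun h : R => f0 (xi h, be (h + t)) * (h^-1 * (al (h + t) - al t))).
    by apply/funext => h; rewrite subrr subr0 (xiP h).2; ring.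
  apply: cvgM; last exact/is_derive_cvgP.
  have cxi : xi h @[h --> 0^'] --> al t.
    apply/cvgrPdist_lt => e e0.
    have /cvgrPdist_lt/(_ e e0) := shift0 _ cal.
    apply: filterS => h; apply: le_lt_trans.
    by rewrite distrC (le_trans (xiP h).1)// distrC.
  exact: (cvg_comp _ _ (cvg_pair cxi (shift0 _ cbe)) (c0 (al t, be t))).
have := deriveD1 H1 H2; congr is_derive.
by apply/funext => s; rewrite subrK.
Qed.

End chain_rule.

Section plane_sigma_finite.
Context {R : realType}.

Lemma leb2_sigma_finite : sigma_finite setT (leb2 R).
Proof.
exists (fun n : nat => `[- (n%:R : R), n%:R]%classic `*` `[- (n%:R : R), n%:R]%classic).
  apply/seteqP; split => // -[x y] _.
  pose n := (Num.truncn (`|x| + `|y|)).+1.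
  have H : `|x| + `|y| < n%:R by exact: truncnS_gt.
  have := normr_ge0 x; have := normr_ge0 y => ny nx.
  exists n => //; split; rewrite /= in_itv/= -ler_norml; lra.
move=> n; split; first exact: measurableX.
rewrite leb2X// !lebesgue_measure_itv/=.
by case: ifPn => _; rewrite ?mule0// -!EFinB -EFinM ltry.
Qed.

(** The plane measure with its sigma-finite structure, which Fubini's theorem
    for the product with the angle requires. *)
Definition leb2_sf :=
  HB.pack_for (SigmaFiniteMeasure.type (plane R) R) (Measure.sort (leb2 R))
    (Measure_isSigmaFinite.Build _ _ _ (leb2 R) leb2_sigma_finite).

End plane_sigma_finite.

Section weighted_wirtinger.
Context {R : realType}.
Local Notation leb := (@lebesgue_measure R).
Local Notation B := (unit_ball R).
Local Notation j0 := (ord0 : 'I_2).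
Local Notation j1 := (lift ord0 ord0 : 'I_2).
Local Notation rot t := (rotation (cos t) (sin t)).

(** Rotation invariance makes the integral of [G] over the disc equal to the
    average over the angle of the integrals of the rotated functions;
    exchanging the two integrations gives the integrals along circles. *)
Lemma rotation_average_ge0 (G : R * R -> R) : continuous G ->
  (forall p, B p -> 0 <= \int[leb]_(t in `[0%R, (2 * pi)%R]) G (rot t p)) ->
  0 <= \int[leb2 R]_(p in B) G p.
Proof.
move=> cG G0; have pi0 := pi_gt0 R; have mB := @measurable_unit_ball R.
pose I : set (measurableTypeR R) := `[0%R, (2 * pi)%R]%classic.
pose H (z : measurableTypeR R * plane R) : R := G (rot z.1 z.2).
have mH : measurable_fun setT H.
  apply: (measurableT_comp (continuous_measurable_plane cG)).
  have mc : measurable_fun [set: measurableTypeR R * plane R] (fun z => cos z.1).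
    apply: (measurableT_comp (f := @cos R)); last exact: measurable_fst.
    by apply: continuous_measurable_fun; exact: continuous_cos.
  have ms : measurable_fun [set: measurableTypeR R * plane R] (fun z => sin z.1).
    apply: (measurableT_comp (f := @sin R)); last exact: measurable_fst.
    by apply: continuous_measurable_fun; exact: continuous_sin.
  have mx : measurable_fun [set: measurableTypeR R * plane R] (fun z => z.2.1 : R).
    by apply: (measurableT_comp (f := fst)); [exact: measurable_fst|exact: measurable_snd].
  have my : measurable_fun [set: measurableTypeR R * plane R] (fun z => z.2.2 : R).
    by apply: (measurableT_comp (f := snd)); [exact: measurable_snd|exact: measurable_snd].
  by apply: measurable_fun_pair; [apply: measurable_funB|apply: measurable_funD];
    apply: measurable_funM.
have mI : measurable I by exact: measurable_itv.
have leI : leb I = (2 * pi)%:E.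
  by rewrite /I lebesgue_measure_itv/= lte_fin mulr_gt0// -EFinB subr0.
pose leb2' := @leb2_sf R.
have mIB : measurable (I `*` B) by exact: measurableX.
have fIB : ((leb \x leb2')%E (I `*` B) < +oo)%E.
  have -> : ((leb \x leb2') (I `*` B) = leb I * leb2 R B)%E by exact: product_measure1E.
  by rewrite leI lte_mul_pinfty// ?lee_fin; [lra|exact: leb2_unit_ball_lty].
have bH : [bounded H z | z in I `*` B].
  have [M [_ HM]] := continuous_bounded_ball cG.
  exists M; split; rewrite ?num_real // => k Mk [t p] [_ Bp]; apply: (HM k Mk).
  by rewrite -(rotation_unit_ball t) in Bp.
have iH : (leb \x leb2')%E.-integrable (I `*` B) (EFin \o H).
  by apply: measurable_bounded_integrable => //; exact: measurable_funTS.
have iH' : (leb \x leb2')%E.-integrable setT ((EFin \o H) \_ (I `*` B)).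
  by rewrite -integrable_mkcond.
pose c := \int[leb2 R]_(p in B) G p.
have ic : (\int[leb2 R]_(p in B) (G p)%:E)%E = c%:E.
  by rewrite /c /Rintegral fineK//; apply: integrable_fin_num => //; exact: integrable_continuous_ball.
have /= F := Fubini iH'.
have L : (\int[leb]_t \int[leb2']_p ((EFin \o H) \_ (I `*` B)) (t, p) = (c * (2 * pi))%:E)%E.
  transitivity (\int[leb]_(t in I) c%:E)%E; last by rewrite integral_cst// EFinM; congr (_ * _)%E.
  rewrite [RHS]integral_mkcond; apply: eq_integral => t _.
  rewrite {2}/patch; case: ifPn => tI; last first.
    apply: integral0_eq => p _; rewrite /patch ifF//.
    by apply/negbTE; apply: contra tI; rewrite !inE => -[].
  transitivity (\int[leb2 R]_(p in B) (G (rot t p))%:E)%E.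
    rewrite [RHS]integral_mkcond; apply: eq_integral => p _.
    by rewrite /patch in_setX tI.
  rewrite -ic -[LHS]fineK; last first.
    apply: integrable_fin_num => //.
    apply: (@integrable_continuous_ball R (fun p => G (rot t p))).
    exact: continuous_rotated_point.
  by rewrite ic; congr EFin; exact: Rintegral_rotation.
suff : (0%:E <= (c * (2 * pi))%:E)%E by rewrite lee_fin pmulr_lge0//; lra.
rewrite -L F; apply: integral_ge0 => p _.
have [Bp|nBp] := pselect (B p); last first.
  by rewrite integral0_eq// => t _; rewrite /patch ifF//; apply/negP; rewrite inE => -[].
have -> : (\int[leb]_t ((EFin \o H) \_ (I `*` B)) (t, p) = \int[leb]_(t in I) (G (rot t p))%:E)%E.
  rewrite [RHS]integral_mkcond; apply: eq_integral => t _.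
  by rewrite /patch in_setX (mem_set Bp) andbT.
rewrite -[X in (_ <= X)%E]fineK ?lee_fin; first exact: G0.
apply: integrable_fin_num => //.
apply: (@integrable_continuous_itv R (fun t => G (rot t p))).
exact: continuous_rotation_angle.
Qed.

(** Along the orbit of a point under rotations, [p.1 * b p - p.2 * a p] is the
    derivative of [u] with respect to the angle, and the weight is constant. *)
Lemma weighted_wirtinger (u v a b c d : R * R -> R) (e : R) : 0 < e ->
  C1_along j0 u a -> C1_along j1 u b -> C1_along j0 v c -> C1_along j1 v d ->
  0 <= \int[leb2 R]_(p in B) (inv_weight e p *
    ((p.1 * b p - p.2 * a p) ^+ 2 + (p.1 * d p - p.2 * c p) ^+ 2
     - (u p * (p.1 * d p - p.2 * c p) - v p * (p.1 * b p - p.2 * a p)))).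
Proof.
move=> e0 ua ub vc vd.
have [[cu ca _] [_ cb _] [cv cc _] [_ cd _]] := And4 ua ub vc vd.
have cT (f g : R * R -> R) : continuous f -> continuous g -> continuous (fun p : R * R => p.1 * g p - p.2 * f p).
  by move=> cf cg; apply: contB; apply: contM => //; [exact: continuous_fst2|exact: continuous_snd2].
have [cq _ _] := inv_weight_C1 e0 j0.
apply: rotation_average_ge0.
  apply: contM => //; apply: contB; first by apply: contD; apply: contX; exact: cT.
  by apply: contB; apply: contM => //; exact: cT.
move=> p Bp.
pose ut t := u (rot t p); pose vt t := v (rot t p).
pose T (f g : R * R -> R) t := (rot t p).1 * g (rot t p) - (rot t p).2 * f (rot t p).
have crot (f : R * R -> R) : continuous f -> continuous (fun t : R => f (rot t p)).
  exact: continuous_rotation_angle.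
have Drot (f f0 f1 : R * R -> R) (t : R) : C1_along j0 f f0 -> C1_along j1 f f1 ->
    is_derive t (1 : R) (fun t => f (rot t p)) (T f0 f1 t).
  move=> ff0 ff1; have Dc := is_derive_cos t; have Ds := is_derive_sin t.
  have Dx := deriveB1 (deriveM1 Dc (deriveC1 p.1 t)) (deriveM1 Ds (deriveC1 p.2 t)).
  have Dy := deriveD1 (deriveM1 Ds (deriveC1 p.1 t)) (deriveM1 Dc (deriveC1 p.2 t)).
  apply: is_derive_eq (chain_rule ff0 ff1 Dx Dy) _.
  by rewrite /T /rotation/=; ring.
have rot2pi t : rot (t + 2 * pi) p = rot t p by rewrite mulr_natl cosD2pi sinD2pi.
have key : 0 <= \int[leb]_(t in `[0%R, (2 * pi)%R])
     (T a b t ^+ 2 + T c d t ^+ 2 - (ut t * T c d t - vt t * T a b t)).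
  apply: wirtinger_periodic.
  - exact: (crot _ (cT _ _ ca cb)).
  - exact: (crot _ (cT _ _ cc cd)).
  - by move=> t; exact: Drot.
  - by move=> t; exact: Drot.
  - by move=> t; rewrite /ut rot2pi.
  - by move=> t; rewrite /vt rot2pi.
  - by move=> t; rewrite /T rot2pi.
  - by move=> t; rewrite /T rot2pi.
have -> : (fun t : R => inv_weight e (rot t p) *
    (((rot t p).1 * b (rot t p) - (rot t p).2 * a (rot t p)) ^+ 2 +
     ((rot t p).1 * d (rot t p) - (rot t p).2 * c (rot t p)) ^+ 2 -
     (u (rot t p) * ((rot t p).1 * d (rot t p) - (rot t p).2 * c (rot t p)) -
      v (rot t p) * ((rot t p).1 * b (rot t p) - (rot t p).2 * a (rot t p))))) =
  (fun t => inv_weight e p * (T a b t ^+ 2 + T c d t ^+ 2 - (ut t * T c d t - vt t * T a b t))).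
  apply/funext => t; congr (_ * _); rewrite /inv_weight; congr (_ + _)^-1.
  move: (cos2Dsin2 t); move: (cos t) (sin t) => x y xy; rewrite /rotation/=.
  transitivity ((x ^+ 2 + y ^+ 2) * (p.1 ^+ 2 + p.2 ^+ 2)); first by ring.
  by rewrite xy mul1r.
rewrite RintegralZl//.
  by rewrite mulr_ge0// ltW// inv_weight_gt0.
apply: integrable_continuous_itv.
apply: contB; first by apply: contD; apply: contX; exact: (crot _ (cT _ _ _ _)).
by apply: contB; apply: contM; [exact: crot|exact: (crot _ (cT _ _ _ _))|exact: crot|exact: (crot _ (cT _ _ _ _))].
Qed.

End weighted_wirtinger.

Lemma young {R : realFieldType} (x y t : R) : 0 < t ->
  `|x * y| <= (t^-1 * x ^+ 2 + t * y ^+ 2) / 2.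
Proof.
move=> t0; have i0 : 0 < t^-1 by rewrite invr_gt0.
have it : t^-1 * t = 1 by rewrite mulVf// gt_eqF.
have E1 : t^-1 * (x + t * y) ^+ 2 = t^-1 * x ^+ 2 + t * y ^+ 2 + 2 * (x * y).
  transitivity (t^-1 * x ^+ 2 + (t^-1 * t) * (t * y ^+ 2) + 2 * ((t^-1 * t) * (x * y))); first by ring.
  by rewrite it !mul1r.
have E2 : t^-1 * (x - t * y) ^+ 2 = t^-1 * x ^+ 2 + t * y ^+ 2 - 2 * (x * y).
  transitivity (t^-1 * x ^+ 2 + (t^-1 * t) * (t * y ^+ 2) - 2 * ((t^-1 * t) * (x * y))); first by ring.
  by rewrite it !mul1r.
have := mulr_ge0 (ltW i0) (sqr_ge0 (x + t * y)).
have := mulr_ge0 (ltW i0) (sqr_ge0 (x - t * y)).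
by rewrite E1 E2 ler_norml; lra.
Qed.

(** * Square-integrable functions and products of L2 limits *)

Section square_integrable.
Context d (T : measurableType d) (R : realType).
Variables (mu : {measure set T -> \bar R}) (D : set T).
Hypothesis mD : measurable D.
Implicit Types (f g w : T -> R).

Local Notation integ f := (mu.-integrable D (EFin \o f)).

Lemma integrable_add f g : integ f -> integ g -> integ (fun x => f x + g x).
Proof. by move=> hf hg; exact: (integrableD mD hf hg). Qed.

Lemma integrable_opp f : integ f -> integ (fun x => - f x).
Proof. by move=> hf; exact: integrableN hf. Qed.

Lemma integrable_sub f g : integ f -> integ g -> integ (fun x => f x - g x).
Proof. by move=> hf hg; apply: integrable_add => //; exact: integrable_opp. Qed.

Lemma integrable_scale (k : R) f : integ f -> integ (fun x => k * f x).
Proof. by move=> hf; exact: (integrableZl mD k hf). Qed.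

Lemma integrable_measurable f : integ f -> measurable_fun D f.
Proof. by move=> /(measurable_int mu) /measurable_EFinP. Qed.

Lemma integrable_le f g : measurable_fun D f -> integ g ->
  (forall x, D x -> `|f x| <= g x) -> integ f.
Proof.
move=> mf ig fg; apply: (le_integrable mD _ _ ig).
  exact/measurable_EFinP.
by move=> x Dx; rewrite /= lee_fin (le_trans (fg x Dx))// ler_norm.
Qed.

Lemma integrable_bounded_mul w f (M : R) : measurable_fun D w ->
  (forall x, D x -> `|w x| <= M) -> integ f -> integ (fun x => w x * f x).
Proof.
move=> mw wM hf; have mf := integrable_measurable hf.
have hN := integrable_scale M (integrable_norm hf).
apply: (integrable_le _ hN); first exact: measurable_funM.
by move=> x Dx; rewrite normrM ler_wpM2r// wM.
Qed.

Definition sqint f := measurable_fun D f /\ integ (fun x => f x ^+ 2).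

Lemma sqint_mul f g : sqint f -> sqint g -> integ (fun x => f x * g x).
Proof.
move=> [mf hf] [mg hg]; apply: (integrable_le _ (integrable_add hf hg)).
  exact: measurable_funM.
move=> x _; rewrite ler_norml.
have := sqr_ge0 (f x + g x); have := sqr_ge0 (f x - g x).
by have := sqr_ge0 (f x); have := sqr_ge0 (g x); rewrite sqrrB sqrrD; lra.
Qed.

Lemma sqint_scale (k : R) f : sqint f -> sqint (fun x => k * f x).
Proof.
move=> [mf hf]; split; first exact: measurable_funM.
by under eq_fun do rewrite exprMn; exact: integrable_scale.
Qed.

Lemma sqint_add f g : sqint f -> sqint g -> sqint (fun x => f x + g x).
Proof.
move=> hf hg; split; first by apply: measurable_funD; [case: hf|case: hg].
have := integrable_add (integrable_add (proj2 hf) (integrable_scale 2 (sqint_mul hf hg))) (proj2 hg).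
by congr (mu.-integrable D _); apply/funext => x /=; congr EFin; ring.
Qed.

Lemma sqint_sub f g : sqint f -> sqint g -> sqint (fun x => f x - g x).
Proof.
move=> hf /(sqint_scale (-1)) hg; have := sqint_add hf hg.
by congr sqint; apply/funext => x; rewrite mulN1r.
Qed.

Lemma sqint_cst (c : R) : (mu D < +oo)%E -> sqint (fun _ => c).
Proof.
move=> fD; split; first exact: measurable_cst.
apply: measurable_bounded_integrable => //.
by exists (`|c ^+ 2|); split; rewrite ?num_real // => M cM x _; exact: ltW.
Qed.

Definition sqcvg (f_ : nat -> T -> R) f :=
  ((fun k => \int[mu]_(x in D) ((f_ k x - f x) ^+ 2)%:E) @ \oo --> 0)%E.

Lemma sqcvg_Rintegral (f_ : nat -> T -> R) f : sqcvg f_ f ->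
  \int[mu]_(x in D) (f_ k x - f x) ^+ 2 @[k --> \oo] --> (0 : R).
Proof. by move=> H; exact: (fine_cvg H). Qed.

Lemma sqcvg_cst f : sqcvg (fun _ => f) f.
Proof.
rewrite /sqcvg (_ : (fun _ => _) = fun _ => 0%E); first exact: cvg_cst.
by apply/funext => k; apply: integral0_eq => x _; rewrite subrr expr0n.
Qed.

(** Writing [f_k g_k - f g] with the differences [f_k - f] and [g_k - g], each
    product is bounded by Young's inequality with a parameter [t] that makes
    the contribution of the fixed functions small. *)
Lemma sqcvg_mul w (f_ g_ : nat -> T -> R) f g (M : R) :
  measurable_fun D w -> (forall x, D x -> `|w x| <= M) ->
  (forall k, sqint (f_ k)) -> (forall k, sqint (g_ k)) -> sqint f -> sqint g ->
  sqcvg f_ f -> sqcvg g_ g ->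
  \int[mu]_(x in D) (w x * (f_ k x * g_ k x)) @[k --> \oo] -->
  \int[mu]_(x in D) (w x * (f x * g x)).
Proof.
move=> mw wM hf_ hg_ hf hg cf cg.
have A0 := sqcvg_Rintegral cf; have C0 := sqcvg_Rintegral cg.
have iw h : integ h -> integ (fun x => w x * h x) by move=> ih; exact: (integrable_bounded_mul mw wM).
pose M1 := `|M| + 1; have M10 : 0 < M1 by rewrite /M1; have := normr_ge0 M; lra.
pose S := \int[mu]_(x in D) (f x ^+ 2 + g x ^+ 2).
have iS := integrable_add (proj2 hf) (proj2 hg).
have S0 : 0 <= S by apply: Rintegral_ge0 => x _; rewrite addr_ge0// sqr_ge0.
have bound t k : 0 < t ->
   `|\int[mu]_(x in D) (w x * (f x * g x)) - \int[mu]_(x in D) (w x * (f_ k x * g_ k x))| <=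
   M1 * ((1 + t^-1) * (\int[mu]_(x in D) (f_ k x - f x) ^+ 2 + \int[mu]_(x in D) (g_ k x - g x) ^+ 2) + t * S).
  move=> t0.
  have ifg := iw _ (sqint_mul hf hg); have ifgk := iw _ (sqint_mul (hf_ k) (hg_ k)).
  have ix := proj2 (sqint_sub (hf_ k) hf); have iy := proj2 (sqint_sub (hg_ k) hg).
  have ixy := integrable_add ix iy.
  pose h x := M1 * ((1 + t^-1) * ((f_ k x - f x) ^+ 2 + (g_ k x - g x) ^+ 2) + t * (f x ^+ 2 + g x ^+ 2)).
  have ih1 := integrable_add (integrable_scale (1 + t^-1) ixy) (integrable_scale t iS).
  have ih : integ h := integrable_scale M1 ih1.
  have -> : M1 * ((1 + t^-1) * (\int[mu]_(x in D) (f_ k x - f x) ^+ 2 + \int[mu]_(x in D) (g_ k x - g x) ^+ 2) + t * S) =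
     \int[mu]_(x in D) h x.
    rewrite /h (RintegralZl _ mD ih1) RintegralD//; try exact: integrable_scale.
    by rewrite (RintegralZl _ mD ixy) (RintegralZl _ mD iS) RintegralD.
  rewrite -RintegralB//; apply: (le_trans (le_normr_Rintegral mD (integrable_sub ifg ifgk))).
  apply: le_Rintegral => //; first exact: (integrable_norm (integrable_sub ifg ifgk)).
  move=> x Dx /=; rewrite -mulrBr normrM.
  have wM1 : `|w x| <= M1 by rewrite (le_trans (wM x Dx))// /M1; have := ler_norm M; lra.
  apply: ler_pM => //.
  rewrite distrC.
  have -> : f_ k x * g_ k x - f x * g x =
    (f_ k x - f x) * (g_ k x - g x) + (f_ k x - f x) * g x + (g_ k x - g x) * f x by ring.
  apply: (le_trans (ler_normD _ _)); apply: (le_trans (lerD (ler_normD _ _) (lexx _))).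
  have t1 : 0 < t^-1 by rewrite invr_gt0.
  have X0 := sqr_ge0 (f_ k x - f x); have Y0 := sqr_ge0 (g_ k x - g x).
  have F0 := sqr_ge0 (f x); have G0 := sqr_ge0 (g x).
  apply: (le_trans (lerD (lerD (young _ _ ltr01) (young _ _ t0)) (young _ _ t0))).
  rewrite invr1 !mul1r.
  have := mulr_ge0 (ltW t1) X0; have := mulr_ge0 (ltW t1) Y0.
  have := mulr_ge0 (ltW t0) F0; have := mulr_ge0 (ltW t0) G0.
  lra.
apply/cvgrPdist_le => e e0.
(* This choice makes the term with [t * S] at most [e / 2]; adding 1 avoids
   dividing by zero. *)
pose t := e / (2 * M1 * (S + 1)).
have t0 : 0 < t by rewrite divr_gt0// !mulr_gt0//; lra.
have tS : M1 * (t * S) <= e / 2.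
  have E : t * (2 * M1 * (S + 1)) = e by rewrite /t divfK// gt_eqF// !mulr_gt0//; lra.
  have : 0 <= t * M1 by rewrite mulr_ge0 ?ltW.
  by nra.
have t1 : 0 < 1 + t^-1 by rewrite addr_gt0// invr_gt0.
pose e' := e / 4 / (M1 * (1 + t^-1)).
have e'0 : 0 < e' by rewrite divr_gt0 ?mulr_gt0// divr_gt0.
have e'E : M1 * (1 + t^-1) * e' = e / 4 by rewrite mulrC divfK// gt_eqF// mulr_gt0.
move/cvgrPdist_le : A0 => /(_ e' e'0) A0; move/cvgrPdist_le : C0 => /(_ e' e'0) C0.
near=> k.
apply: (le_trans (bound t k t0)).
have Ak : \int[mu]_(x in D) (f_ k x - f x) ^+ 2 <= e'.
  have : `|0 - \int[mu]_(x in D) (f_ k x - f x) ^+ 2| <= e' by near: k.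
  by rewrite sub0r normrN; apply: le_trans; exact: ler_norm.
have Ck : \int[mu]_(x in D) (g_ k x - g x) ^+ 2 <= e'.
  have : `|0 - \int[mu]_(x in D) (g_ k x - g x) ^+ 2| <= e' by near: k.
  by rewrite sub0r normrN; apply: le_trans; exact: ler_norm.
rewrite mulrDr mulrA.
have : M1 * (1 + t^-1) * (\int[mu]_(x in D) (f_ k x - f x) ^+ 2 + \int[mu]_(x in D) (g_ k x - g x) ^+ 2)
   <= M1 * (1 + t^-1) * (e' + e').
  by rewrite ler_pM2l ?mulr_gt0// lerD.
by lra.
Unshelve. all: by end_near. Qed.

End square_integrable.

(** * Passage to the limit in the integral identities *)

Section integral_convergence.
Context d (T : measurableType d) (R : realType).
Variables (mu : {measure set T -> \bar R}) (D : set T).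
Hypothesis mD : measurable D.

(** Convergence of integrals together with the integrability that makes it
    stable under linear combinations. *)
Definition intcvg (h_ : nat -> T -> R) (h : T -> R) :=
  [/\ forall k, mu.-integrable D (EFin \o h_ k), mu.-integrable D (EFin \o h) &
   \int[mu]_(x in D) h_ k x @[k --> \oo] --> \int[mu]_(x in D) h x].

Lemma intcvg_add h_ h g_ g : intcvg h_ h -> intcvg g_ g ->
  intcvg (fun k x => h_ k x + g_ k x) (fun x => h x + g x).
Proof.
move=> [ih_ ih ch] [ig_ ig cg]; split.
- by move=> k; exact: integrable_add.
- exact: integrable_add.
- under eq_fun do rewrite RintegralD//.
  by rewrite RintegralD//; exact: cvgD.
Qed.

Lemma intcvg_scale (c : R) h_ h : intcvg h_ h -> intcvg (fun k x => c * h_ k x) (fun x => c * h x).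
Proof.
move=> [ih_ ih ch]; split.
- by move=> k; exact: integrable_scale.
- exact: integrable_scale.
- under eq_fun do rewrite RintegralZl//.
  by rewrite RintegralZl//; apply: cvgM => //; exact: cvg_cst.
Qed.

Lemma intcvg_sub h_ h g_ g : intcvg h_ h -> intcvg g_ g ->
  intcvg (fun k x => h_ k x - g_ k x) (fun x => h x - g x).
Proof.
move=> Hh /(intcvg_scale (-1)) Hg; have := intcvg_add Hh Hg.
congr intcvg; first by apply/funext => k; apply/funext => x; rewrite mulN1r.
by apply/funext => x; rewrite mulN1r.
Qed.

Lemma intcvg_eq h_ h g_ g : (forall k, h_ k =1 g_ k) -> h =1 g ->
  intcvg h_ h -> intcvg g_ g.
Proof.
by move=> E /funext ->; have -> : h_ = g_ by apply/funext => k; exact/funext.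
Qed.

Lemma intcvg_const h_ h (c : R) : intcvg h_ h ->
  (forall k, \int[mu]_(x in D) h_ k x = c) -> \int[mu]_(x in D) h x = c.
Proof.
move=> [_ _ cv] E; rewrite (_ : (fun k => _) = fun _ => c) in cv; last exact/funext.
by apply: (cvg_unique _ cv) => //; exact: cvg_cst.
Qed.

Lemma intcvg_ge0 h_ h : intcvg h_ h ->
  (forall k, 0 <= \int[mu]_(x in D) h_ k x) -> 0 <= \int[mu]_(x in D) h x.
Proof.
move=> [_ _ cv] E; rewrite -(cvg_lim _ cv)//; apply: limr_ge; first by apply/cvg_ex; eexists; exact: cv.
exact: nearW.
Qed.

Lemma intcvg_mul (w : T -> R) (f_ g_ : nat -> T -> R) (f g : T -> R) (M : R) :
  measurable_fun D w -> (forall x, D x -> `|w x| <= M) ->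
  (forall k, sqint mu D (f_ k)) -> (forall k, sqint mu D (g_ k)) -> sqint mu D f -> sqint mu D g ->
  sqcvg mu D f_ f -> sqcvg mu D g_ g ->
  intcvg (fun k x => w x * (f_ k x * g_ k x)) (fun x => w x * (f x * g x)).
Proof.
move=> mw wM hf_ hg_ hf hg cf cg; split.
- by move=> k; apply: (integrable_bounded_mul mD mw wM); exact: sqint_mul.
- by apply: (integrable_bounded_mul mD mw wM); exact: sqint_mul.
- exact: (sqcvg_mul mD mw wM).
Qed.

Lemma intcvg_lin (w : T -> R) (f_ : nat -> T -> R) (f : T -> R) (M : R) : (mu D < +oo)%E ->
  measurable_fun D w -> (forall x, D x -> `|w x| <= M) ->
  (forall k, sqint mu D (f_ k)) -> sqint mu D f -> sqcvg mu D f_ f ->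
  intcvg (fun k x => w x * f_ k x) (fun x => w x * f x).
Proof.
move=> fD mw wM hf_ hf cf; have h1 := sqint_cst mD 1 fD.
have := intcvg_mul mw wM hf_ (fun=> h1) hf h1 cf (sqcvg_cst mu D (fun _ => 1)).
by apply: intcvg_eq => [k x|x]; rewrite mulr1.
Qed.

End integral_convergence.

Section disc_limits.
Context {R : realType}.
Local Notation B := (unit_ball R).
Local Notation mu := (leb2 R).
Local Notation leb := (@lebesgue_measure R).
Local Notation j0 := (ord0 : 'I_2).
Local Notation j1 := (lift ord0 ord0 : 'I_2).
Local Notation mB := (@measurable_unit_ball R).

Lemma sqint_continuous (f : R * R -> R) : continuous f -> sqint mu B f.
Proof.
move=> cf; split; first by apply: measurable_funTS; exact: continuous_measurable_plane.
by apply: integrable_continuous_ball; exact: contX.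
Qed.

(** What the definition of the trace gives for a displacement: approximations
    in W^{1,2} by functions regular enough for the identities above, with
    boundary values that tend to zero in L^2 of the circle. *)
Definition trace_zero_approx (phi a b : R * R -> R) (phi_ a_ b_ : nat -> R * R -> R) :=
  [/\ forall k, [/\ C1_along j0 (phi_ k) (a_ k), C1_along j1 (phi_ k) (b_ k),
         exists a1, C1_along j1 (a_ k) a1 & exists b0, C1_along j0 (b_ k) b0],
      [/\ sqint mu B phi, sqint mu B a & sqint mu B b],
      [/\ sqcvg mu B phi_ phi, sqcvg mu B a_ a & sqcvg mu B b_ b] &
      sqcvg leb `[0%R, (2 * pi)%R] (fun k t => phi_ k (cos t, sin t)) (fun _ => 0)].

Lemma intcvg_continuous_mul (w : R * R -> R) (f_ g_ : nat -> R * R -> R) (f g : R * R -> R) : continuous w ->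
  (forall k, continuous (f_ k)) -> (forall k, continuous (g_ k)) -> sqint mu B f -> sqint mu B g ->
  sqcvg mu B f_ f -> sqcvg mu B g_ g ->
  intcvg mu B (fun k x => w x * (f_ k x * g_ k x)) (fun x => w x * (f x * g x)).
Proof.
move=> cw cf_ cg_ hf hg cf cg.
have [M [_ HM]] := continuous_bounded_ball cw.
have wM p : B p -> `|w p| <= M + 1 by move=> Bp; apply: HM => //; lra.
apply: (intcvg_mul mB _ wM) => //.
- by apply: measurable_funTS; exact: continuous_measurable_plane.
- by move=> k; exact: sqint_continuous.
- by move=> k; exact: sqint_continuous.
Qed.

Lemma intcvg_continuous_lin (w : R * R -> R) (f_ : nat -> R * R -> R) (f : R * R -> R) : continuous w ->
  (forall k, continuous (f_ k)) -> sqint mu B f -> sqcvg mu B f_ f ->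
  intcvg mu B (fun k x => w x * f_ k x) (fun x => w x * f x).
Proof.
move=> cw cf_ hf cf.
have [M [_ HM]] := continuous_bounded_ball cw.
have wM p : B p -> `|w p| <= M + 1 by move=> Bp; apply: HM => //; lra.
apply: (intcvg_lin mB (@leb2_unit_ball_lty R) _ wM) => //.
- by apply: measurable_funTS; exact: continuous_measurable_plane.
- by move=> k; exact: sqint_continuous.
Qed.

Variables (u v a b c d : R * R -> R) (u_ v_ a_ b_ c_ d_ : nat -> R * R -> R).
Hypotheses (Hu : trace_zero_approx u a b u_ a_ b_) (Hv : trace_zero_approx v c d v_ c_ d_).

Let cX : continuous (fun p : R * R => p.1). Proof. exact: continuous_fst2. Qed.
Let cY : continuous (fun p : R * R => p.2). Proof. exact: continuous_snd2. Qed.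

Let cont_approx (w f g : R * R -> R) w_ f_ g_ : trace_zero_approx w f g w_ f_ g_ ->
  [/\ forall k, continuous (w_ k), forall k, continuous (f_ k) & forall k, continuous (g_ k)].
Proof. by case=> H _ _ _; split => k; have [[? ? _] [_ ? _] _ _] := H k. Qed.

Lemma limit_log_weight_divergence (e : R) : 0 < e ->
  \int[mu]_(p in B) (log_weight e p * (a p + d p) + inv_weight e p *
    (p.2 ^+ 2 * a p - p.1 * p.2 * b p - p.1 * p.2 * c p + p.1 ^+ 2 * d p)) = 0.
Proof.
move=> e0.
have [_ ca cb] := cont_approx Hu; have [_ cc cd] := cont_approx Hv.
have [Du [_ ha hb] [_ qa qb] _] := Hu; have [Dv [_ hc hd] [_ qc qd] _] := Hv.
have [cL _ _] := log_weight_C1 e0 j0; have [cQ _ _] := inv_weight_C1 e0 j0.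
have cQM (f g : R * R -> R) : continuous f -> continuous g -> continuous (fun p => inv_weight e p * (f p * g p)).
  by move=> cf cg; apply: contM => //; exact: contM.
have H : intcvg mu B
   (fun k p => log_weight e p * (a_ k p + d_ k p) + inv_weight e p *
    (p.2 ^+ 2 * a_ k p - p.1 * p.2 * b_ k p - p.1 * p.2 * c_ k p + p.1 ^+ 2 * d_ k p))
   (fun p => log_weight e p * (a p + d p) + inv_weight e p *
    (p.2 ^+ 2 * a p - p.1 * p.2 * b p - p.1 * p.2 * c p + p.1 ^+ 2 * d p)).
  apply: intcvg_eq; last first.
  - exact: (intcvg_add mB (intcvg_add mB (intcvg_continuous_lin cL ca ha qa) (intcvg_continuous_lin cL cd hd qd))
     (intcvg_add mB (intcvg_sub mB (intcvg_sub mB (intcvg_continuous_lin (cQM _ _ cY cY) ca ha qa)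
       (intcvg_continuous_lin (cQM _ _ cX cY) cb hb qb)) (intcvg_continuous_lin (cQM _ _ cX cY) cc hc qc))
       (intcvg_continuous_lin (cQM _ _ cX cX) cd hd qd))).
  - by move=> p /=; ring.
  - by move=> k p /=; ring.
apply: (intcvg_const H) => k.
have [ua ub _ _] := Du k; have [vc vd _ _] := Dv k.
exact: (integral_log_weight_divergence ua ub vc vd).
Qed.

(** For the approximations this is the sum of the identity for the determinant
    and of Wirtinger's inequality, in which the terms containing the
    displacement itself cancel; only the gradient is left in the limit. *)
Lemma limit_quadratic_ge0 (e : R) : 0 < e ->
  0 <= \int[mu]_(p in B) (2 * log_weight e p * (a p * d p - b p * c p) + inv_weight e p *
    ((p.1 * b p - p.2 * a p) ^+ 2 + (p.1 * d p - p.2 * c p) ^+ 2)).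
Proof.
move=> e0.
have [cu ca cb] := cont_approx Hu; have [cv cc cd] := cont_approx Hv.
have [Du [_ ha hb] [_ qa qb] _] := Hu; have [Dv [_ hc hd] [_ qc qd] _] := Hv.
have [cL _ _] := log_weight_C1 e0 j0; have [cQ _ _] := inv_weight_C1 e0 j0.
have cQM (f g : R * R -> R) : continuous f -> continuous g -> continuous (fun p => inv_weight e p * (f p * g p)).
  by move=> cf cg; apply: contM => //; exact: contM.
have cT (f g : R * R -> R) : continuous f -> continuous g -> continuous (fun p : R * R => p.1 * g p - p.2 * f p).
  by move=> cf cg; apply: contB; exact: contM.
have H : intcvg mu B
   (fun k p => 2 * log_weight e p * (a_ k p * d_ k p - b_ k p * c_ k p) + inv_weight e p *
    ((p.1 * b_ k p - p.2 * a_ k p) ^+ 2 + (p.1 * d_ k p - p.2 * c_ k p) ^+ 2))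
   (fun p => 2 * log_weight e p * (a p * d p - b p * c p) + inv_weight e p *
    ((p.1 * b p - p.2 * a p) ^+ 2 + (p.1 * d p - p.2 * c p) ^+ 2)).
  have cL2 : continuous (fun p => 2 * log_weight e p) by apply: contM => //; exact: contC.
  have M w cw := fun f_ g_ f g cf cg hf hg qf qg => @intcvg_continuous_mul w f_ g_ f g cw cf cg hf hg qf qg.
  apply: intcvg_eq; last first.
  + exact: (intcvg_add mB
     (intcvg_sub mB (M _ cL2 _ _ _ _ ca cd ha hd qa qd) (M _ cL2 _ _ _ _ cb cc hb hc qb qc))
     (intcvg_add mB
      (intcvg_add mB (intcvg_sub mB (M _ (cQM _ _ cX cX) _ _ _ _ cb cb hb hb qb qb)
         (intcvg_scale mB 2 (M _ (cQM _ _ cX cY) _ _ _ _ ca cb ha hb qa qb)))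
        (M _ (cQM _ _ cY cY) _ _ _ _ ca ca ha ha qa qa))
      (intcvg_add mB (intcvg_sub mB (M _ (cQM _ _ cX cX) _ _ _ _ cd cd hd hd qd qd)
         (intcvg_scale mB 2 (M _ (cQM _ _ cX cY) _ _ _ _ cc cd hc hd qc qd)))
        (M _ (cQM _ _ cY cY) _ _ _ _ cc cc hc hc qc qc)))).
  + by move=> p /=; ring.
  + by move=> k p /=; ring.
apply: (intcvg_ge0 H) => k; have [ua ub [a1 aa1] [b0 bb0]] := Du k; have [vc vd [c1 cc1] [d0 dd0]] := Dv k.
  have H1 := integral_log_weight_det ua ub vc vd e0 aa1 bb0 cc1 dd0.
  have H2 := weighted_wirtinger e0 ua ub vc vd.
  have H1' := lexx (0 : R); rewrite -{2}H1 in H1'.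
  have := addr_ge0 H1' H2; rewrite -RintegralD//; last 3 first.
  + exact: mB.
  + apply: integrable_continuous_ball; apply: contD; apply: contM => //.
    * by apply: contM => //; exact: contC.
    * by apply: contB; exact: contM.
    * by apply: contB; apply: contM => //; exact: cT.
  + apply: integrable_continuous_ball; apply: contM => //; apply: contB.
      by apply: contD; apply: contX; exact: cT.
    by apply: contB; apply: contM => //; exact: cT.
  by congr (_ <= _); apply: eq_Rintegral => p _; ring.
Qed.

(** The circle integrals of the approximations tend to zero with their boundary
    values. *)
Lemma limit_divergence : \int[mu]_(p in B) (a p + d p) = 0.
Proof.
have [cu ca cb] := cont_approx Hu; have [cv cc cd] := cont_approx Hv.
have [Du [_ ha hb] [_ qa qb] tu] := Hu; have [Dv [_ hc hd] [_ qc qd] tv] := Hv.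
have H : intcvg mu B (fun k p => a_ k p + d_ k p) (fun p => a p + d p).
  have c1 : continuous (fun _ : R * R => 1 : R) by exact: contC.
  have := intcvg_add mB (intcvg_continuous_lin c1 ca ha qa) (intcvg_continuous_lin c1 cd hd qd).
  by apply: intcvg_eq => [k p|p]; rewrite !mul1r.
have mI : measurable (`[0%R, (2 * pi)%R]%classic : set (measurableTypeR R)) by exact: measurable_itv.
have fI : (leb `[0%R, (2 * pi)%R] < +oo)%E.
  by rewrite lebesgue_measure_itv/=; case: ifP => // _; rewrite -EFinB ltry.
have lin (w : R -> R) f_ : continuous w -> (forall t, `|w t| <= 1) -> (forall k, continuous (f_ k)) ->
   sqcvg leb `[0%R, (2 * pi)%R] (fun k t => f_ k (cos t, sin t)) (fun _ => 0) ->
   intcvg leb `[0%R, (2 * pi)%R] (fun k t => w t * f_ k (cos t, sin t)) (fun t => w t * 0).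
  move=> cw w1 cf q; apply: (intcvg_lin mI fI _ (fun x _ => w1 x)) => //.
  - by apply: measurable_funTS; exact: continuous_measurable_fun.
  - move=> k; split.
      by apply: measurable_funTS; apply: continuous_measurable_fun; exact: continuous_circle.
    by apply: integrable_continuous_itv; apply: contX; exact: continuous_circle.
  - exact: sqint_cst.
have [_ _ cv1] := intcvg_add mI (lin _ _ (@continuous_cos R) (@cos_max R) cu tu)
  (lin _ _ (@continuous_sin R) (@sin_max R) cv tv).
have [_ _ cv2] := H.
apply: cvg_unique cv2 _ => //.
have E0 : \int[leb]_(t in `[0%R, (2 * pi)%R]) (cos t * 0 + sin t * 0) = 0 :> R.
  by under eq_Rintegral do rewrite !mulr0 addr0; rewrite /Rintegral integral0.
rewrite E0 in cv1; apply: cvg_trans cv1.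
apply: near_eq_cvg; apply: nearW => k /=.
have [ua ub _ _] := Du k; have [vc vd _ _] := Dv k.
rewrite (integral_divergence ua vd) /circle_integral.
by apply: eq_Rintegral => t _ /=; ring.
Qed.

Lemma limit_square_divergence :
  \int[mu]_(p in B) (2 * (u p * u p) + 2 * p.1 * (u p * a p) + 2 * p.2 * (u p * b p)) = 0.
Proof.
have [cu ca cb] := cont_approx Hu.
have [Du [hu ha hb] [qu qa qb] tu] := Hu.
have c2 : continuous (fun _ : R * R => 2 : R) by exact: contC.
have [_ _ cv] := intcvg_add mB (intcvg_add mB (intcvg_continuous_mul c2 cu cu hu hu qu qu)
  (intcvg_continuous_mul (contM c2 cX) cu ca hu ha qu qa))
  (intcvg_continuous_mul (contM c2 cY) cu cb hu hb qu qb).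
apply: (cvg_unique _ cv) => //.
apply: cvg_trans (sqcvg_Rintegral tu); apply: near_eq_cvg; apply: nearW => k /=.
have [ua ub _ _] := Du k.
under eq_Rintegral do rewrite subr0.
rewrite -[LHS](integral_square_divergence ua ub).
by apply: eq_Rintegral => p _; ring.
Qed.

End disc_limits.

(** * Displacements of maps with identity trace *)

Section Cn_calculus.
Context {R : realType}.
Implicit Types f g : R * R -> R.

Lemma Cn_lower n f : Cn n.+1 f -> Cn n f.
Proof.
elim: n f => [|n IH] f; first by case=> cf _; split.
case=> cf Df; split => // j; have [dj cj] := Df j; split => //.
exact: IH.
Qed.

Lemma Cn_continuous n f : Cn n f -> continuous f.
Proof. by case: n => [|n] []. Qed.

(** Derivatives may be supplied explicitly instead of through [partial]. *)
Lemma Cn_intro n f (df : 'I_2 -> R * R -> R) :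
  (forall j, C1_along j f (df j)) -> (forall j, Cn n (df j)) -> Cn n.+1 f.
Proof.
move=> Df Cdf; split; first by case: (Df ord0).
move=> j; have [_ _ D] := Df j; split; first by move=> p; case: (D p).
suff -> : partial j f = df j by [].
by apply/funext => p; rewrite /partial derive_val.
Qed.

Lemma Cn_C1 n f j : Cn n.+1 f -> C1_along j f (partial j f).
Proof.
case=> cf /(_ j)[Df cdf].
by split => //; exact: Cn_continuous cdf.
Qed.

Lemma Cn_add n f g : Cn n f -> Cn n g -> Cn n (fun p => f p + g p).
Proof.
elim: n f g => [|n IH] f g Cf Cg; first by split => //; apply: contD; [exact: Cn_continuous Cf|exact: Cn_continuous Cg].
apply: (Cn_intro (df := fun j p => partial j f p + partial j g p)) => j.
  by apply: C1D; [exact: Cn_C1 Cf|exact: Cn_C1 Cg].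
by apply: IH; [case: Cf => _ /(_ j)[]|case: Cg => _ /(_ j)[]].
Qed.

Lemma Cn_mul n f g : Cn n f -> Cn n g -> Cn n (fun p => f p * g p).
Proof.
elim: n f g => [|n IH] f g Cf Cg; first by split => //; apply: contM; [exact: Cn_continuous Cf|exact: Cn_continuous Cg].
apply: (Cn_intro (df := fun j p => f p * partial j g p + g p * partial j f p)) => j.
  by apply: C1M; [exact: Cn_C1 Cf|exact: Cn_C1 Cg].
apply: Cn_add; apply: IH.
- exact: Cn_lower.
- by case: Cg => _ /(_ j)[].
- exact: Cn_lower.
- by case: Cf => _ /(_ j)[].
Qed.

Lemma Cn_cst n (c : R) : Cn n (fun _ => c).
Proof.
elim: n c => [|n IH] c; first by split => //; exact: contC.
apply: (Cn_intro (df := fun j p => 0)) => j; last exact: IH.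
exact: C1C.
Qed.

Lemma Cn_coord n (i : 'I_2) : Cn n (@Defs.coord R i).
Proof.
case: n => [|n]; first by split => //; case: (C1_coord (R := R) i ord0).
by apply: Cn_intro; [move=> j; exact: C1_coord|move=> j; exact: Cn_cst].
Qed.

End Cn_calculus.

Section admissible.
Context {R : realType}.
Local Notation B := (unit_ball R).
Local Notation mu := (leb2 R).
Local Notation j0 := (ord0 : 'I_2).
Local Notation j1 := (lift ord0 ord0 : 'I_2).
Local Notation mB := (@measurable_unit_ball R).

Lemma weak_gradient_wgrad (w : R * R -> R) : W12 w -> weak_gradient w (wgrad w).
Proof. by case=> _ wg; exact: (@xgetPex _ _ [set g | weak_gradient w g] wg). Qed.

(** The smooth functions that define the trace, minus the coordinate, approximate
    the displacement. *)
Lemma trace_coord_approx (i : 'I_2) (w : R * R -> R) : W12 w -> has_trace w (Defs.coord i) ->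
  exists phi_ a_ b_, trace_zero_approx (fun p => w p - Defs.coord i p)
    (fun p => wgrad w p 0 j0 - (i == j0)%:R) (fun p => wgrad w p 0 j1 - (i == j1)%:R)
    phi_ a_ b_.
Proof.
move=> Ww [U [sU cU cdU tU]]; have gw := weak_gradient_wgrad Ww.
exists (fun k p => U k p - Defs.coord i p), (fun k p => partial j0 (U k) p - (i == j0)%:R),
  (fun k p => partial j1 (U k) p - (i == j1)%:R).
split.
- move=> k; have [_ C2] := sU k 2.
  have C1p j : Cn 1 (partial j (U k)) by exact: (C2 j).2.
  have C1U j : C1_along j (U k) (partial j (U k)) by exact/Cn_C1/(sU k 1%N).
  split; [exact: (C1B (C1U j0) (C1_coord i j0))|exact: (C1B (C1U j1) (C1_coord i j1))|..].
    by eexists; exact: (C1B (Cn_C1 j1 (C1p j0)) (C1C j1 _)).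
  by eexists; exact: (C1B (Cn_C1 j0 (C1p j1)) (C1C j0 _)).
- have ccoord : continuous (@Defs.coord R i) by have [] := C1_coord (R := R) i j0.
  split; apply: (sqint_sub mB).
  + by case: Ww.
  + exact: sqint_continuous.
  + by case: (gw j0).
  + by apply: sqint_continuous; exact: contC.
  + by case: (gw j1).
  + by apply: sqint_continuous; exact: contC.
- have E (f_ : nat -> R * R -> R) (f g : R * R -> R) : sqcvg mu B f_ f ->
    sqcvg mu B (fun k p => f_ k p - g p) (fun p => f p - g p).
    rewrite /sqcvg; under [X in _ -> X @ _ --> _]eq_fun do under eq_integral do rewrite opprB addrA subrK.
    by [].
  split; first exact: E.
    exact: (E (fun k => partial j0 (U k)) (fun p => wgrad w p 0 j0) (fun=> (i == j0)%:R) (cdU j0)).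
  exact: (E (fun k => partial j1 (U k)) (fun p => wgrad w p 0 j1) (fun=> (i == j1)%:R) (cdU j1)).
- move: tU; rewrite /sqcvg; under [X in _ -> X @ _ --> _]eq_fun do under eq_integral do rewrite subr0.
  by [].
Qed.

End admissible.

(** * Expansion of the energy density at the identity *)

Section density.
Context {R : realType}.
Local Notation j0 := (ord0 : 'I_2).
Local Notation j1 := (lift ord0 ord0 : 'I_2).

Definition density (eps : R) (A : 'M[R]_2) (h : 'cV[R]_2) : R :=
  eps^-1 * sqnorm (A^T *m h) + eps * sqnorm (\adj A *m h).

Definition coord_density (eps h1 h2 A11 A12 A21 A22 : R) : R :=
  eps^-1 * ((A11 * h1 + A21 * h2) ^+ 2 + (A12 * h1 + A22 * h2) ^+ 2)
  + eps * ((A22 * h1 - A12 * h2) ^+ 2 + (A11 * h2 - A21 * h1) ^+ 2).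

(** The component [F t . t] of the displacement gradient in the direction [t]
    orthogonal to the radial direction. *)
Definition hoop_strain (h1 h2 a b c d : R) : R :=
  h2 ^+ 2 * a - h1 * h2 * b - h1 * h2 * c + h1 ^+ 2 * d.

Lemma densityE (eps : R) (A : 'M[R]_2) (h : 'cV[R]_2) :
  density eps A h =
  coord_density eps (h j0 0) (h j1 0) (A j0 j0) (A j0 j1) (A j1 j0) (A j1 j1).
Proof.
have adjE : (\adj A *m h) j0 0 = A j1 j1 * h j0 0 - A j0 j1 * h j1 0 /\
    (\adj A *m h) j1 0 = A j0 j0 * h j1 0 - A j1 j0 * h j0 0.
  rewrite !mxE !big_ord_recl !big_ord0 !mxE /cofactor !det_mx11 !mxE.
  have l0 : lift j1 (ord0 : 'I_1) = j0 by apply: val_inj.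
  by rewrite !l0 /=; split; ring.
rewrite /density /sqnorm !big_ord_recl !big_ord0 !addr0 adjE.1 adjE.2.
by rewrite !mxE !big_ord_recl !big_ord0 !mxE !addr0.
Qed.

Lemma det22 (A : 'M[R]_2) : \det A = A j0 j0 * A j1 j1 - A j0 j1 * A j1 j0.
Proof.
rewrite (expand_det_row A j0) !big_ord_recl big_ord0 /cofactor !det_mx11 !mxE.
have l0 : lift j1 (ord0 : 'I_1) = j0 by apply: val_inj.
by rewrite !l0 /=; ring.
Qed.

Lemma hatE (p : R * R) : hat p j0 0 = p.1 / Num.sqrt (p.1 ^+ 2 + p.2 ^+ 2) /\
  hat p j1 0 = p.2 / Num.sqrt (p.1 ^+ 2 + p.2 ^+ 2).
Proof.
rewrite /hat !mxE /sqnorm !big_ord_recl !big_ord0 !mxE /Defs.coord/= addr0.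
by split; rewrite mulrC.
Qed.

Lemma hat_bound (p : R * R) (j : 'I_2) : `|hat p j 0| <= 1.
Proof.
have [h0 h1] := hatE p.
pose r := Num.sqrt (p.1 ^+ 2 + p.2 ^+ 2).
have key (z : R) : z ^+ 2 <= p.1 ^+ 2 + p.2 ^+ 2 -> `|z / r| <= 1.
  move=> zr; have r0 : 0 <= r by exact: sqrtr_ge0.
  have zr' : `|z| <= r by rewrite -sqrtr_sqr ler_wsqrtr.
  have [->|rn] := eqVneq r 0; first by rewrite invr0 mulr0 normr0.
  by rewrite normrM normfV (ger0_norm r0) ler_pdivrMr ?mul1r// lt_def rn r0.
have := sqr_ge0 p.1; have := sqr_ge0 p.2 => p2 p1.
case: j => -[|[|//]] ltj; [have -> : Ordinal ltj = j0 by apply: val_inj|have -> : Ordinal ltj = j1 by apply: val_inj].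
  by rewrite h0; apply: key; lra.
by rewrite h1; apply: key; lra.
Qed.

Lemma hat_polar (p : R * R) : p != (0, 0) ->
  exists r, [/\ 0 < r, r ^+ 2 = p.1 ^+ 2 + p.2 ^+ 2, p.1 = r * hat p j0 0, p.2 = r * hat p j1 0 &
    hat p j0 0 ^+ 2 + hat p j1 0 ^+ 2 = 1].
Proof.
move=> p0; have [-> ->] := hatE p; set r := Num.sqrt _.
have s0 : 0 <= p.1 ^+ 2 + p.2 ^+ 2 by rewrite addr_ge0// sqr_ge0.
have sn : p.1 ^+ 2 + p.2 ^+ 2 != 0.
  apply: contra p0; rewrite paddr_eq0 ?sqr_ge0// !sqrf_eq0; case: p {r s0} => x y /=.
  by move=> /andP[/eqP -> /eqP ->].
have r0 : 0 < r by rewrite sqrtr_gt0 lt_def sn s0.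
have rr : r ^+ 2 = p.1 ^+ 2 + p.2 ^+ 2 by exact: sqr_sqrtr.
exists r; split => //; try by rewrite mulrC divfK// gt_eqF.
by rewrite !expr_div_n -mulrDl rr divff.
Qed.

(** The terms on the left are arranged as they integrate: the trace, the two
    lines in which the weights enter (with [k] the ratio of [r ^+ 2] to its
    regularisation), the remainder of the linear term, and the quadratic
    surplus. With [X = |F^T h|^2], [Y = |adj F h|^2], [Z = |F t|^2] and
    [V = |F h|^2], the norm of [F] is both [X + Y] and [Z + V]; after
    cancelling the linear terms by the constraint, the two sides differ by
    [c0 * (Y + V + (1 - k) * Z)], where [c0] is [eps - eps^-1]. *)
Lemma density_excess (eps h1 h2 a b c d lam k : R) : 1 <= eps ->
  h1 ^+ 2 + h2 ^+ 2 = 1 -> 0 <= k <= 1 -> a + d + (a * d - b * c) = 0 ->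
  (2 / eps) * (a + d) + 2 * (eps - eps^-1) * (lam * (a + d) + k * hoop_strain h1 h2 a b c d)
  + (eps - eps^-1) * (2 * lam * (a * d - b * c) + k * ((h1 * b - h2 * a) ^+ 2 + (h1 * d - h2 * c) ^+ 2))
  + 2 * (eps - eps^-1) * ((1 - k) * hoop_strain h1 h2 a b c d) + (2 / eps - eps) * (a ^+ 2 + b ^+ 2 + c ^+ 2 + d ^+ 2)
  <= coord_density eps h1 h2 (1 + a) b c (1 + d) - coord_density eps h1 h2 1 0 0 1.
Proof.
move=> e1 hh /andP[k0 k1] det; have e0 : 0 < eps by lra.
set W := coord_density eps h1 h2; set Ftt := hoop_strain h1 h2 a b c d.
set c0 := eps - eps^-1.
have ei : eps * eps^-1 = 1 by rewrite divff// gt_eqF.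
have i0 : 0 < eps^-1 by rewrite invr_gt0.
have i1 : eps^-1 <= 1 by rewrite invf_le1.
have c00 : 0 <= c0 by rewrite /c0; lra.
pose X := (a * h1 + c * h2) ^+ 2 + (b * h1 + d * h2) ^+ 2.
pose Y := (d * h1 - b * h2) ^+ 2 + (a * h2 - c * h1) ^+ 2.
pose Z := (h1 * b - h2 * a) ^+ 2 + (h1 * d - h2 * c) ^+ 2.
pose V := (a * h1 + b * h2) ^+ 2 + (c * h1 + d * h2) ^+ 2.
have N1 : X + Y = a ^+ 2 + b ^+ 2 + c ^+ 2 + d ^+ 2.
  transitivity ((h1 ^+ 2 + h2 ^+ 2) * (a ^+ 2 + b ^+ 2 + c ^+ 2 + d ^+ 2)); first by rewrite /X /Y; ring.
  by rewrite hh mul1r.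
have N2 : Z + V = a ^+ 2 + b ^+ 2 + c ^+ 2 + d ^+ 2.
  transitivity ((h1 ^+ 2 + h2 ^+ 2) * (a ^+ 2 + b ^+ 2 + c ^+ 2 + d ^+ 2)); first by rewrite /Z /V; ring.
  by rewrite hh mul1r.
have Y0 : 0 <= Y by rewrite addr_ge0// sqr_ge0.
have Z0 : 0 <= Z by rewrite addr_ge0// sqr_ge0.
have V0 : 0 <= V by rewrite addr_ge0// sqr_ge0.
pose Frr := h1 ^+ 2 * a + h1 * h2 * b + h1 * h2 * c + h2 ^+ 2 * d.
have tr : Frr + Ftt = a + d.
  transitivity ((h1 ^+ 2 + h2 ^+ 2) * (a + d)); first by rewrite /Frr /Ftt /hoop_strain; ring.
  by rewrite hh mul1r.
have WE : W (1 + a) b c (1 + d) - W 1 0 0 1 =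
    (2 * eps^-1 * Frr + 2 * eps * Ftt) + (eps^-1 * X + eps * Y).
  by rewrite /W /coord_density /Frr /Ftt /hoop_strain /X /Y; ring.
have XY : eps^-1 * X + eps * Y = eps^-1 * (X + Y) + c0 * Y by rewrite /c0; ring.
have linE : 2 * eps^-1 * Frr + 2 * eps * Ftt = (2 / eps) * (a + d) + 2 * c0 * Ftt.
  by rewrite -tr /c0; ring.
have dE : a * d - b * c = - (a + d) by lra.
rewrite WE XY linE N1 -N2 dE -/Z.
have cY := mulr_ge0 c00 Y0.
have cZ : c0 * (k * Z) <= c0 * Z by rewrite ler_wpM2l// ler_piMl.
have cV := mulr_ge0 c00 V0.
have -> : 2 / eps - eps = eps^-1 - c0 by rewrite /c0; ring.
have -> : (eps^-1 - c0) * (Z + V) = eps^-1 * (Z + V) - c0 * Z - c0 * V by ring.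
set t := eps^-1 * (Z + V) in cY cZ cV *.
have -> : 2 / eps * (a + d) + 2 * c0 * (lam * (a + d) + k * Ftt) +
  c0 * (2 * lam * - (a + d) + k * Z) + 2 * c0 * ((1 - k) * Ftt) + (t - c0 * Z - c0 * V) =
  2 / eps * (a + d) + 2 * c0 * Ftt + c0 * (k * Z) + t - c0 * Z - c0 * V by ring.
lra.
Qed.

End density.

(** * Comparison of integrals almost everywhere *)

Section ae_comparison.
Context d (T : measurableType d) (R : realType).
Variables (mu : {measure set T -> \bar R}) (D : set T).
Hypothesis mD : measurable D.

Lemma ae_eq_Rintegral (f g : T -> R) : measurable_fun D f -> measurable_fun D g ->
  {ae mu, forall x, D x -> f x = g x} -> \int[mu]_(x in D) f x = \int[mu]_(x in D) g x.
Proof.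
move=> mf mg fg; rewrite /Rintegral; congr fine.
apply: ae_eq_integral => //; try exact/measurable_EFinP.
by apply: filterS fg => x fg Dx; rewrite fg.
Qed.

(** Comparing with the maximum of the two functions reduces an inequality that
    holds almost everywhere to one that holds everywhere. *)
Lemma ae_le_Rintegral (f g : T -> R) :
  mu.-integrable D (EFin \o f) -> mu.-integrable D (EFin \o g) ->
  {ae mu, forall x, D x -> f x <= g x} ->
  \int[mu]_(x in D) f x <= \int[mu]_(x in D) g x.
Proof.
move=> hf hg fg.
have mf := integrable_measurable hf; have mg := integrable_measurable hg.
have mM : measurable_fun D (fun x => Num.max (f x) (g x)) by exact: measurable_maxr.
rewrite (@ae_eq_Rintegral g (fun x => Num.max (f x) (g x)))//; last first.
  by apply: filterS fg => x fg Dx; rewrite (max_idPr (fg Dx)).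
apply: le_Rintegral => //; last by move=> x _; rewrite le_max lexx.
apply: (integrable_le mD mM (integrable_add mD (integrable_norm hf) (integrable_norm hg))).
by move=> x _ /=; rewrite maxEle; case: ifP => _; rewrite ?lerDl ?lerDr.
Qed.

End ae_comparison.

Section measurable_hat.
Context {R : realType}.

Lemma measurable_invr : measurable_fun [set: R] (fun x : R => x^-1).
Proof.
rewrite -(setUv [set (0 : R)]); apply/measurable_funU => //; first exact: measurableC.
split; first exact: measurable_fun_set1.
apply: open_continuous_measurable_fun; first exact: closed_openC.
by move=> x; rewrite inE => /eqP x0; exact: inv_continuous.
Qed.

Lemma measurable_hat (j : 'I_2) : measurable_fun [set: plane R] (fun p : R * R => hat p j 0).
Proof.
have mr : measurable_fun [set: plane R] (fun p : R * R => (Num.sqrt (p.1 ^+ 2 + p.2 ^+ 2))^-1).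
  apply: (measurableT_comp measurable_invr); apply: continuous_measurable_plane.
  apply: (@cont_comp R _ (@Num.sqrt R)); first exact: sqrt_continuous.
  by apply: contD; apply: contX; [exact: continuous_fst2|exact: continuous_snd2].
have H p := hatE (R := R) p.
case: j => -[|[|//]] ltj.
  have -> : (fun p : R * R => hat p (Ordinal ltj) 0) = (fun p => p.1 / Num.sqrt (p.1 ^+ 2 + p.2 ^+ 2)).
    by apply/funext => p; rewrite -(H p).1; congr (hat p _ _); exact: val_inj.
  by apply: measurable_funM => //; exact: measurable_fst.
have -> : (fun p : R * R => hat p (Ordinal ltj) 0) = (fun p => p.2 / Num.sqrt (p.1 ^+ 2 + p.2 ^+ 2)).
  by apply/funext => p; rewrite -(H p).2; congr (hat p _ _); exact: val_inj.
by apply: measurable_funM => //; exact: measurable_snd.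
Qed.

Lemma ae_neq_origin : {ae leb2 R, forall p, p != (0, 0)}.
Proof.
exists ([set (0 : R)] `*` [set (0 : R)]); split; first exact: measurableX.
  by rewrite leb2X// lebesgue_measure_set1 mule0.
by move=> [x y] /= /negP; rewrite negbK => /eqP[-> ->].
Qed.

End measurable_hat.

(** * Lower bound for the energy excess *)

Section bounded_weights.
Context {R : realType}.
Local Notation B := (unit_ball R).
Local Notation mu := (leb2 R).
Local Notation mB := (@measurable_unit_ball R).
Implicit Types w f g : R * R -> R.

Definition bounded_weight w :=
  measurable_fun B (w : plane R -> R) /\ exists M, forall p, B p -> `|w p| <= M.

Lemma bounded_weight_mul w f : bounded_weight w -> bounded_weight f ->
  bounded_weight (fun p => w p * f p).
Proof.
move=> [mw [M wM]] [mf [N fN]]; split; first exact: measurable_funM.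
by exists (M * N) => p Bp; rewrite normrM ler_pM// ?wM// fN.
Qed.

Lemma bounded_weight_sub w f : bounded_weight w -> bounded_weight f ->
  bounded_weight (fun p => w p - f p).
Proof.
move=> [mw [M wM]] [mf [N fN]]; split; first exact: measurable_funB.
by exists (M + N) => p Bp; rewrite (le_trans (ler_normB _ _))// lerD// ?wM// fN.
Qed.

Lemma bounded_weight_continuous w : continuous w -> bounded_weight w.
Proof.
move=> cw; split; first by apply: measurable_funTS; exact: continuous_measurable_plane.
have [M [_ HM]] := continuous_bounded_ball cw.
by exists (M + 1) => p Bp; apply: HM => //; lra.
Qed.

Lemma bounded_weight_hat (j : 'I_2) : bounded_weight (fun p => hat p j 0).
Proof.
split; first by apply: measurable_funTS; exact: measurable_hat.
by exists 1 => p _; exact: hat_bound.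
Qed.

Lemma integrable_weight w f : bounded_weight w -> mu.-integrable B (EFin \o f) ->
  mu.-integrable B (EFin \o (fun p => w p * f p)).
Proof. by move=> [mw [M wM]]; exact: (integrable_bounded_mul mB mw wM). Qed.

Lemma sqint_weight w f : bounded_weight w -> sqint mu B f -> sqint mu B (fun p => w p * f p).
Proof.
move=> bw [mf hf]; split; first by apply: measurable_funM => //; case: bw.
have := integrable_weight (bounded_weight_mul bw bw) hf.
by congr (mu.-integrable B _); apply/funext => p /=; congr EFin; ring.
Qed.

Lemma sqint_integrable f : sqint mu B f -> mu.-integrable B (EFin \o f).
Proof.
move=> hf; have := sqint_mul mB hf (sqint_cst mB 1 (@leb2_unit_ball_lty R)).
by congr (mu.-integrable B _); apply/funext => p /=; rewrite mulr1.
Qed.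

End bounded_weights.

Section excess.
Context {R : realType}.
Local Notation B := (unit_ball R).
Local Notation mu := (leb2 R).
Local Notation mB := (@measurable_unit_ball R).
Local Notation j0 := (ord0 : 'I_2).
Local Notation j1 := (lift ord0 ord0 : 'I_2).
Local Notation h1 p := (hat p j0 0).
Local Notation h2 p := (hat p j1 0).
Local Notation integ f := (mu.-integrable B (EFin \o f)).

(** The radial direction is bounded, so the density of a square-integrable
    gradient is integrable. *)
Lemma integrable_coord_density (eps : R) (a b c d : R * R -> R) :
  sqint mu B a -> sqint mu B b -> sqint mu B c -> sqint mu B d ->
  integ (fun p => coord_density eps (h1 p) (h2 p) (a p) (b p) (c p) (d p)).
Proof.
move=> ha hb hc hd.
have H1 f (hf : sqint mu B f) := sqint_weight (bounded_weight_hat j0) hf.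
have H2 f (hf : sqint mu B f) := sqint_weight (bounded_weight_hat j1) hf.
have := integrable_add mB
  (integrable_scale mB eps^-1 (integrable_add mB
     (proj2 (sqint_add mB (H1 _ ha) (H2 _ hc))) (proj2 (sqint_add mB (H1 _ hb) (H2 _ hd)))))
  (integrable_scale mB eps (integrable_add mB
     (proj2 (sqint_sub mB (H1 _ hd) (H2 _ hb))) (proj2 (sqint_sub mB (H2 _ ha) (H1 _ hc))))).
by congr (mu.-integrable B _); apply/funext => p /=; rewrite /coord_density; congr EFin; ring.
Qed.

Variables (a b c d : R * R -> R).
Hypotheses (ha : sqint mu B a) (hb : sqint mu B b) (hc : sqint mu B c) (hd : sqint mu B d).

Let Ftt p := hoop_strain (h1 p) (h2 p) (a p) (b p) (c p) (d p).

Let iFtt : integ Ftt.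
Proof.
have b11 := bounded_weight_mul (bounded_weight_hat (R := R) j0) (bounded_weight_hat j0).
have b12 := bounded_weight_mul (bounded_weight_hat (R := R) j0) (bounded_weight_hat j1).
have b22 := bounded_weight_mul (bounded_weight_hat (R := R) j1) (bounded_weight_hat j1).
have I f (hf : sqint mu B f) := sqint_integrable hf.
have := integrable_add mB (integrable_sub mB (integrable_sub mB
   (integrable_weight b22 (I _ ha)) (integrable_weight b12 (I _ hb)))
   (integrable_weight b12 (I _ hc))) (integrable_weight b11 (I _ hd)).
by congr (mu.-integrable B _); apply/funext => p /=; rewrite /Ftt /hoop_strain; congr EFin; ring.
Qed.

Let k (e : R) (p : R * R) : R := inv_weight e p * (p.1 ^+ 2 + p.2 ^+ 2).

Let k01 e p : 0 < e -> 0 <= k e p <= 1.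
Proof.
move=> e0; rewrite /k /inv_weight; have s0 : 0 <= p.1 ^+ 2 + p.2 ^+ 2 by rewrite addr_ge0// sqr_ge0.
apply/andP; split; first by rewrite mulr_ge0// invr_ge0; lra.
by rewrite ler_pdivrMl ?mulr1; lra.
Qed.

Let cX : continuous (fun p : R * R => p.1). Proof. exact: continuous_fst2. Qed.
Let cY : continuous (fun p : R * R => p.2). Proof. exact: continuous_snd2. Qed.
Let cQ e : 0 < e -> continuous (inv_weight e : R * R -> R).
Proof. by move=> e0; case: (inv_weight_C1 e0 j0). Qed.

Let bk e : 0 < e -> bounded_weight (k e).
Proof.
move=> e0; apply: bounded_weight_continuous; apply: contM; first exact: cQ.
by apply: contD; exact: contX.
Qed.

Let b1k e : 0 < e -> bounded_weight (fun p => 1 - k e p).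
Proof.
by move=> e0; apply: bounded_weight_sub; [apply: bounded_weight_continuous; exact: contC|exact: bk].
Qed.

(** The regularised identity controls the hoop strain only up to the factor
    [1 - k e p], which tends to 0 away from the origin. *)
Let residual_cvg0 :
  \int[mu]_(p in B) ((1 - k n.+1%:R^-1 p) * Ftt p) @[n --> \oo] --> (0 : R).
Proof.
have n0 n : 0 < (n.+1%:R^-1 : R) by rewrite invr_gt0.
have pt p : (1 - k n.+1%:R^-1 p) * Ftt p @[n --> \oo] --> (0 : R).
  (* At the origin [hat p] is zero, and so is the hoop strain. *)
  have [p0|/hat_polar[r [r0 rr _ _ _]]] := eqVneq p (0, 0).
    have E : Ftt p = 0.
      by have [] := hatE p; rewrite /Ftt /hoop_strain p0 /= !mul0r => -> ->; ring.
    by rewrite E; under eq_fun do rewrite mulr0; exact: cvg_cst.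
  rewrite -(mul0r (Ftt p)); apply: cvgM; last exact: cvg_cst.
  have s0 : 0 < p.1 ^+ 2 + p.2 ^+ 2 by rewrite -rr exprn_gt0.
  apply: (@squeeze_cvgr _ _ _ _ (fun _ => 0) (fun n => n.+1%:R^-1 * (p.1 ^+ 2 + p.2 ^+ 2)^-1)).
  - apply: nearW => n; have /andP[k0 k1] := k01 p (n0 n); apply/andP; split; first by rewrite subr_ge0.
    have w0 : 0 < p.1 ^+ 2 + p.2 ^+ 2 + n.+1%:R^-1 by rewrite addr_gt0.
    have -> : 1 - k n.+1%:R^-1 p = n.+1%:R^-1 * inv_weight n.+1%:R^-1 p.
      have w1 : inv_weight n.+1%:R^-1 p * (p.1 ^+ 2 + p.2 ^+ 2) + inv_weight n.+1%:R^-1 p * n.+1%:R^-1 = 1.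
        by rewrite -mulrDr mulVf// lt0r_neq0.
      by rewrite /k -[X in X - _]w1 addrAC subrr add0r mulrC.
    rewrite ler_wpM2l// ?(ltW (n0 n))// /inv_weight lef_pV2// ?posrE//.
    by rewrite lerDl ltW.
  - exact: cvg_cst.
  - rewrite -[X in _ --> X](mul0r (p.1 ^+ 2 + p.2 ^+ 2)^-1); apply: cvgM; last exact: cvg_cst.
    exact: cvg_harmonic.
have [|||||_ _] := @dominated_convergence _ _ _ mu B mB
  (fun n p => ((1 - k n.+1%:R^-1 p) * Ftt p)%:E) (cst 0%E) (fun p => (`|Ftt p|)%:E).
- move=> n; apply/measurable_EFinP; apply: integrable_measurable.
  exact: (integrable_weight (b1k (n0 n)) iFtt).
- exact: measurable_cst.
- by apply: aeW => p _; apply: cvg_EFin; [exact: nearW|exact: pt].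
- exact: (integrable_norm iFtt).
- apply: aeW => p n _ /=; rewrite lee_fin normrM ler_piMl// ger0_norm;
    have /andP[k0 k1] := k01 p (n0 n); lra.
rewrite integral0 => H.
exact: (fine_cvg H).
Qed.

Hypothesis L1 : forall e : R, 0 < e ->
  \int[mu]_(p in B) (log_weight e p * (a p + d p) + inv_weight e p *
    (p.2 ^+ 2 * a p - p.1 * p.2 * b p - p.1 * p.2 * c p + p.1 ^+ 2 * d p)) = 0.
Hypothesis L2 : \int[mu]_(p in B) (a p + d p) = 0.
Hypothesis L3 : forall e : R, 0 < e ->
  0 <= \int[mu]_(p in B) (2 * log_weight e p * (a p * d p - b p * c p) + inv_weight e p *
    ((p.1 * b p - p.2 * a p) ^+ 2 + (p.1 * d p - p.2 * c p) ^+ 2)).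
Hypothesis det1 : {ae mu, forall p, B p -> a p + d p + (a p * d p - b p * c p) = 0}.

Let S := \int[mu]_(p in B) (a p ^+ 2 + b p ^+ 2 + c p ^+ 2 + d p ^+ 2).

Let excess_approx (eps e : R) : 1 <= eps -> 0 < e ->
  2 * (eps - eps^-1) * \int[mu]_(p in B) ((1 - k e p) * Ftt p) + (2 / eps - eps) * S <=
  \int[mu]_(p in B) coord_density eps (h1 p) (h2 p) (1 + a p) (b p) (c p) (1 + d p)
  - \int[mu]_(p in B) coord_density eps (h1 p) (h2 p) 1 0 0 1.
Proof.
move=> e1 e0; have eps0 : 0 < eps by lra.
have c0 : 0 <= eps - eps^-1 by rewrite subr_ge0 (le_trans _ e1)// invf_le1.
have s1 : sqint mu B (fun _ => 1) := sqint_cst mB 1 (@leb2_unit_ball_lty R).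
have s0 : sqint mu B (fun _ => 0) := sqint_cst mB 0 (@leb2_unit_ball_lty R).
have iW := integrable_coord_density eps (sqint_add mB s1 ha) hb hc (sqint_add mB s1 hd).
have iI := integrable_coord_density eps s1 s0 s0 s1.
have I f (hf : sqint mu B f) := sqint_integrable hf.
have [cL _ _] := log_weight_C1 e0 j0.
have bL := bounded_weight_continuous cL; have bQ := bounded_weight_continuous (cQ e0).
have bX := bounded_weight_continuous cX; have bY := bounded_weight_continuous cY.
pose T1 p := a p + d p; have iT1 : integ T1 := I _ (sqint_add mB ha hd).
pose T2 p := log_weight e p * (a p + d p) + inv_weight e p *
    (p.2 ^+ 2 * a p - p.1 * p.2 * b p - p.1 * p.2 * c p + p.1 ^+ 2 * d p).
have iT2 : integ T2.
  apply: (integrable_add mB (integrable_weight bL iT1)); apply: (integrable_weight bQ).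
  have bXX := bounded_weight_mul bX bX; have bXY := bounded_weight_mul bX bY.
  have bYY := bounded_weight_mul bY bY.
  apply: (integrable_add mB); last exact: (integrable_weight bXX (I _ hd)).
  apply: (integrable_sub mB); last exact: (integrable_weight bXY (I _ hc)).
  apply: (integrable_sub mB); last exact: (integrable_weight bXY (I _ hb)).
  exact: (integrable_weight bYY (I _ ha)).
pose T3 p := 2 * log_weight e p * (a p * d p - b p * c p) + inv_weight e p *
    ((p.1 * b p - p.2 * a p) ^+ 2 + (p.1 * d p - p.2 * c p) ^+ 2).
have iT3 : integ T3.
  apply: (integrable_add mB).
    apply: (integrable_weight (w := fun p => 2 * log_weight e p)).
      by apply: bounded_weight_mul => //; apply: bounded_weight_continuous; exact: contC.
    exact: (integrable_sub mB (sqint_mul mB ha hd) (sqint_mul mB hb hc)).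
  apply: (integrable_weight bQ); apply: (integrable_add mB).
    exact: (proj2 (sqint_sub mB (sqint_weight bX hb) (sqint_weight bY ha))).
  exact: (proj2 (sqint_sub mB (sqint_weight bX hd) (sqint_weight bY hc))).
pose T4 p := (1 - k e p) * Ftt p; have iT4 : integ T4 := integrable_weight (b1k e0) iFtt.
pose T5 p := a p ^+ 2 + b p ^+ 2 + c p ^+ 2 + d p ^+ 2.
have iT5 : integ T5.
  exact: (integrable_add mB (integrable_add mB (integrable_add mB (proj2 ha) (proj2 hb)) (proj2 hc)) (proj2 hd)).
have i1 := integrable_scale mB (2 / eps) iT1.
have i2 := integrable_scale mB (2 * (eps - eps^-1)) iT2.
have i3 := integrable_scale mB (eps - eps^-1) iT3.
have i4 := integrable_scale mB (2 * (eps - eps^-1)) iT4.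
have i5 := integrable_scale mB (2 / eps - eps) iT5.
have i12 := integrable_add mB i1 i2; have i123 := integrable_add mB i12 i3.
have i1234 := integrable_add mB i123 i4; have iall := integrable_add mB i1234 i5.
have := ae_le_Rintegral mB iall (integrable_sub mB iW iI).
rewrite RintegralB; [|exact: mB|exact: iW|exact: iI].
rewrite (RintegralD mB i1234 i5) (RintegralD mB i123 i4) (RintegralD mB i12 i3) (RintegralD mB i1 i2).
rewrite (RintegralZl _ mB iT1) (RintegralZl _ mB iT2) (RintegralZl _ mB iT3).
rewrite (RintegralZl _ mB iT4) (RintegralZl _ mB iT5) (L1 e0) L2 !mulr0 !add0r => H.
have := mulr_ge0 c0 (L3 e0); rewrite -/T3 -/S -/T4.
suff Hae : {ae mu, forall p, B p ->
    2 / eps * T1 p + 2 * (eps - eps^-1) * T2 p + (eps - eps^-1) * T3 p + 2 * (eps - eps^-1) * T4 p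
     + (2 / eps - eps) * T5 p <=
    coord_density eps (h1 p) (h2 p) (1 + a p) (b p) (c p) (1 + d p) - coord_density eps (h1 p) (h2 p) 1 0 0 1}.
  by move: (H Hae); rewrite /S /T4 /T3; lra.
have F := ae_filter_ringOfSetsType mu.
apply: (filterS _ (filterI (@ae_neq_origin R) det1)) => p [p0 dp] Bp.
have [r [r0 rr xr yr hh]] := hat_polar p0.
have := density_excess (log_weight e p) e1 hh (k01 p e0) (dp Bp).
apply: le_trans; rewrite -/(Ftt p) le_eqVlt; apply/orP; left; apply/eqP.
have kF : k e p * Ftt p = inv_weight e p *
    (p.2 ^+ 2 * a p - p.1 * p.2 * b p - p.1 * p.2 * c p + p.1 ^+ 2 * d p).
  rewrite /k -rr xr yr /Ftt /hoop_strain; ring.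
have kZ : k e p * ((h1 p * b p - h2 p * a p) ^+ 2 + (h1 p * d p - h2 p * c p) ^+ 2) =
    inv_weight e p * ((p.1 * b p - p.2 * a p) ^+ 2 + (p.1 * d p - p.2 * c p) ^+ 2).
  rewrite /k -rr xr yr; ring.
by rewrite kF kZ.
Qed.

(** Let the regularisation parameter tend to 0 along [1 / (n + 1)]. *)
Lemma energy_excess (eps : R) : 1 <= eps ->
  (2 / eps - eps) * S <=
  \int[mu]_(p in B) coord_density eps (h1 p) (h2 p) (1 + a p) (b p) (c p) (1 + d p)
  - \int[mu]_(p in B) coord_density eps (h1 p) (h2 p) 1 0 0 1.
Proof.
move=> e1.
have cv : 2 * (eps - eps^-1) * \int[mu]_(p in B) ((1 - k n.+1%:R^-1 p) * Ftt p) + (2 / eps - eps) * S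
    @[n --> \oo] --> 2 * (eps - eps^-1) * 0 + (2 / eps - eps) * S.
  by apply: cvgD; [apply: cvgM; [exact: cvg_cst|exact: residual_cvg0]|exact: cvg_cst].
rewrite mulr0 add0r in cv; rewrite -(cvg_lim _ cv)//.
apply: limr_le; first by apply/cvg_ex; eexists; exact: cv.
by apply: nearW => n; apply: excess_approx => //; rewrite invr_gt0.
Qed.

End excess.

(** * Smooth bump functions on boxes *)

Section flat.
Context {R : realType}.

(** The functions [t ^- k * exp (- 1 / t)], extended by 0: a family of flat
    functions whose span is closed under differentiation. *)
Definition flat (k : nat) (t : R) : R :=
  if 0 < t then t^-1 ^+ k * expR (- t^-1) else 0.

Lemma deriveX1 (f : R -> R) (x df : R) n : is_derive x (1 : R) f df ->
  is_derive x (1 : R) (fun y => f y ^+ n) (n%:R * f x ^+ n.-1 * df).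
Proof.
move=> Df; elim: n => [|n IH]; first by rewrite !mul0r; exact: deriveC1.
under eq_fun do rewrite exprS.
apply: is_derive_eq (deriveM1 Df IH) _.
by case: n {IH} => [|n]; rewrite /= ?expr0 -?[n.+2]addn1 ?natrD ?exprS; ring.
Qed.

Lemma exprn_le_expR (k : nat) (y : R) : 0 <= y -> y ^+ k.+1 <= k.+1%:R ^+ k.+1 * expR y.
Proof.
move=> y0; have k0 : 0 < k.+1%:R :> R by [].
(* Since [1 + z <= exp z] for [z = y / (k + 1)]. *)
have -> : expR y = expR (y / k.+1%:R) ^+ k.+1.
  by rewrite -expRM_natl mulrC divfK// gt_eqF.
rewrite -exprMn ler_pXn2r// ?nnegrE ?mulr_ge0 ?expR_ge0//.
rewrite -ler_pdivrMl// [_ * y]mulrC; apply: le_trans (expR_ge1Dx _).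
by rewrite lerDr.
Qed.

Lemma flat_ge0 k t : 0 <= flat k t.
Proof.
rewrite /flat; case: ifP => // t0.
by rewrite mulr_ge0 ?expR_ge0// exprn_ge0// invr_ge0 ltW.
Qed.

(** The exponential beats every power; a quadratic bound is what gives a zero
    derivative at the origin. *)
Lemma flat_bound k : exists C, 0 <= C /\ forall t, flat k t <= C * t ^+ 2.
Proof.
exists (k.+2%:R ^+ k.+2); split; first by rewrite exprn_ge0.
move=> t; rewrite /flat; case: ifP => t0; last by apply: mulr_ge0; [exact: exprn_ge0|exact: sqr_ge0].
have ti : 0 < t^-1 by rewrite invr_gt0.
have H := exprn_le_expR k.+1 (ltW ti).
have E : expR (- t^-1) * expR t^-1 = 1 by rewrite -expRD addNr expR0.
have tt : t^-1 * t = 1 by rewrite mulVf// gt_eqF.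
have -> : t^-1 ^+ k * expR (- t^-1) = (t^-1 ^+ k.+2 * expR (- t^-1)) * t ^+ 2.
  rewrite (_ : k.+2 = (k + 2)%N) ?exprD ?addn2//.
  transitivity (t^-1 ^+ k * expR (- t^-1) * ((t^-1 * t) ^+ 2)); last by ring.
  by rewrite tt expr1n mulr1.
rewrite ler_wpM2r ?sqr_ge0//.
have := ler_wpM2r (expR_ge0 (- t^-1)) H.
by rewrite -[X in _ <= X]mulrA [expR t^-1 * _]mulrC E mulr1.
Qed.

Lemma is_derive_flat k (t : R) : is_derive t (1 : R) (flat k) (flat k.+2 t - k%:R * flat k.+1 t).
Proof.
have [t0|t0|->] := ltgtP t 0.
- have -> : flat k.+2 t - k%:R * flat k.+1 t = 0 by rewrite /flat ltNge (ltW t0)/= mulr0 subrr.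
  apply: near_eq_is_derive (deriveC1 0 t).
  near=> x; have x0 : x < 0 by near: x; exact: lt_nbhsl.
  by rewrite /flat ltNge (ltW x0).
- have tn : t != 0 by rewrite gt_eqF.
  have Di : is_derive t (1 : R) (fun x : R => x^-1) (- t^-1 ^+ 2).
    by rewrite -[X in is_derive _ _ _ X]mulr1 exprVn; exact: is_deriveV.
  have DN : is_derive t (1 : R) (fun x : R => - x^-1) (t^-1 ^+ 2).
    by rewrite -[t^-1 ^+ 2]opprK; exact: is_deriveN.
  have De := derive_comp1 (h := expR) (g := fun x : R => - x^-1) (is_derive_expR _) DN.
  have DX : is_derive t (1 : R) (fun x : R => x^-1 ^+ k) ((k%:R * t^-1 ^+ k.-1) * (- t^-1 ^+ 2)).
    exact: deriveX1.
  have D := deriveM1 DX De.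
  have E : t^-1 ^+ k * (expR (- t^-1) * t^-1 ^+ 2) + expR (- t^-1) * (k%:R * t^-1 ^+ k.-1 * - t^-1 ^+ 2) =
      flat k.+2 t - k%:R * flat k.+1 t.
    rewrite /flat t0; case: k {DX D} => [|k]; first by rewrite !expr0; ring.
    by rewrite /= !exprS; ring.
  rewrite -E; apply: near_eq_is_derive D.
  near=> x; have x0 : 0 < x by near: x; exact: lt_nbhsr.
  by rewrite /flat x0.
- have -> : flat k.+2 0 - k%:R * flat k.+1 0 = 0 by rewrite /flat ltxx mulr0 subrr.
  apply/is_derive_cvgP.
  have [C [C0 HC]] := flat_bound k.
  have f0 : flat k 0 = 0 by rewrite /flat ltxx.
  apply/cvgr0Pnorm_le => e e0.
  near=> h.
  rewrite addr0 f0 subr0 normrM normfV (ger0_norm (flat_ge0 _ _)).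
  have h0 : h != 0 by near: h; exact: nbhs_dnbhs_neq.
  have hn : 0 < `|h| by rewrite normr_gt0.
  rewrite ler_pdivrMl//; apply: (le_trans (HC h)).
  rewrite -real_normK ?num_real// expr2 mulrA mulrC ler_wpM2l//.
  have hC : `|h| * (C + 1) <= e.
    rewrite -ler_pdivlMr; last by lra.
    near: h; apply: dnbhs0_le.
    by rewrite divr_gt0//; lra.
  by have := normr_ge0 h; lra.
Unshelve. all: by end_near. Qed.
End flat.

Section bumps.
Context {R : realType}.

Lemma continuous_flat k : continuous (@flat R k).
Proof. by move=> t; apply/differentiable_continuous/derivable1_diffP; case: (is_derive_flat k t). Qed.

(** Induction on [n] for all [k] at once, because differentiation raises
    [k]. *)
Lemma Cn_flat n k (l : R * R -> R) (c : 'I_2 -> R) :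
  (forall j, C1_along j l (fun _ => c j)) -> Cn n (fun p => flat k (l p)).
Proof.
move=> Dl; have cl : continuous l by case: (Dl ord0).
elim: n k => [|n IH] k; first by split => //; apply: cont_comp => //; exact: continuous_flat.
apply: (Cn_intro (df := fun j p => (flat k.+2 (l p) - k%:R * flat k.+1 (l p)) * c j)) => j.
  have cd : continuous (fun t : R => flat k.+2 t - k%:R * flat k.+1 t).
    by apply: contB; [exact: continuous_flat|apply: contM; [exact: contC|exact: continuous_flat]].
  have := @C1_comp R j (flat k) (fun t => flat k.+2 t - k%:R * flat k.+1 t) l _ (fun p => cd (l p))
    (fun p => is_derive_flat k (l p)) (Dl j).
  exact.
apply: Cn_mul; last exact: Cn_cst.
have := Cn_add (IH k.+2) (Cn_mul (Cn_cst n (- k%:R)) (IH k.+1)).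
by congr Cn; apply/funext => p; rewrite mulNr.
Qed.

Lemma flat0_le1 (t : R) : flat 0 t <= 1.
Proof.
rewrite /flat; case: ifP => // t0; rewrite expr0 mul1r -expR0 ler_expR.
by rewrite oppr_le0 invr_ge0 ltW.
Qed.

Lemma flat0_gt0 (t : R) : (flat 0 t != 0) = (0 < t).
Proof.
rewrite /flat; case: ifP => t0; rewrite ?eqxx// expr0 mul1r.
by rewrite gt_eqF// expR_gt0.
Qed.

Lemma flat0_cvg (t : R) : 0 < t -> flat 0 (n.+1%:R * t) @[n --> \oo] --> (1 : R).
Proof.
move=> t0; have E : (fun n : nat => flat 0 (n.+1%:R * t)) = (fun n : nat => expR (- (n.+1%:R^-1 * t^-1))).
  by apply/funext => n; rewrite /flat mulr_gt0// expr0 mul1r invfM.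
have H : - (n.+1%:R^-1 * t^-1) @[n --> \oo] --> (0 : R).
  rewrite -oppr0; apply: cvgN; rewrite -(mul0r t^-1); apply: cvgM; last exact: cvg_cst.
  exact: cvg_harmonic.
rewrite E -[X in _ --> X]expR0; exact: (cvg_comp _ _ H (@continuous_expR R 0)).
Qed.

(** As [m] grows, these bumps increase to the indicator of the open box. *)
Definition box_bump (a b c d : R) (m : R) (p : R * R) : R :=
  (flat 0 (m * (p.1 - a)) * flat 0 (m * (b - p.1))) *
  (flat 0 (m * (p.2 - c)) * flat 0 (m * (d - p.2))).

Definition open_box (a b c d : R) : set (plane R) := `]a, b[%classic `*` `]c, d[%classic.

Lemma smooth_box_bump a b c d m : smooth (box_bump a b c d m).
Proof.
move=> n.
have X j := C1_fst (R := R) j; have Y j := C1_snd (R := R) j.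
have lin (l : R * R -> R) (dl : 'I_2 -> R) (r s : R) : (forall j, C1_along j l (fun _ => dl j)) ->
    Cn n (fun p => flat 0 (m * (r * l p - s))).
  move=> Dl; apply: (@Cn_flat n 0%N (fun p => m * (r * l p - s)) (fun j => m * (r * dl j))) => j.
  apply: C1_eq (C1M (C1C j m) (C1B (C1M (C1C j r) (Dl j)) (C1C j s))) => // p; ring.
have := Cn_mul (Cn_mul (lin _ _ 1 a X) (lin _ _ (-1) (- b) X)) (Cn_mul (lin _ _ 1 c Y) (lin _ _ (-1) (- d) Y)).
congr Cn; apply/funext => p; rewrite /box_bump !mul1r !mulN1r.
by rewrite !opprK -![_ + b]addrC -![_ + d]addrC.
Qed.

Lemma box_bump_bound a b c d m p : 0 <= box_bump a b c d m p <= 1.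
Proof.
by apply/andP; split; rewrite /box_bump; [rewrite !mulr_ge0 ?flat_ge0|rewrite !mulr_ile1 ?mulr_ge0 ?flat_ge0 ?flat0_le1].
Qed.

Lemma box_bump_out a b c d m p : 0 < m -> ~ open_box a b c d p -> box_bump a b c d m p = 0.
Proof.
move=> m0 np; apply/eqP; apply: contra_notT np.
rewrite /box_bump !mulf_eq0 !negb_or !flat0_gt0 !pmulr_rgt0// !subr_gt0 => /andP[/andP[h1 h2] /andP[h3 h4]].
by split; rewrite /= in_itv/= ?h1 ?h2 ?h3 ?h4.
Qed.

Lemma box_bump_cvg a b c d p : box_bump a b c d n.+1%:R p @[n --> \oo] --> (\1_(open_box a b c d) p : R).
Proof.
have [pb|npb] := pselect (open_box a b c d p).
  rewrite indicE mem_set//= -[X in _ --> X](mulr1 1) -[X in X * _](mulr1 1) -[X in _ * X](mulr1 1).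
  case: pb; rewrite /= !in_itv/= => /andP[h1 h2] /andP[h3 h4].
  by apply: cvgM; apply: cvgM; apply: flat0_cvg; rewrite subr_gt0.
rewrite indicE memNset//=; under eq_fun do rewrite box_bump_out//.
exact: cvg_cst.
Qed.

Lemma test_function_box_bump a b c d m : 0 < m ->
  `[a, b]%classic `*` `[c, d]%classic `<=` unit_ball R -> test_function (box_bump a b c d m).
Proof.
move=> m0 sub; split; first exact: smooth_box_bump.
exists (`[a, b]%classic `*` `[c, d]%classic); split => //.
  by apply: compact_setX; exact: segment_compact.
move=> p np; apply: box_bump_out => // -[p1 p2]; apply: np.
by split; apply: subset_itv_oo_cc.
Qed.

End bumps.

(** * The fundamental lemma of the calculus of variations *)

Section boxes_generate.
Context {R : realType}.

Definition open_boxes : set (set (plane R)) :=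
  [set A | exists a b c d, A = open_box a b c d].

Lemma measurable_open_box (a b c d : R) : measurable (open_box a b c d).
Proof. exact: measurableX. Qed.

Lemma open_boxI (a b c d a' b' c' d' : R) :
  open_box a b c d `&` open_box a' b' c' d' =
  open_box (Num.max a a') (Num.min b b') (Num.max c c') (Num.min d d').
Proof.
apply/seteqP; split => -[x y]; rewrite /open_box/= !in_itv/= !gt_max !lt_min.
  by move=> [[/andP[-> ->] /andP[-> ->]] [/andP[-> ->] /andP[-> ->]]].
by move=> [/andP[/andP[-> ->] /andP[-> ->]] /andP[/andP[-> ->] /andP[-> ->]]].
Qed.

Lemma setI_closed_open_boxes : setI_closed open_boxes.
Proof.
move=> _ _ [a [b [c [d ->]]]] [a' [b' [c' [d' ->]]]].
by rewrite open_boxI; do 4 eexists; reflexivity.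
Qed.

Let P := g_sigma_algebraType open_boxes.

Let box_measurable (a b c d : R) : measurable (open_box a b c d : set P).
Proof. by apply: sub_sigma_algebra; do 4 eexists; reflexivity. Qed.

Let le_bound (x : R) : exists n : nat, `|x| < n%:R.
Proof. by exists (Num.truncn `|x|).+1; exact: truncnS_gt. Qed.

Let measurable_fst_box : measurable_fun [set: P] (fst : P -> measurableTypeR R).
Proof.
apply: (measurability _ (RGenOInfty.measurableE R)) => _ [_ [x ->] <-].
rewrite setTI (_ : _ @^-1` _ = \bigcup_n (open_box x n%:R (- n%:R) n%:R : set P)).
  by apply: bigcupT_measurable.
apply/seteqP; split => [[s t] /=|[s t] [n _] [/=]]; rewrite !in_itv/= ?andbT.
  move=> xs; have [n ns] := le_bound (`|s| + `|t|).
  rewrite ger0_norm ?addr_ge0// in ns.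
  have := ler_norm s; have := normr_ge0 t; have := normr_ge0 s => s0 t0 ss.
  exists n => //; split; rewrite /= in_itv/= ?xs/=; first by lra.
  by rewrite -ltr_norml; lra.
by case/andP.
Qed.

Let measurable_snd_box : measurable_fun [set: P] (snd : P -> measurableTypeR R).
Proof.
apply: (measurability _ (RGenOInfty.measurableE R)) => _ [_ [x ->] <-].
rewrite setTI (_ : _ @^-1` _ = \bigcup_n (open_box (- n%:R) n%:R x n%:R : set P)).
  by apply: bigcupT_measurable.
apply/seteqP; split => [[s t] /=|[s t] [n _] [/=]]; rewrite !in_itv/= ?andbT.
  move=> xt; have [n ns] := le_bound (`|s| + `|t|).
  rewrite ger0_norm ?addr_ge0// in ns.
  have := ler_norm t; have := normr_ge0 t; have := normr_ge0 s => s0 t0 tt.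
  exists n => //; split; rewrite /= in_itv/= ?xt/=; last by lra.
  by rewrite -ltr_norml; lra.
by move=> _ /andP[].
Qed.

(** Open boxes generate the sigma-algebra of the plane and are stable under
    intersection, which is what Dynkin's lemma needs. *)
Lemma measurable_plane_boxes : @measurable _ (plane R) = <<s open_boxes >>.
Proof.
apply/seteqP; split.
  rewrite measurable_prod_measurableType; apply: smallest_sub.
    exact: smallest_sigma_algebra.
  move=> _ [A mA [D mD <-]].
  have -> : A `*` D = ((fst : P -> measurableTypeR R) @^-1` A) `&` ((snd : P -> measurableTypeR R) @^-1` D).
    by apply/seteqP; split.
  apply: (@measurableI _ P).
    by rewrite -[X in measurable X]setTI; exact: measurable_fst_box.
  by rewrite -[X in measurable X]setTI; exact: measurable_snd_box.
apply: smallest_sub; first by split; [exact: measurable0|by move=> A mA; rewrite setTD; exact: measurableC|exact: bigcupT_measurable].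
by move=> _ [a [b [c [d ->]]]]; exact: measurable_open_box.
Qed.

End boxes_generate.

Section fundamental_lemma.
Context {R : realType}.
Local Notation B := (unit_ball R).
Local Notation mu := (leb2 R).
Local Notation mB := (@measurable_unit_ball R).
Variable h : R * R -> R.
Hypothesis ih : mu.-integrable B (EFin \o h).
Hypothesis h0 : forall phi, test_function phi -> \int[mu]_(p in B) (h p * phi p) = 0.

Let closed_box (a b c d : R) : set (plane R) := `[a, b]%classic `*` `[c, d]%classic.

Let open_box_sub (a b c d : R) : closed_box a b c d `<=` B -> open_box a b c d `<=` B.
Proof.
move=> sub; apply: subset_trans sub => -[x y] [xI yI].
by split; exact: subset_itv_oo_cc.
Qed.

(** By dominated convergence along the bumps that tend to the indicator of the
    box. *)
Let box_integral0 (a b c d : R) : closed_box a b c d `<=` B ->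
  (\int[mu]_(p in open_box a b c d) (h p)%:E = 0)%E.
Proof.
move=> sub; pose Q := open_box a b c d.
have mh := integrable_measurable ih.
have bounded n : bounded_weight (box_bump a b c d n.+1%:R : R * R -> R).
  by apply: bounded_weight_continuous; exact: Cn_continuous (@smooth_box_bump R a b c d n.+1%:R 0%N).
have ibump n : mu.-integrable B (EFin \o (fun p => h p * box_bump a b c d n.+1%:R p)).
  have := integrable_weight (bounded n) ih.
  by congr (mu.-integrable B _); apply/funext => p /=; rewrite mulrC.
have zero n : (\int[mu]_(p in B) (h p * box_bump a b c d n.+1%:R p)%:E = 0)%E.
  rewrite -[LHS]fineK; last exact: (integrable_fin_num mB (ibump n)).
  by congr EFin; apply: h0; exact: test_function_box_bump.
have mQ : measurable Q by exact: measurable_open_box.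
have [|||||_ _] := @dominated_convergence _ _ _ mu B mB
  (fun n p => (h p * box_bump a b c d n.+1%:R p)%:E) (fun p => (h p * \1_Q p)%:E) (fun p => (`|h p|)%:E).
- by move=> n; apply/measurable_EFinP; exact: integrable_measurable (ibump n).
- by apply/measurable_EFinP; apply: measurable_funM => //; exact: measurable_funTS.
- apply: aeW => p _; apply: cvg_EFin; first exact: nearW.
  by apply: cvgM; [exact: cvg_cst|exact: box_bump_cvg].
- exact: integrable_norm ih.
- apply: aeW => p n _; rewrite /= lee_fin normrM ler_piMr//.
  by have /andP[? ?] := box_bump_bound a b c d n.+1%:R p; rewrite ger0_norm.
rewrite (_ : (fun n => _) = (fun _ => 0%E)); last by apply/funext => n; exact: zero.
move=> cv; have := cvg_unique (@ereal_hausdorff R) cv (cvg_cst _).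
rewrite -(setIidr (open_box_sub sub)) integral_mkcondr => <-.
apply: eq_integral => p _; rewrite /patch indicE -/Q.
by case: (p \in Q); rewrite ?mulr1 ?mulr0.
Qed.

(** The measurable sets [A] for which the integral vanishes form a Dynkin
    system; it contains the boxes, whose intersections with the given box are
    boxes with closure in the disc. *)
Let integral_sub_box0 (a b c d : R) (A : set (plane R)) : closed_box a b c d `<=` B ->
  measurable A -> (\int[mu]_(p in A `&` open_box a b c d) (h p)%:E = 0)%E.
Proof.
move=> sub; pose Q := open_box a b c d.
have mQ : measurable Q by exact: measurable_open_box.
have iQ : mu.-integrable Q (EFin \o h).
  by apply: integrableS ih => //; [exact: mB|exact: open_box_sub].
rewrite measurable_plane_boxes; move: A.
apply: (dynkin_induction (measurable_plane_boxes (R := R)) setI_closed_open_boxes).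
- by rewrite setTI; exact: box_integral0.
- move=> _ [a' [b' [c' [d' ->]]]]; rewrite open_boxI; apply: box_integral0.
  apply: subset_trans sub => -[x y] []; rewrite /= !in_itv/= !ge_max !le_min.
  move=> /andP[/andP[_ ax] /andP[_ xb]] /andP[/andP[_ cy] /andP[_ yd]].
  by split; rewrite /= in_itv/= ?ax ?cy.
- move=> S mS S0; have E : Q = (S `&` Q) `|` (~` S `&` Q) by rewrite -setIUl setUv setTI.
  have := box_integral0 sub; rewrite -/Q {1}E integral_setU//.
  + by rewrite S0 add0e.
  + exact: measurableI.
  + by apply: measurableI => //; exact: measurableC.
  + by rewrite -E; apply/measurable_EFinP; exact: integrable_measurable iQ.
  + by apply/disj_setPS => p [[Sp _] [nSp _]].
- move=> F mF tF F0; rewrite setI_bigcupl integral_bigcup.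
  + by apply: eseries0 => n _ _; exact: F0.
  + exact: trivIset_setIr.
  + by move=> n; exact: measurableI.
  + rewrite -setI_bigcupl; apply: integrableS iQ => //.
    by apply: measurableI => //; exact: bigcupT_measurable.
Qed.

Let ae_eq0_box (a b c d : R) : closed_box a b c d `<=` B ->
  mu.-negligible (open_box a b c d `&` [set p | h p != 0]).
Proof.
move=> sub; have mQ : measurable (open_box a b c d) by exact: measurable_open_box.
have iQ : mu.-integrable (open_box a b c d) (EFin \o h).
  by apply: integrableS ih => //; [exact: mB|exact: open_box_sub].
have [|E EQ mE|] := @integral_ae_eq _ _ _ mu _ mQ (cst 0%E) (EFin \o h) iQ.
- exact: measurable_cst.
- by rewrite integral0 -(setIidl EQ); exact: integral_sub_box0.
move=> N [mN N0 sN]; exists N; split => // p [Qp /eqP hp]; apply: sN => /= H.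
by apply: hp; case: (H Qp).
Qed.

(** Boxes with rational corners and closure in the disc cover the disc, and there
    are countably many. *)
Lemma test_function_ae0 : {ae mu, forall p, B p -> h p = 0}.
Proof.
pose G (i : (rat * rat) * (rat * rat)) : set (plane R) :=
  let a := ratr i.1.1 in let b := ratr i.1.2 in let c := ratr i.2.1 in let d := ratr i.2.2 in
  if `[< closed_box a b c d `<=` B >] then open_box a b c d `&` [set p | h p != 0] else set0.
pose F (n : nat) : set (plane R) := if unpickle n is Some i then G i else set0.
have FG i : F (pickle i) = G i by rewrite /F pickleK.
have nF n : mu.-negligible (F n).
  rewrite /F; case: unpickle => [i|]; last exact: negligible_set0.
  rewrite /G; case: ifPn => [/asboolP sub|_]; last exact: negligible_set0.
  exact: ae_eq0_box.
apply: negligibleS (negligible_bigcup nF) => -[x y] /= /not_implyP[Bxy hxy].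
have /nbhs_ballP[e /= e0 eB] := open_nbhs_nbhs (conj (@open_unit_ball R) Bxy).
have [r rx1 /andP[rx2 /andP[rx3 rx4]]] := rational_bracket x e0.
have [s sy1 /andP[sy2 /andP[sy3 sy4]]] := rational_bracket y e0.
exists (pickle (r, s)); first exact: I.
rewrite FG /G [(r, s).1]/= [(r, s).2]/=; case: ifPn => [_|/asboolP].
  split; first by split; rewrite /= in_itv/= ?rx2 ?sy2.
  exact/eqP.
case; move=> [a b] [] /=; rewrite !in_itv/= => /andP[ra ar] /andP[sb bs].
by apply: eB; split => /=; rewrite /ball/= ltr_norml; lra.
Qed.

End fundamental_lemma.

(** * The identity is admissible *)

Section identity_admissible.
Context {R : realType}.
Local Notation B := (unit_ball R).
Local Notation mu := (leb2 R).
Local Notation mB := (@measurable_unit_ball R).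
Local Notation j0 := (ord0 : 'I_2).
Local Notation j1 := (lift ord0 ord0 : 'I_2).
Local Notation co i := (@Defs.coord R i).

Lemma green_zero (j : 'I_2) (f df : R * R -> R) : C1_along j f df ->
  (forall p, p.1 ^+ 2 + p.2 ^+ 2 = 1 -> f p = 0) -> \int[mu]_(p in B) df p = 0.
Proof.
elim/ord2P: j => fdf f0.
  by rewrite (green_fst fdf); apply: circle_integral0 => p p1; rewrite f0// mul0r.
by rewrite (green_snd fdf); apply: circle_integral0 => p p1; rewrite f0// mul0r.
Qed.

Lemma test_function_circle (phi : R * R -> R) (p : R * R) : test_function phi ->
  p.1 ^+ 2 + p.2 ^+ 2 = 1 -> phi p = 0.
Proof.
move=> [_ [K [_ KB K0]]] p1; apply: K0 => /KB /unit_ballP.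
by rewrite p1 ltxx.
Qed.

Lemma test_function_continuous (phi : R * R -> R) : test_function phi -> continuous phi.
Proof. by move=> [sphi _]; exact: Cn_continuous (sphi 0%N). Qed.

(** A test function vanishes on the circle, so the divergence theorem has no
    boundary term. *)
Lemma weak_gradient_coord (i : 'I_2) : weak_gradient (co i) (fun _ => \row_j (i == j)%:R).
Proof.
move=> j; split.
  have -> : (fun x : R * R => (\row_j (i == j)%:R : 'rV[R]_2) 0 j) = fun _ => (i == j)%:R.
    by apply/funext => p; rewrite mxE.
  exact: (sqint_cst mB _ (@leb2_unit_ball_lty R)).
move=> phi tphi; have cphi := test_function_continuous tphi.
have Cphi : C1_along j phi (partial j phi) by apply: Cn_C1; exact: (proj1 tphi 1%N).
have [ccoord _ _] := C1_coord (R := R) i j; have [_ cdphi _] := Cphi.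
have := green_zero (C1M (C1_coord i j) Cphi).
have I1 : mu.-integrable B (EFin \o (fun p => co i p * partial j phi p)).
  by apply: integrable_continuous_ball; exact: contM.
have I2 : mu.-integrable B (EFin \o (fun p => phi p * (i == j)%:R)).
  by apply: integrable_continuous_ball; apply: contM => //; exact: contC.
rewrite (RintegralD mB I1 I2) => H.
have {}H : \int[mu]_(p in B) (co i p * partial j phi p) + \int[mu]_(p in B) (phi p * (i == j)%:R) = 0.
  by apply: H => p p1; rewrite (test_function_circle tphi p1) mulr0.
have E : \int[mu]_(p in B) ((\row_j (i == j)%:R : 'rV[R]_2) 0 j * phi p) = \int[mu]_(p in B) (phi p * (i == j)%:R).
  by apply: eq_Rintegral => p _; rewrite mxE mulrC.
by rewrite E; apply/eqP; rewrite -addr_eq0; apply/eqP.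
Qed.

Lemma W12_coord (i : 'I_2) : W12 (co i).
Proof.
split; last by eexists; exact: weak_gradient_coord.
by have [ccoord _ _] := C1_coord (R := R) i j0; exact: sqint_continuous.
Qed.

(** [wgrad] is some weak gradient, selected by choice; only the fundamental lemma
    tells that it is the classical one, and only almost everywhere. *)
Lemma wgrad_coord_ae (i j : 'I_2) : {ae mu, forall p, B p -> wgrad (co i) p 0 j = (i == j)%:R}.
Proof.
have [hw iw] := weak_gradient_wgrad (W12_coord i) j.
have [_ ic] := weak_gradient_coord i j.
have hc : sqint mu B (fun _ => (i == j)%:R : R) := sqint_cst mB _ (@leb2_unit_ball_lty R).
have ih := sqint_integrable (sqint_sub mB hw hc).
have H phi : test_function phi ->
    \int[mu]_(p in B) ((wgrad (co i) p 0 j - (i == j)%:R) * phi p) = 0.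
  move=> tphi; have bphi := bounded_weight_continuous (test_function_continuous tphi).
  have I1 := integrable_weight bphi (sqint_integrable hw).
  have I2 := integrable_weight bphi (sqint_integrable hc).
  transitivity (\int[mu]_(p in B) (phi p * wgrad (co i) p 0 j - phi p * (i == j)%:R)).
    by apply: eq_Rintegral => p _; ring.
  rewrite (RintegralB mB I1 I2); apply/eqP; rewrite subr_eq0; apply/eqP.
  apply: oppr_inj.
  transitivity (\int[mu]_(p in B) (co i p * partial j phi p)).
    by rewrite (iw _ tphi); congr (- _); apply: eq_Rintegral => p _; rewrite mulrC.
  by rewrite (ic _ tphi); congr (- _); apply: eq_Rintegral => p _; rewrite mxE mulrC.
have F := ae_filter_ringOfSetsType mu.
apply: filterS (test_function_ae0 ih H) => p H0 Bp.
by apply/eqP; rewrite -subr_eq0; apply/eqP; exact: H0.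
Qed.

(** The coordinate is smooth and approximates itself. *)
Lemma has_trace_coord (i : 'I_2) : has_trace (co i) (co i).
Proof.
exists (fun _ => co i); split.
- by move=> _ n; exact: Cn_coord.
- exact: sqcvg_cst.
- move=> j.
  have -> : (fun k : nat => \int[mu]_(x in B) ((partial j (co i) x - wgrad (co i) x 0 j) ^+ 2)%:E)%E =
      fun _ => 0%E; last exact: cvg_cst.
  apply/funext => _.
  have F := ae_filter_ringOfSetsType mu.
  have dE p : partial j (co i) p = (i == j)%:R.
    by have [_ _ D] := C1_coord (R := R) i j; rewrite /partial derive_val.
  have [hw _] := weak_gradient_wgrad (W12_coord i) j.
  have hc : sqint mu B (fun _ => (i == j)%:R : R) := sqint_cst mB _ (@leb2_unit_ball_lty R).
  transitivity (\int[mu]_(x in B) (cst 0%E x))%E; last by rewrite integral0.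
  apply: ae_eq_integral; [exact: mB| |exact: measurable_cst|].
    under eq_fun do rewrite dE.
    by apply/measurable_EFinP; exact: integrable_measurable (proj2 (sqint_sub mB hc hw)).
  apply: filterS (wgrad_coord_ae i j) => p H Bp.
  by rewrite dE H// subrr expr0n.
- exact: sqcvg_cst.
Qed.

Lemma nabla_id_ae : {ae mu, forall p, B p -> nabla (idfun : R * R -> R * R) p = 1%:M}.
Proof.
have F := ae_filter_ringOfSetsType mu.
apply: (filterS _ (filterI (filterI (wgrad_coord_ae j0 j0) (wgrad_coord_ae j0 j1))
  (filterI (wgrad_coord_ae j1 j0) (wgrad_coord_ae j1 j1)))) => p [[H00 H01] [H10 H11]] Bp; apply/matrixP => i j; rewrite !mxE.
by elim/ord2P: i; elim/ord2P: j; [exact: H00|exact: H01|exact: H10|exact: H11].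
Qed.

Lemma Ac_id : Ac R (idfun : R * R -> R * R).
Proof.
split; [exact: W12_coord|exact: has_trace_coord|].
have F := ae_filter_ringOfSetsType mu.
by apply: filterS nabla_id_ae => p H Bp; rewrite H// det1.
Qed.

End identity_admissible.

(** * Minimality and uniqueness *)

Section minimality.
Context {R : realType}.
Local Notation B := (unit_ball R).
Local Notation mu := (leb2 R).
Local Notation mB := (@measurable_unit_ball R).
Local Notation j0 := (ord0 : 'I_2).
Local Notation j1 := (lift ord0 ord0 : 'I_2).
Local Notation h1 p := (hat p j0 0).
Local Notation h2 p := (hat p j1 0).
Local Notation integ f := (mu.-integrable B (EFin \o f)).

Lemma ae_eq0_of_Rintegral_le0 (f : R * R -> R) : integ f -> (forall p, 0 <= f p) ->
  \int[mu]_(p in B) f p <= 0 -> {ae mu, forall p, B p -> f p = 0}.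
Proof.
move=> hf f0 If.
have mf : measurable_fun B (EFin \o f) by apply/measurable_EFinP; exact: integrable_measurable hf.
have E : (\int[mu]_(p in B) `|(EFin \o f) p| = 0)%E.
  transitivity (\int[mu]_(p in B) (EFin \o f) p)%E.
    by apply: eq_integral => p _ /=; rewrite ger0_norm.
  rewrite -(fineK (integrable_fin_num mB hf)); congr EFin.
  by apply/le_anti; rewrite If Rintegral_ge0// => p _.
have F := ae_filter_ringOfSetsType mu.
have := (ae_eq_integral_abs mu mB mf).1 E.
by apply: filterS => p H Bp; have [] := H Bp.
Qed.

Variable v : R * R -> R * R.
Hypothesis Av : Ac R v.

Let dis (i j : 'I_2) p := wgrad (fun y => Defs.coord i (v y)) p 0 j - (i == j)%:R.
Let u (i : 'I_2) p := Defs.coord i (v p) - Defs.coord i p.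
Local Notation a := (dis j0 j0).
Local Notation b := (dis j0 j1).
Local Notation c := (dis j1 j0).
Local Notation d := (dis j1 j1).

Let approx i : exists phi_ a_ b_,
  trace_zero_approx (u i) (dis i j0) (dis i j1) phi_ a_ b_.
Proof. by have [Wv tv _] := Av; exact: (trace_coord_approx (Wv i) (tv i)). Qed.

Let hdis i j : sqint mu B (dis i j).
Proof.
have [phi_ [a_ [b_ [_ [_ ha hb] _ _]]]] := approx i.
by elim/ord2P: j.
Qed.

Let nablaE p : [/\ nabla v p j0 j0 = 1 + a p, nabla v p j0 j1 = b p,
  nabla v p j1 j0 = c p & nabla v p j1 j1 = 1 + d p].
Proof. by rewrite /dis !mxE; split; rewrite /= ?subr0// addrC subrK. Qed.

Let det1 : {ae mu, forall p, B p -> a p + d p + (a p * d p - b p * c p) = 0}.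
Proof.
have [_ _ D] := Av; have F := ae_filter_ringOfSetsType mu.
apply: filterS D => p H Bp; have := H Bp; have [n00 n01 n10 n11] := nablaE p.
by rewrite det22 n00 n01 n10 n11; lra.
Qed.

Let iD (eps : R) : integ (fun p => coord_density eps (h1 p) (h2 p) (1 + a p) (b p) (c p) (1 + d p)).
Proof.
have s1 : sqint mu B (fun _ => 1) := sqint_cst mB 1 (@leb2_unit_ball_lty R).
exact: (integrable_coord_density eps (sqint_add mB s1 (hdis j0 j0)) (hdis j0 j1) (hdis j1 j0)
  (sqint_add mB s1 (hdis j1 j1))).
Qed.

Let DenergyE (eps : R) : Denergy eps v =
  (\int[mu]_(p in B) coord_density eps (h1 p) (h2 p) (1 + a p) (b p) (c p) (1 + d p))%:E.
Proof.
rewrite /Rintegral fineK; last exact: (integrable_fin_num mB (iD eps)).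
apply: eq_integral => p _; congr EFin; have [n00 n01 n10 n11] := nablaE p.
by rewrite -/(density eps (nabla v p) (hat p)) densityE n00 n01 n10 n11.
Qed.

Lemma Denergy_fin_num (eps : R) : Denergy eps v \is a fin_num.
Proof. by rewrite DenergyE. Qed.

Lemma Denergy_excess (eps : R) : 1 <= eps ->
  (2 / eps - eps) * \int[mu]_(p in B) (a p ^+ 2 + b p ^+ 2 + c p ^+ 2 + d p ^+ 2) <=
  fine (Denergy eps v) - \int[mu]_(p in B) coord_density eps (h1 p) (h2 p) 1 0 0 1.
Proof.
move=> e1; rewrite DenergyE.
have [u_ [a_ [b_ Hu]]] := approx j0; have [v_ [c_ [d_ Hv]]] := approx j1.
apply: (energy_excess (hdis j0 j0) (hdis j0 j1) (hdis j1 j0) (hdis j1 j1)) => //.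
- exact: limit_log_weight_divergence Hu Hv.
- exact: limit_divergence Hu Hv.
- exact: limit_quadratic_ge0 Hu Hv.
Qed.

(** A zero gradient and the divergence identity for the square of the
    displacement make the displacement zero. *)
Lemma gradient_id_rigid : \int[mu]_(p in B) (a p ^+ 2 + b p ^+ 2 + c p ^+ 2 + d p ^+ 2) <= 0 ->
  {ae mu, forall p, B p -> v p = p}.
Proof.
move=> S0; have F := ae_filter_ringOfSetsType mu.
have iS := integrable_add mB (integrable_add mB (integrable_add mB (proj2 (hdis j0 j0))
  (proj2 (hdis j0 j1))) (proj2 (hdis j1 j0))) (proj2 (hdis j1 j1)).
have /(ae_eq0_of_Rintegral_le0 iS) : forall p, 0 <= a p ^+ 2 + b p ^+ 2 + c p ^+ 2 + d p ^+ 2.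
  by move=> p; rewrite !addr_ge0// sqr_ge0.
move=> /(_ S0) Z.
have dis0 i j : {ae mu, forall p, B p -> dis i j p = 0}.
  apply: filterS Z => p /[apply] /eqP.
  rewrite !paddr_eq0 ?addr_ge0 ?sqr_ge0// !sqrf_eq0 => /andP[/andP[/andP[/eqP Ha /eqP Hb] /eqP Hc] /eqP Hd].
  by elim/ord2P: i; elim/ord2P: j.
have u0 i : {ae mu, forall p, B p -> u i p = 0}.
  have [u_ [a_ [b_ Hu]]] := approx i; have [_ [hu _ _] _ _] := Hu.
  have iu := proj2 hu.
  have : {ae mu, forall p, B p -> u i p ^+ 2 = 0}.
    apply: (ae_eq0_of_Rintegral_le0 iu) => [p|]; first exact: sqr_ge0.
    have mu2 : measurable_fun B (fun p : plane R => 2 * u i p ^+ 2).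
      by apply: measurable_funM => //; exact: integrable_measurable iu.
    have E : \int[mu]_(p in B) (2 * u i p ^+ 2) = 0.
      rewrite -(limit_square_divergence Hu); apply: ae_eq_Rintegral; [exact: mB|exact: mu2| |].
        have ma := (hdis i j0).1; have mb := (hdis i j1).1; have mu1 := hu.1.
        have mX : measurable_fun B (fun p : plane R => p.1) by apply: measurable_funTS; exact: measurable_fst.
        have mY : measurable_fun B (fun p : plane R => p.2) by apply: measurable_funTS; exact: measurable_snd.
        by do !(apply: measurable_funD || apply: measurable_funM) => //; exact: measurable_cst.
      apply: (filterS _ (filterI (dis0 i j0) (dis0 i j1))) => p [Ha Hb] Bp.
      by rewrite Ha// Hb// !mulr0 !addr0 expr2.
    rewrite (RintegralZl _ mB iu) in E; have := E; lra.
  by apply: filterS => p /[apply] /eqP; rewrite sqrf_eq0 => /eqP.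
apply: (filterS _ (filterI (u0 j0) (u0 j1))) => p [U0 U1] Bp.
rewrite (surjective_pairing (v p)) [RHS]surjective_pairing.
by congr pair; apply/eqP; rewrite -subr_eq0; apply/eqP; [exact: U0|exact: U1].
Qed.

End minimality.

Section identity_energy.
Context {R : realType}.
Local Notation B := (unit_ball R).
Local Notation mu := (leb2 R).
Local Notation j0 := (ord0 : 'I_2).
Local Notation j1 := (lift ord0 ord0 : 'I_2).

Lemma Denergy_id (eps : R) : Denergy eps (idfun : R * R -> R * R) =
  (\int[mu]_(p in B) coord_density eps (hat p j0 0) (hat p j1 0) 1 0 0 1)%:E.
Proof.
have mB := @measurable_unit_ball R.
have s1 : sqint mu B (fun _ => 1) := sqint_cst mB 1 (@leb2_unit_ball_lty R).
have s0 : sqint mu B (fun _ => 0) := sqint_cst mB 0 (@leb2_unit_ball_lty R).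
have iI := integrable_coord_density eps s1 s0 s0 s1.
have W i j : sqint mu B (fun p => nabla (idfun : R * R -> R * R) p i j).
  under eq_fun do rewrite mxE.
  exact: (weak_gradient_wgrad (W12_coord i) j).1.
have iN := integrable_coord_density eps (W j0 j0) (W j0 j1) (W j1 j0) (W j1 j1).
rewrite /Rintegral fineK; last exact: integrable_fin_num.
transitivity (\int[mu]_(p in B) (coord_density eps (hat p j0 0) (hat p j1 0)
  (nabla idfun p j0 j0) (nabla idfun p j0 j1) (nabla idfun p j1 j0) (nabla idfun p j1 j1))%:E)%E.
  by apply: eq_integral => p _; rewrite -/(density eps (nabla _ p) (hat p)) densityE.
apply: ae_eq_integral; [exact: mB|exact: measurable_int iN|exact: measurable_int iI|].
have F := ae_filter_ringOfSetsType mu.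
by apply: filterS nabla_id_ae => p H Bp; rewrite H// !mxE.
Qed.

Lemma sqrt2_gap (eps : R) : 0 < eps -> (0 <= 2 / eps - eps) = (eps <= Num.sqrt 2) /\
  (0 < 2 / eps - eps) = (eps < Num.sqrt 2).
Proof.
move=> e0; rewrite subr_ge0 subr_gt0 ler_pdivlMr// ltr_pdivlMr// -expr2.
set s : R := Num.sqrt 2; have s0 : 0 <= s by exact: sqrtr_ge0.
have -> : 2 = s ^+ 2 by rewrite sqr_sqrtr.
by split; rewrite (ler_sqr, ltr_sqr) ?nnegrE ?(ltW e0).
Qed.

Lemma id_global_minimizer (eps : R) : 1 <= eps -> eps <= Num.sqrt 2 ->
  global_minimizer (Denergy eps) (Ac R) (idfun : R * R -> R * R).
Proof.
move=> e1 e2; have e0 : 0 < eps by exact: lt_le_trans e1.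
split; [exact: Ac_id|move=> w Aw].
rewrite Denergy_id -(fineK (Denergy_fin_num Aw eps)) lee_fin -subr_ge0.
apply: le_trans (Denergy_excess Aw e1); apply: mulr_ge0.
  by rewrite (sqrt2_gap e0).1.
by apply: Rintegral_ge0 => p _; rewrite !addr_ge0// sqr_ge0.
Qed.

Lemma global_minimizer_unique (eps : R) (w : R * R -> R * R) : 1 <= eps -> eps < Num.sqrt 2 ->
  global_minimizer (Denergy eps) (Ac R) w -> {ae mu, forall p, B p -> w p = p}.
Proof.
move=> e1 e2 [Aw /(_ _ (@Ac_id R))]; have e0 : 0 < eps by exact: lt_le_trans e1.
rewrite Denergy_id -(fineK (Denergy_fin_num Aw eps)) lee_fin => min.
apply: (gradient_id_rigid Aw).
have gap : 0 < 2 / eps - eps by rewrite (sqrt2_gap e0).2.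
rewrite -(pmulr_rle0 _ gap); apply: le_trans (Denergy_excess Aw e1) _.
by rewrite subr_le0.
Qed.

End identity_energy.

Theorem theorem4p2 (R : realType) :
  (forall eps : R, 1 < eps -> eps < Num.sqrt 2 ->
     global_minimizer (Denergy eps) (Ac R) idfun /\
     forall w : R * R -> R * R,
       global_minimizer (Denergy eps) (Ac R) w ->
       {ae leb2 R, forall x, unit_ball R x -> w x = x}) /\
  global_minimizer (Denergy (Num.sqrt 2 : R)) (Ac R) idfun.
Proof.
split=> [eps /ltW e1 e2|].
  split; first by apply: id_global_minimizer => //; exact: ltW.
  by move=> w; exact: global_minimizer_unique.
apply: id_global_minimizer => //.
by rewrite -[X in X <= _]sqrtr1 ler_wsqrtr// ler1n.
Qed.
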